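(* Let $f\in W^{1,1}(\mathbb{R}^n)\cap W^{1,\infty}(\mathbb{R}^n)$ be nonnegative. Then the following inequalities hold (those with $\pm$ for each choice of sign, the same on both sides): (i) For any fixed $s\in(0,1)$, $$|\Pi^{\ast,s}_{\infty,\pm}f|^{-\frac sn}\ge|\Pi^{\ast,s}_{\infty,\pm}f^\star|^{-\frac sn}\quad\text{and}\quad|\Pi^{\ast,s}_{\infty}f|^{-\frac sn}\ge|\Pi^{\ast,s}_{\infty}f^\star|^{-\frac sn}.$$ (ii) $$|\Pi^{\ast}_{\infty,\pm}f|^{-\frac1n}\ge|\Pi^{\ast}_{\infty,\pm}f^\star|^{-\frac1n}\quad\text{and}\quad|\Pi^{\ast}_{\infty}f|^{-\frac1n}\ge|\Pi^{\ast}_{\infty}f^\star|^{-\frac1n}.$$ Equality holds in all the inequalities in (i) and (ii) if $f$ is a translate of $f^\star\circ\phi$ for some $\phi\in\mathrm{SL}(n)$.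
   Context: $a_+=\max\{a,0\}$, $a_-=\max\{-a,0\}$; $|\cdot|$ applied to a set is Lebesgue measure. $W^{1,p}(\mathbb{R}^n)=\{f\in L^p: |\nabla f|\in L^p\}$; elements of $W^{1,\infty}(\mathbb{R}^n)$ are identified with their Lipschitz representatives. For a measurable set $E$ of finite measure, $E^\star$ is the Euclidean ball centered at the origin with the same volume as $E$. For a nonnegative $f$ the Schwarz symmetral is $f^\star(x)=\int_0^\infty \mathbf 1_{\{f\ge t\}^\star}(x)\,dt$; for $f$ as in the claim one has $f^\star\in W^{1,1}(\mathbb{R}^n)\cap W^{1,\infty}(\mathbb{R}^n)$. For a set $K\subset\mathbb{R}^n$ star-shaped with respect to the origin, the gauge function is $\|x\|_K=\inf\{\lambda>0: x\in\lambda K\}$ and $|K|=\frac1n\int_{\mathbb{S}^{n-1}}\|\xi\|_K^{-n}\,d\xi$. For $g\in W^{1,1}(\mathbb{R}^n)\cap W^{1,\infty}(\mathbb{R}^n)$ and $s\in(0,1)$, the following sets are defined through their gauge functions (a set with prescribed gauge $\|\cdot\|$ being $\{\xi:\|\xi\|\le 1\}$), $\xi\in\mathbb{R}^n$: - $\|\xi\|_{\Pi^{\ast,s}_\infty g}^{s}=\sup_{(x,t)\in\mathbb{R}^n\times(0,\infty)}t^{-s}|g(x+t\xi)-g(x)|$; - $\|\xi\|_{\Pi^{\ast,s}_{\infty,\pm} g}^{s}=\sup_{(x,t)\in\mathbb{R}^n\times(0,\infty)}t^{-s}(g(x+t\xi)-g(x))_\pm$; - $\|\xi\|_{\Pi^\ast_\infty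 g}=\operatorname{ess\,sup}_{x\in\mathbb{R}^n}|\langle\nabla g(x),\xi\rangle|$; - $\|\xi\|_{\Pi^\ast_{\infty,\pm} g}=\operatorname{ess\,sup}_{x\in\mathbb{R}^n}\langle\nabla g(x),\xi\rangle_\pm$. Convention for $f=0$ (all sets equal $\mathbb{R}^n$): $\infty^{-a}=0$ for $a>0$. *)

(* Defs.v *)
From HB Require Import structures.
From mathcomp Require Import all_boot all_order all_algebra.
From mathcomp Require Import all_classical all_reals all_analysis.
From mathcomp Require Import ess_sup_inf.

Set Implicit Arguments.
Unset Strict Implicit.
Unset Printing Implicit Defensive.

Import Order.TTheory GRing.Theory Num.Def Num.Theory.
Import numFieldNormedType.Exports.

Local Open Scope classical_set_scope.
Local Open Scope ring_scope.

(* Points of R^n are row vectors.  The norm that the library puts on 'rV[R]_n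
   is the sup norm: it is used below only for topology, derivatives and
   Lipschitz continuity, where all norms are equivalent. *)

Section euclidean.
Context {R : realType} {n : nat}.
Implicit Types (x y : 'rV[R]_n) (r : R).

Definition dotp x y : R := \sum_i x 0 i * y 0 i.

Definition enorm x : R := Num.sqrt (dotp x x).

Definition eball r : set 'rV[R]_n := [set x | enorm x < r].

End euclidean.

Definition rV_display : measure_display.
Proof. exact: default_measure_display. Qed.

(* The Borel sigma-algebra of R^n, generated by the coordinate functions. *)
Section measurable_rV.
Context {R : realType} {n : nat}.

Let coors (i : 'I_n) (x : 'rV[R]_n) : measurableTypeR R := x 0 i.

Let rV_set0 : g_sigma_preimage coors set0.
Proof. exact: sigma_algebra0. Qed.

Let rV_setC A : g_sigma_preimage coors A -> g_sigma_preimage coors (~` A).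
Proof. exact: sigma_algebraC. Qed.

Let rV_bigcup (F : (set _)^nat) : (forall i, g_sigma_preimage coors (F i)) ->
  g_sigma_preimage coors (\bigcup_i (F i)).
Proof. exact: sigma_algebra_bigcup. Qed.

HB.instance Definition _ := @isMeasurable.Build rV_display
  'rV[R]_n (g_sigma_preimage coors) rV_set0 rV_setC rV_bigcup.

Lemma measurable_coor (i : 'I_n) :
  measurable_fun [set: 'rV[R]_n] (fun x => x 0 i : measurableTypeR R).
Proof.
move=> _ Y mY; rewrite setTI; apply: sub_sigma_algebra => /=.
rewrite -bigcup_seq/=; exists i => /=; first by rewrite mem_index_enum.
by exists Y => //; rewrite setTI.
Qed.

Lemma measurable_fun_coorP d (T : measurableType d) (f : T -> 'rV[R]_n) :
  (forall i, measurable_fun [set: T] (fun x => f x 0 i : measurableTypeR R)) ->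
  measurable_fun [set: T] f.
Proof.
move=> mf _ A mA; rewrite setTI.
suff : [set B | d.-measurable (f @^-1` B)] A by [].
apply: (smallest_sub _ _ mA).
  split => /=.
  - by rewrite preimage_set0.
  - by move=> B mB; rewrite setTD preimage_setC; exact: measurableC.
  - by move=> F mF; rewrite preimage_bigcup; exact: bigcup_measurable.
rewrite -bigcup_seq/= => B [i _] [C mC <-] /=.
by rewrite setTI -comp_preimage -[X in measurable X]setTI; exact: mf.
Qed.

End measurable_rV.

(* Lebesgue measure on R^n, by iterated products along R^(n+1) = R x R^n. *)
Section lebesgue_rV.
Context {R : realType}.

Definition cons_rV n (p : measurableTypeR R * 'rV[R]_n) : 'rV[R]_n.+1 :=
  row_mx (const_mx p.1 : 'rV_1) p.2.

Definition uncons_rV n (v : 'rV[R]_n.+1) : measurableTypeR R * 'rV[R]_n :=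
  (v 0 ord0, \row_j v 0 (lift ord0 j)).

Lemma cons_rV0 n p : @cons_rV n p 0 ord0 = p.1.
Proof.
rewrite /cons_rV mxE; case: splitP => [j _|k /= /eqP]; first by rewrite mxE.
by rewrite add1n.
Qed.

Lemma cons_rVS n p j : @cons_rV n p 0 (lift ord0 j) = p.2 0 j.
Proof.
rewrite /cons_rV mxE; case: splitP => [k|k] /=.
  by rewrite ord1 /bump.
by rewrite /bump/= !add1n => -[jk]; congr (p.2 0 _); exact/val_inj.
Qed.

Lemma cons_rVK n : cancel (@cons_rV n) (@uncons_rV n).
Proof.
move=> p; rewrite /uncons_rV cons_rV0 [RHS]surjective_pairing; congr pair.
by apply/rowP => j; rewrite mxE cons_rVS.
Qed.

Lemma uncons_rVK n : cancel (@uncons_rV n) (@cons_rV n).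
Proof.
move=> v; apply/rowP => i; case: (unliftP ord0 i) => [j|] ->.
  by rewrite cons_rVS mxE.
by rewrite cons_rV0.
Qed.

Lemma measurable_cons_rV n : measurable_fun setT (@cons_rV n).
Proof.
apply: measurable_fun_coorP => i; case: (unliftP ord0 i) => [j|] ->.
  under eq_fun do rewrite cons_rVS.
  exact: (measurableT_comp (@measurable_coor _ _ j) measurable_snd).
under eq_fun do rewrite cons_rV0.
exact: measurable_fst.
Qed.

Lemma measurable_uncons_rV n : measurable_fun setT (@uncons_rV n).
Proof.
apply/measurable_fun_pairP; split; first exact: measurable_coor.
apply: measurable_fun_coorP => i /=.
under eq_fun do rewrite mxE.
exact: measurable_coor.
Qed.

HB.instance Definition _ n :=
  isMeasurableFun.Build _ _ _ _ (@cons_rV n) (@measurable_cons_rV n).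

Section step.
Variables (n : nat) (m : {sigma_finite_measure set 'rV[R]_n -> \bar R}).
Local Open Scope ereal_scope.

Definition lebesgue_rV_step : set 'rV[R]_n.+1 -> \bar R :=
  pushforward (@lebesgue_measure R \x m) (@cons_rV n).

Let step0 : lebesgue_rV_step set0 = 0.
Proof. exact: measure0. Qed.

Let step_ge0 A : 0 <= lebesgue_rV_step A.
Proof. exact: measure_ge0. Qed.

Let step_sigma_additive : semi_sigma_additive lebesgue_rV_step.
Proof. exact: measure_semi_sigma_additive. Qed.

HB.instance Definition _ := isMeasure.Build _ _ _ lebesgue_rV_step
  step0 step_ge0 step_sigma_additive.

Let step_sigma_finite : sigma_finite setT lebesgue_rV_step.
Proof.
have /sigma_finiteP[F [FT ndF Foo]] := sigma_finiteT (@lebesgue_measure R).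
have /sigma_finiteP[G [GT ndG Goo]] := sigma_finiteT m.
exists (fun k => @uncons_rV n @^-1` (F k `*` G k)).
  apply/seteqP; split=> // v _.
  have [k _ Fk] : (\bigcup_k F k) (uncons_rV v).1 by rewrite -FT.
  have [l _ Gl] : (\bigcup_k G k) (uncons_rV v).2 by rewrite -GT.
  exists (maxn k l) => //; split.
  - by move: Fk; exact/subsetPset/ndF/leq_maxl.
  - by move: Gl; exact/subsetPset/ndG/leq_maxr.
move=> k; have [mF Fk] := Foo k; have [mG Gk] := Goo k; split.
  rewrite -[X in measurable X]setTI; apply: measurable_uncons_rV => //.
  exact: measurableX.
rewrite /lebesgue_rV_step /pushforward -comp_preimage.
rewrite (_ : _ \o _ = id); last by apply/funext => p /=; rewrite cons_rVK.
by rewrite preimage_id product_measure1E// lte_mul_pinfty// ge0_fin_numE.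
Qed.

HB.instance Definition _ := Measure_isSigmaFinite.Build _ _ _ lebesgue_rV_step
  step_sigma_finite.

End step.

Fixpoint lebesgue_rV n : {sigma_finite_measure set 'rV[R]_n -> \bar R} :=
  match n with
  | 0 => [the {sigma_finite_measure set 'rV[R]_0 -> \bar R} of \d_(0 : 'rV[R]_0)]
  | n.+1 => [the {sigma_finite_measure set 'rV[R]_n.+1 -> \bar R}
              of lebesgue_rV_step (lebesgue_rV n)]
  end.

End lebesgue_rV.

Section sobolev.
Context {R : realType} {n : nat}.
Implicit Types (g : 'rV[R]_n -> R) (G : 'rV[R]_n -> 'rV[R]_n) (p : \bar R).
Local Notation mu := (lebesgue_rV n).

Definition partial (i : 'I_n) g : 'rV[R]_n -> R := fun x => 'D_(delta_mx 0 i) g x.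

Fixpoint is_Ck (k : nat) g : Prop :=
  match k with
  | 0 => continuous g
  | k.+1 => continuous g /\ forall i : 'I_n,
      (forall x, derivable g x (delta_mx 0 i)) /\ is_Ck k (partial i g)
  end.

Definition test_function g : Prop :=
  (forall k, is_Ck k g) /\ compact (closure [set x | g x != 0]).

Definition locally_integrable_rV g : Prop :=
  forall K : set 'rV[R]_n, compact K -> mu.-integrable K (EFin \o g).

Definition is_weak_grad g G : Prop :=
  locally_integrable_rV g /\
  forall i : 'I_n, [/\ measurable_fun setT (fun x => G x 0 i),
    locally_integrable_rV (fun x => G x 0 i) &
    forall phi, test_function phi ->
      \int[mu]_(x in setT) (g x * partial i phi x) =
      - \int[mu]_(x in setT) (G x 0 i * phi x)].

(* A weak gradient is unique up to null sets; the value is junk when there is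
   none. *)
Definition weak_grad g : 'rV[R]_n -> 'rV[R]_n :=
  xget (fun=> 0) [set G | is_weak_grad g G].

Definition sobolev p g : Prop :=
  [/\ g \in Lfun mu p, is_weak_grad g (weak_grad g) &
      (fun x => enorm (weak_grad g x)) \in Lfun mu p].

(* Elements of W^{1,oo} are identified with their Lipschitz representatives. *)
Definition sobolev_1_infty g : Prop :=
  [/\ sobolev 1 g, sobolev +oo g & lipschitz g].

End sobolev.

Section symmetrization.
Context {R : realType} {n : nat}.
Implicit Types (E : set 'rV[R]_n) (f : 'rV[R]_n -> R).
Local Notation mu := (lebesgue_rV n).

(* The open ball is used: the closed ball of measure 0 would be {0} instead of
   the empty set, and would make the symmetral below infinite at 0. *)
Definition sym_ball E : set 'rV[R]_n :=
  [set x | exists2 r : R, mu (eball r) = mu E & eball r x].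

Definition schwarz f : 'rV[R]_n -> R := fun x =>
  \int[lebesgue_measure]_(t in `]0, +oo[) \1_(sym_ball [set y | t <= f y]) x.

End symmetrization.

Section polar_projection_bodies.
Context {R : realType} {n : nat}.
Implicit Types (s : R) (q : R -> R) (g : 'rV[R]_n -> R) (xi : 'rV[R]_n).
Local Notation mu := (lebesgue_rV n).

Definition pos_part (a : R) : R := maxr a 0.
Definition neg_part (a : R) : R := maxr (- a) 0.

Definition unit_set (gauge : 'rV[R]_n -> \bar R) : set 'rV[R]_n :=
  [set xi | (gauge xi <= 1)%E].

(* The gauges below share one definition: q is the absolute value, the positive
   part or the negative part. *)

Definition frac_gauge q s g xi : \bar R :=
  (ereal_sup [set (z.2 `^ (- s) * q (g (z.1 + z.2 *: xi)%R - g z.1))%:E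
             | z in [set: 'rV[R]_n] `*` `]0%R, +oo[] `^ s^-1)%E.

Definition grad_gauge q g xi : \bar R :=
  ess_sup mu (fun x => (q (dotp (weak_grad g x) xi))%:E).

Definition Pi_frac s g := unit_set (frac_gauge normr s g).
Definition Pi_frac_pos s g := unit_set (frac_gauge pos_part s g).
Definition Pi_frac_neg s g := unit_set (frac_gauge neg_part s g).

Definition Pi_grad g := unit_set (grad_gauge normr g).
Definition Pi_grad_pos g := unit_set (grad_gauge pos_part g).
Definition Pi_grad_neg g := unit_set (grad_gauge neg_part g).

(* |K|^(-a); the inverse in \bar R sends +oo to 0, whereas the power +oo `^ -a
   of the library is +oo. *)
Definition vol_negpow (K : set 'rV[R]_n) (a : R) : \bar R := (mu K `^ a)^-1%E.

End polar_projection_bodies.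

(* Main.v *)
(* With [q] one of the three functions of the gauges, the fractional body of g is
   the set fd_set q s g of the xi with q (g (x + t xi) - g x) <= t^s for all x
   and t > 0.  If K is the body of f for the negative part, then
     {f >= v} + (v - u)^(1/s) K is contained in {f >= u}   for 0 < u < v.
   By the Brunn-Minkowski inequality the radii r(u) of the superlevel sets of
   the symmetral satisfy r(u) >= r(v) + (v - u)^(1/s) rho, where rho is the radius
   of the ball with the volume of K; hence
     f*(y) - f*(x) <= (|x - y| / rho)^s,
   so that the ball of radius rho is contained in the bodies of f*.  The body for
   the positive part is - K, and the one for the absolute value is a subset of K.

   The gradient bodies are the case s = 1: for a continuous g with weak gradient
   G, <G, xi> <= 1 holds almost everywhere if and only if g (x + t xi) - g x <= t
   for all x and t > 0.  This is seen by testing g against translates of a bump phi: the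
   derivative of t |-> int g(x) phi(x - t xi) dx is int <G, xi> phi(x - t xi) dx.

   For the equality case, E |-> |{x : x A in E}| is a translation invariant
   measure, hence a multiple of Lebesgue measure; the factor is 1 because f and
   f* are equimeasurable, and the bodies of f and f* correspond to each other
   under A. *)

From HB Require Import structures.
Require Import Defs.
From mathcomp Require Import all_boot all_order all_algebra.
From mathcomp Require Import all_classical all_reals all_analysis.
From mathcomp Require Import measurable_realfun ess_sup_inf lra ring.
Set Implicit Arguments.
Unset Strict Implicit.
Unset Printing Implicit Defensive.
Import Order.TTheory GRing.Theory Num.Def Num.Theory.
Import numFieldNormedType.Exports.
Local Open Scope classical_set_scope.
Local Open Scope ring_scope.

(** * Lebesgue measure on R^n *)

Section lebesgue_rV_basics.
Context {R : realType}.

(** A one-sided estimate for [f] along [K] becomes a two-sided one for the symmetral, because the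
    resulting modulus depends only on the distance of the two points; so a single comparison serves
    all three choices of [q]. The same modulus is what makes the symmetral continuous, hence its
    bodies closed and measurable. Of [f] the comparison uses only continuity, an upper bound and the
    finite measure of superlevel sets at positive heights, and nothing in it separates [s = 1] from
    [s < 1]. The degenerate cases need separate care: [K] may have measure 0 or infinite measure,
    the symmetral is the finite part of an integral that must first be shown finite, and [f = 0] has
    no superlevel set of positive height and positive measure from which the factor of a linear map
    could be read off. *)

Lemma lebesgue_measure_translate (a : R) (E : set (measurableTypeR R)) :
  measurable E ->
  lebesgue_measure ((fun x => x + a) @^-1` E) = lebesgue_measure E.
Proof.
move=> mE.
have mT : measurable_fun setT (fun x : measurableTypeR R => x + a : measurableTypeR R).
  exact: measurable_funD.
rewrite (_ : lebesgue_measure _ =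
  pushforward lebesgue_measure (fun x : measurableTypeR R => x + a : measurableTypeR R) E) //.
pose h : {mfun measurableTypeR R >-> measurableTypeR R} := HB.pack
  (fun x : measurableTypeR R => x + a : measurableTypeR R)
  (isMeasurableFun.Build _ _ _ _ _ mT).
apply/esym; apply: (lebesgue_measure_unique (mu := pushforward lebesgue_measure h)) => //.
move=> X [[u v] _ <-] /=; rewrite /pushforward.
rewrite [in RHS](_ : _ @^-1` _ = `]u - a, v - a]%classic); last first.
  by apply/seteqP; split => x /=; rewrite !in_itv/= ltrBlDr lerBrDr.
by rewrite !lebesgue_measure_itv/= !lte_fin ltrD2r -!EFinB; case: ifP => // _; congr EFin; lra.
Qed.

Lemma lebesgue_rVE n (E : set 'rV[R]_n.+1) :
  lebesgue_rV n.+1 E =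
  (\int[lebesgue_measure]_x lebesgue_rV n [set y | E (cons_rV (x, y))])%E.
Proof.
rewrite /= /lebesgue_rV_step /pushforward /product_measure1 /=.
apply: eq_integral => x _ /=; congr (lebesgue_rV n _).
by apply/seteqP; split => y; rewrite /xsection /= inE.
Qed.

Lemma measurable_section n (E : set 'rV[R]_n.+1) (x : R) :
  measurable E -> measurable [set y : 'rV[R]_n | E (cons_rV (x, y))].
Proof.
move=> mE; rewrite -[X in measurable X]setTI.
apply: (measurableT_comp (@measurable_cons_rV R n)) => //.
Qed.

Lemma measurable_fun_section n (E : set 'rV[R]_n.+1) : measurable E ->
  measurable_fun setT (fun x : measurableTypeR R =>
     lebesgue_rV n [set y | E (cons_rV (x, y))]).
Proof.
move=> mE; have mE' : measurable (@cons_rV R n @^-1` E).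
  by rewrite -[X in measurable X]setTI; exact: measurable_cons_rV.
apply: eq_measurable_fun (measurable_fun_xsection (lebesgue_rV n) mE') => x _ /=.
by congr (lebesgue_rV n _); apply/seteqP; split => y; rewrite /xsection /= inE.
Qed.

Lemma measurable_translate n (a : 'rV[R]_n) :
  measurable_fun setT (fun x : 'rV[R]_n => x + a).
Proof.
apply: measurable_fun_coorP => i.
under eq_fun do rewrite mxE.
apply: measurable_funD => //; exact: measurable_coor.
Qed.

Lemma measurable_opp_rV n :
  measurable_fun setT (fun x : 'rV[R]_n => - x).
Proof.
apply: measurable_fun_coorP => i.
under eq_fun do rewrite mxE.
exact: (measurableT_comp (@oppr_measurable R setT) (measurable_coor i)).
Qed.

Lemma measurable_mulmx n m (A : 'M[R]_(n, m)) :
  measurable_fun setT (fun x : 'rV[R]_n => x *m A).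
Proof.
apply: measurable_fun_coorP => i.
under eq_fun do rewrite mxE.
apply: measurable_sum => j.
apply: measurable_funM => //; exact: measurable_coor.
Qed.

Lemma measurable_scale_rV n (c : R) :
  measurable_fun setT (fun x : 'rV[R]_n => c *: x).
Proof.
apply: measurable_fun_coorP => i.
under eq_fun do rewrite mxE.
apply: measurable_funM => //; exact: measurable_coor.
Qed.

Lemma preimage_measurable d d' (T : measurableType d) (T' : measurableType d')
  (h : T -> T') (E : set T') :
  measurable_fun setT h -> measurable E -> measurable (h @^-1` E).
Proof. by move=> mh mE; rewrite -[X in measurable X]setTI; exact: mh. Qed.

Lemma cons_rVD n (x : R) (y : 'rV[R]_n) (a : 'rV[R]_n.+1) :
  cons_rV (x, y) + a = cons_rV (x + (uncons_rV a).1, y + (uncons_rV a).2).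
Proof.
apply/rowP => i; rewrite mxE; case: (unliftP ord0 i) => [j|] ->.
  by rewrite !cons_rVS /= !mxE.
by rewrite !cons_rV0.
Qed.

Lemma lebesgue_rV_translate n (a : 'rV[R]_n) (E : set 'rV[R]_n) :
  measurable E -> lebesgue_rV n ((fun x => x + a) @^-1` E) = lebesgue_rV n E.
Proof.
elim: n a E => [|n IH] a E mE.
  congr (lebesgue_rV 0 _); apply/seteqP; split => x /=;
    by rewrite (_ : x + a = x) //; apply/rowP => -[].
rewrite !lebesgue_rVE.
set F := fun x : measurableTypeR R => lebesgue_rV n [set y | E (cons_rV (x, y))].
transitivity (\int[lebesgue_measure]_(x in [set: measurableTypeR R]) F (x + (uncons_rV a).1)%R)%E.
  apply: eq_integral => x _; rewrite /F -[RHS](IH (uncons_rV a).2); last first.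
    exact: measurable_section.
  by congr (lebesgue_rV n _); apply/seteqP; split => y; rewrite /= cons_rVD.
set b := (uncons_rV a).1.
have mT : measurable_fun setT (fun x : measurableTypeR R => x + b : measurableTypeR R).
  exact: measurable_funD.
have mF : measurable_fun setT F by exact: measurable_fun_section.
transitivity (\int[pushforward lebesgue_measure (fun x : measurableTypeR R => (x + b)%R : measurableTypeR R)]_y F y)%E.
  by rewrite ge0_integral_pushforward.
apply: eq_measure_integral => A mA _.
by rewrite -[RHS](lebesgue_measure_translate b mA).
Qed.

Definition cube n (a b : R) : set 'rV[R]_n := [set x | forall i, a < x 0 i < b].

Arguments cube : clear implicits.
Lemma measurable_cube n a b : measurable (cube n a b).
Proof.
rewrite (_ : cube n a b = \bigcap_(i in [set: 'I_n]) ((fun x : 'rV[R]_n => x 0 i) @^-1` `]a, b[%classic)).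
  apply: fin_bigcap_measurable => [|i _]; first exact: finite_finset.
  by apply: preimage_measurable; [exact: measurable_coor|exact: measurable_itv].
apply/seteqP; split => x /= h i; first by move=> _ /=; rewrite in_itv /= h.
by have := h i I; rewrite /= in_itv.
Qed.

Lemma lebesgue_cube n a b : a <= b ->
  lebesgue_rV n (cube n a b) = ((b - a) ^+ n)%:E.
Proof.
move=> ab; elim: n => [|n IH].
  rewrite expr0 /= /dirac /= indicE mem_set //.
  by case.
have -> : lebesgue_rV n.+1 (cube n.+1 a b) =
    (lebesgue_measure \x lebesgue_rV n)%E (`]a, b[%classic `*` cube n a b).
  rewrite /= /lebesgue_rV_step /pushforward; congr (product_measure1 _ _ _).
  apply/seteqP; split => -[x y] /=.
    move=> h; split; first by have := h ord0; rewrite cons_rV0 in_itv.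
    by move=> i; have := h (lift ord0 i); rewrite cons_rVS.
  rewrite in_itv /= => -[h1 h2] i; case: (unliftP ord0 i) => [j|] ->.
    by rewrite cons_rVS.
  by rewrite cons_rV0.
rewrite product_measure1E //; last exact: measurable_cube.
rewrite IH /= lebesgue_measure_itv /= lte_fin exprS EFinM.
have [//|ba] := ltP a b.
have -> : b = a by apply/le_anti; rewrite ab ba.
by rewrite subrr !mul0e.
Qed.

(** The sigma-algebra is generated by the coordinates, so an open set has to be written as a
    countable union of boxes with rational centre and radius [1 / (k + 1)]. *)
Lemma open_measurable_rV n (U : set 'rV[R]_n) : open U -> measurable U.
Proof.
move=> oU.
pose B (p : 'rV[rat]_n * nat) : set 'rV[R]_n :=
  [set y | forall i, ratr (p.1 0 i) - p.2.+1%:R^-1 < y 0 i < ratr (p.1 0 i) + p.2.+1%:R^-1].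
have mB p : measurable (B p).
  rewrite (_ : B p = \bigcap_(i in [set: 'I_n]) ((fun x : 'rV[R]_n => x 0 i) @^-1`
     `](ratr (p.1 0 i) - p.2.+1%:R^-1), (ratr (p.1 0 i) + p.2.+1%:R^-1)[%classic)).
    apply: fin_bigcap_measurable => [|i _]; first exact: finite_finset.
    by apply: preimage_measurable; [exact: measurable_coor|exact: measurable_itv].
  apply/seteqP; split => x /= h i; first by move=> _ /=; rewrite in_itv /= h.
  by have := h i I; rewrite /= in_itv.
rewrite (_ : U = \bigcup_(p in setT) (if `[< B p `<=` U >] then B p else set0)).
  apply: countable_bigcupT_measurable; first exact: countableP.
  by move=> p; case: ifP => _ //; exact: mB.
apply/seteqP; split => [x Ux|x [p _]]; last by case: ifPn => // /asboolP; apply.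
have [e /= e0 eU] := (nbhs_ballP _ _).1 (oU _ Ux).
(* The centre is within [1 / (k + 1)] of [x] and the box has the same radius, hence half of [e]. *)
have [k ke] : exists k : nat, k.+1%:R^-1 < e / 2.
  exists (truncn (e / 2)^-1); rewrite -[ltRHS]invrK ltf_pV2 ?posrE ?invr_gt0 ?divr_gt0 //.
  exact: truncnS_gt.
have hq i : exists q : rat, x 0 i - k.+1%:R^-1 < ratr q < x 0 i + k.+1%:R^-1.
  have xx : x 0 i - k.+1%:R^-1 < x 0 i + k.+1%:R^-1.
    by rewrite ltrBlDr -addrA ltrDl addr_gt0.
  have [q] := rat_in_itvoo xx; rewrite in_itv /= => qh; by exists q.
have {hq} [q hq] := choice hq.
exists (\row_i q i, k) => //.
have Bx : B (\row_i q i, k) x.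
  move=> i; rewrite /= mxE; have /andP[h1 h2] := hq i.
    by rewrite ltrBlDr h2 -ltrBlDr h1.
rewrite (_ : `[< _ >] = true) //; apply/asboolP => y By.
apply: eU; split => // i j; rewrite !ord1 /ball /=.
have /andP[h1 h2] := By j; have /andP[h3 h4] := Bx j; move: h1 h2 h3 h4; rewrite /= => h1 h2 h3 h4.
rewrite ltr_norml; move: h1 h2 h3 h4 ke.
move: (ratr _) (x 0 j) (y 0 j) (_^-1) => r s t d *; apply/andP; split; lra.
Qed.

Lemma closed_measurable_rV n (U : set 'rV[R]_n) : closed U -> measurable U.
Proof.
by move=> cU; rewrite -[U]setCK; apply: measurableC; apply: open_measurable_rV; exact: closed_openC.
Qed.

Lemma continuous_measurable_rV n (f : 'rV[R]_n -> R) :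
  continuous f -> measurable_fun setT f.
Proof.
move=> cf; apply: (measurability _ (RGenOpens.measurableE R)).
move=> _ [_ [a [b ->] <-]]; rewrite setTI; apply: open_measurable_rV.
by move/continuousP : cf; apply; exact: interval_open.
Qed.

(** The exhausting sets are pulled back by the inverse [h'], so that their preimages under [h] are
    cubes again. *)
Lemma sigma_finite_pushforward n (h h' : 'rV[R]_n -> 'rV[R]_n) :
  measurable_fun setT h' -> cancel h h' ->
  sigma_finite setT (fun E => lebesgue_rV n (h @^-1` E)).
Proof.
move=> mh' hK.
exists (fun k : nat => h' @^-1` cube n (- k%:R) k%:R).
  apply/seteqP; split => // x _.
  pose M := \big[Num.max/0]_i `|h' x 0 i|.
  have [k Mk] : exists k : nat, M < k%:R.
    by exists (truncn M).+1; rewrite truncnS_gt.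
  exists k => // i.
  have : `|h' x 0 i| < k%:R by apply: le_lt_trans Mk; rewrite /M; exact: le_bigmax.
  by rewrite ltr_norml.
move=> k; split; first by apply: preimage_measurable => //; exact: measurable_cube.
rewrite (_ : _ @^-1` _ = cube n (- k%:R) k%:R); last first.
  by apply/seteqP; split => x /=; rewrite hK.
by rewrite lebesgue_cube ?ltry // (@le_trans _ _ 0) // oppr_le0.
Qed.

(* Both sides compute the measure of {(x, y) | E x, Q (x + y)} under the product
   of nu and Lebesgue measure, integrating first in y or first in x. *)
Lemma translation_invariant_uniq n (nu : {sigma_finite_measure set 'rV[R]_n -> \bar R})
    (nuT : forall (a : 'rV[R]_n) (E : set 'rV[R]_n), measurable E ->
      nu ((fun x => x + a) @^-1` E) = nu E)
    (E Q : set 'rV[R]_n) : measurable E -> measurable Q ->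
  (nu E * lebesgue_rV n Q = nu Q * lebesgue_rV n ((fun x => - x)%R @^-1` E))%E.
Proof.
move=> mE mQ; set mu := lebesgue_rV n.
have madd : measurable_fun setT (fun p : 'rV[R]_n * 'rV[R]_n => p.1 + p.2).
  apply: measurable_fun_coorP => i; under eq_fun do rewrite mxE.
  by apply: measurable_funD; apply: (measurableT_comp (measurable_coor i)).
have msub : measurable_fun setT (fun p : 'rV[R]_n * 'rV[R]_n => p.1 - p.2).
  apply: measurable_fun_coorP => i; under eq_fun do rewrite !mxE.
  by apply: measurable_funB; apply: (measurableT_comp (measurable_coor i)).
pose W := [set p : 'rV[R]_n * 'rV[R]_n | E p.1 /\ Q (p.1 + p.2)].
(* [V] is [W] sheared by [(x, y) |-> (x + y, y)]: its sections at fixed [y] are translates of those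
   of [W], and [nu] gives both the same measure. *)
pose V := [set p : 'rV[R]_n * 'rV[R]_n | E (p.1 - p.2) /\ Q p.1].
have mW : measurable W.
  have -> : W = (fst @^-1` E) `&` ((fun p => p.1 + p.2) @^-1` Q) by [].
  by apply: measurableI; apply: preimage_measurable.
have mV : measurable V.
  have -> : V = ((fun p => p.1 - p.2) @^-1` E) `&` (fst @^-1` Q) by [].
  by apply: measurableI; apply: preimage_measurable.
have swap X : measurable X -> (nu \x mu)%E X = (nu \x^ mu)%E X.
  move=> mX; apply: product_measure_unique => // A B mA mB.
  exact: product_measure2E.
have iteE (A : set 'rV[R]_n) (F : 'rV[R]_n -> \bar R) c : measurable A ->
    (forall x, F x = if x \in A then c else 0%E) -> (\int[nu]_x F x = c * nu A)%E.
  move=> mA FE; rewrite -integral_cst // [RHS]integral_mkcond.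
  by apply: eq_integral => x _; rewrite FE patchE.
have WE : ((nu \x mu) W = mu Q * nu E)%E.
  rewrite /product_measure1; apply: iteE => // x /=.
  case: ifPn => [/set_mem Ex|/negP nEx].
    rewrite -(lebesgue_rV_translate x mQ); congr (lebesgue_rV n _).
    apply/seteqP; split => y; rewrite /xsection /= inE /W /= addrC; tauto.
  rewrite (_ : xsection W x = set0) ?measure0 // -subset0 => y.
  by rewrite /xsection /= inE => -[Ex _]; apply: nEx; rewrite inE.
have VE : ((nu \x mu) V = mu ((fun x => - x)%R @^-1` E) * nu Q)%E.
  rewrite /product_measure1; apply: iteE => // x /=.
  have mNE : measurable ((fun x : 'rV[R]_n => - x) @^-1` E).
    by apply: preimage_measurable => //; exact: measurable_opp_rV.
  case: ifPn => [/set_mem Qx|/negP nQx].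
    rewrite -(lebesgue_rV_translate (- x) mNE); congr (lebesgue_rV n _).
    apply/seteqP; split => y; rewrite /xsection /= inE /V /= opprB; tauto.
  rewrite (_ : xsection V x = set0) ?measure0 // -subset0 => y.
  by rewrite /xsection /= inE => -[_ Qx]; apply: nQx; rewrite inE.
rewrite muleC -WE muleC -VE swap // swap // /product_measure2.
apply: eq_integral => y _ /=.
have mVy : measurable (ysection V y) by exact: measurable_ysection.
rewrite -[RHS](nuT y) //; congr (nu _).
by apply/seteqP; split => x; rewrite /ysection /= !inE /W /V /= addrK.
Qed.

(** Uniqueness applied to Lebesgue measure itself and the unit cube removes the reflection that the
    uniqueness lemma leaves on one side. *)
Lemma lebesgue_rV_opp n (E : set 'rV[R]_n) : measurable E ->
  lebesgue_rV n ((fun x => - x) @^-1` E) = lebesgue_rV n E.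
Proof.
move=> mE.
have := @translation_invariant_uniq n (lebesgue_rV n)
  (fun a E => @lebesgue_rV_translate n a E) E (cube n 0 1) mE (measurable_cube _ _).
rewrite [X in (_ * X)%E](_ : _ = 1%E); last by rewrite /= lebesgue_cube // subr0 expr1n.
by rewrite lebesgue_cube // subr0 expr1n mul1e mule1 => ->.
Qed.

(** Additivity of [h] makes the pushforward translation invariant. In the cross-multiplied form sets
    of infinite measure are covered, and the factor of [h] can be read off from any [Q] of positive
    finite measure. *)
Lemma lebesgue_rV_pushforward n (h h' : 'rV[R]_n -> 'rV[R]_n) (Q E : set 'rV[R]_n) :
  measurable_fun setT h -> measurable_fun setT h' ->
  cancel h h' -> cancel h' h -> {morph h : x y / x + y} ->
  measurable E -> measurable Q ->
  (lebesgue_rV n (h @^-1` E) * lebesgue_rV n Q =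
   lebesgue_rV n (h @^-1` Q) * lebesgue_rV n E)%E.
Proof.
move=> mh mh' hK h'K hD mE mQ.
pose nu' := HB.pack_for {sigma_finite_measure set 'rV[R]_n -> \bar R}
  (pushforward (lebesgue_rV n) h)
    (Measure_isSigmaFinite.Build _ _ _ (pushforward (lebesgue_rV n) h)
       (sigma_finite_pushforward mh' hK)).
pose nu : {sigma_finite_measure set 'rV[R]_n -> \bar R} := nu' mh mh mh.
have := @translation_invariant_uniq n nu _ E Q mE mQ.
rewrite lebesgue_rV_opp //; apply => a A mA.
rewrite /nu /= /pushforward /=.
rewrite -[RHS](lebesgue_rV_translate (h' a)); last exact: preimage_measurable.
by congr (lebesgue_rV n _); apply/seteqP; split => x /=; rewrite hD h'K.
Qed.

Lemma lebesgue_rV_scale n (c : R) (E : set 'rV[R]_n) : 0 < c -> measurable E ->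
  lebesgue_rV n ((fun x => c *: x) @^-1` E) = ((c ^-1 ^+ n)%:E * lebesgue_rV n E)%E.
Proof.
move=> c0 mE; have c0' : c != 0 by rewrite gt_eqF.
have := @lebesgue_rV_pushforward n (fun x => c *: x) (fun x => c^-1 *: x) (cube n 0 1) E
  (@measurable_scale_rV n c) (@measurable_scale_rV n c^-1).
rewrite lebesgue_cube // subr0 expr1n mule1 => ->; last exact: measurable_cube.
- rewrite (_ : _ @^-1` _ = cube n 0 c^-1); last first.
    apply/seteqP; split => x /= h i; have := h i; rewrite mxE.
      by rewrite pmulr_rgt0 // -ltr_pdivlMl // mulr1.
    by move=> /andP[h1 h2]; rewrite pmulr_rgt0 // h1 -ltr_pdivlMl // mulr1.
  by rewrite lebesgue_cube ?subr0 // invr_ge0 ltW.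
- by move=> x; rewrite scalerA mulVf // scale1r.
- by move=> x; rewrite scalerA divff // scale1r.
- by move=> x y; rewrite scalerDr.
- by [].
Qed.

End lebesgue_rV_basics.

Arguments cube {R} n _ _ _.

(** * The Brunn-Minkowski inequality *)

Section brunn_minkowski.
Context {R : realType}.
Local Notation leb := (@lebesgue_measure R).

Lemma nondecreasing_cvg_sum_le (a b : (\bar R)^nat) (l m c : \bar R) :
  (forall k, (0 <= a k)%E) -> (forall k, (0 <= b k)%E) ->
  a @ \oo --> l -> b @ \oo --> m ->
  (\forall k \near \oo, (a k + b k <= c)%E) -> (l + m <= c)%E.
Proof.
move=> a0 b0 al bm abc.
have l0 : (0 <= l)%E by rewrite -(cvg_lim _ al) //; apply: lime_ge; [exact: cvgP al|exact: nearW].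
have m0 : (0 <= m)%E by rewrite -(cvg_lim _ bm) //; apply: lime_ge; [exact: cvgP bm|exact: nearW].
have lm : (a k + b k)%E @[k --> \oo] --> (l + m)%E.
  by apply: cvgeD => //; exact: ge0_adde_def.
by rewrite -(cvg_lim _ lm) //; apply: lime_le => //; exact: cvgP lm.
Qed.

(** With [a] in [A] near its supremum and [b] in [B] near its infimum, the part of [A] below [a]
    shifted by [b] and the part of [B] above [b] shifted by [a] both lie in [C], on different sides
    of [a + b]. Cutting [A] at [a] and [B] at [b] loses at most [e / 2] each. *)
Lemma brunn_minkowski_line_bounded (A B C : set (measurableTypeR R)) (M : R) :
  measurable A -> measurable B -> measurable C -> A !=set0 -> B !=set0 ->
  (forall x, A x -> - M <= x <= M) -> (forall x, B x -> - M <= x <= M) ->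
  (forall x y, A x -> B y -> C (x + y)) ->
  (leb A + leb B <= leb C)%E.
Proof.
move=> mA mB mC A0 B0 AM BM ABC.
apply/lee_addgt0Pr => e e0.
have supA : has_sup (A : set R).
  by split => //; exists M => x /AM /andP[].
have infB : has_inf (B : set R).
  by split => //; exists (- M) => x /BM /andP[].
have e2 : 0 < e / 2 by rewrite divr_gt0.
have [a Aa ha] := sup_adherent e2 supA.
have [b Bb hb] := inf_adherent e2 infB.
pose A0' : set (measurableTypeR R) := A `&` `]-oo, a[%classic.
pose B0' : set (measurableTypeR R) := B `&` `[b, +oo[%classic.
have mA0' : measurable A0' by apply: measurableI.
have mB0' : measurable B0' by apply: measurableI.
have hA : (leb A <= leb A0' + (e / 2)%:E)%E.
  apply: (@le_trans _ _ (leb (A0' `|` `[a, sup A]%classic))).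
    apply: le_measure; rewrite ?inE //; first exact: measurableU.
    move=> x Ax; have [xa|ax] := ltP x a; [left|right].
      by split => //=; rewrite in_itv.
    rewrite /= in_itv /= ax /=; apply: sup_upper_bound => //.
  apply: (le_trans (measureU2 _ _ _)) => //.
  rewrite leeD2l // /= lebesgue_measure_itv /= lte_fin.
  by case: ifP => _; rewrite ?lee_fin ?ltW // -?EFinB ?lee_fin; lra.
have hB : (leb B <= leb B0' + (e / 2)%:E)%E.
  apply: (@le_trans _ _ (leb (B0' `|` `[inf B, b]%classic))).
    apply: le_measure; rewrite ?inE //; first exact: measurableU.
    move=> x Bx; have [xb|bx] := leP x b; [right|left].
      by rewrite /= in_itv /= xb andbT; apply: inf_lbound => //; case: infB.
    by split => //=; rewrite in_itv /= ltW.
  apply: (le_trans (measureU2 _ _ _)) => //.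
  rewrite leeD2l // /= lebesgue_measure_itv /= lte_fin.
  by case: ifP => _; rewrite ?lee_fin ?ltW // -?EFinB ?lee_fin; lra.
have mT (c : R) : measurable_fun setT (fun x : measurableTypeR R => x + c : measurableTypeR R).
  exact: measurable_funD.
have mA1 : measurable ((fun x => x - b) @^-1` A0').
  exact: (preimage_measurable (mT (- b)) mA0').
have mB1 : measurable ((fun x => x - a) @^-1` B0').
  exact: (preimage_measurable (mT (- a)) mB0').
have hC : (leb A0' + leb B0' <= leb C)%E.
  rewrite -(lebesgue_measure_translate (- b) mA0') -(lebesgue_measure_translate (- a) mB0').
  rewrite -measureU //; last first.
    rewrite -subset0 => x /= [[_ h1] [_ h2]]; move: h1 h2.
    by rewrite /= !in_itv /= andbT => h1 h2; lra.
  apply: le_measure; rewrite ?inE //; first exact: measurableU.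
  move=> x [] /= [h _].
    by rewrite -(subrK b x); exact: ABC.
  by rewrite -(subrK a x) addrC; exact: ABC.
apply: (le_trans (leeD hA hB)).
rewrite addeACA -EFinD -splitr leeD2r //.
Qed.

Lemma brunn_minkowski_line (A B C : set (measurableTypeR R)) :
  measurable A -> measurable B -> measurable C -> A !=set0 -> B !=set0 ->
  (forall x y, A x -> B y -> C (x + y)) ->
  (leb A + leb B <= leb C)%E.
Proof.
move=> mA mB mC [a Aa] [b Bb] ABC.
pose I k : set (measurableTypeR R) := `[- k%:R, k%:R]%classic.
have mI k : measurable (I k) by exact: measurable_itv.
have Ile k l : (k <= l)%N -> I k `<=` I l.
  move=> kl x; rewrite /I /= !in_itv /= => /andP[h1 h2].
  have : (k%:R : R) <= l%:R by rewrite ler_nat.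
  by move: h1 h2; move: (k%:R) (l%:R) => r s *; apply/andP; split; lra.
have Icov x : exists k, I k x.
  exists (truncn `|x|).+1; rewrite /I /= in_itv /= -ler_norml ltW //.
  exact: truncnS_gt.
have cvI (X : set (measurableTypeR R)) : measurable X ->
    (fun k => leb (X `&` I k)) @ \oo --> leb X.
  move=> mX; have {2}-> : X = \bigcup_k (X `&` I k).
    rewrite -setI_bigcupr; apply/seteqP; split => [x Xx|x []//].
    by split => //; have [k] := Icov x; exists k.
  apply: nondecreasing_cvg_mu => [k||k l kl]; first exact: measurableI.
    by apply: bigcup_measurable => k _; exact: measurableI.
  by rewrite subsetEset; apply: setIS; exact: Ile.
apply: (nondecreasing_cvg_sum_le _ _ (cvI A mA) (cvI B mB)) => //.
have [ka Ika] := Icov a; have [kb Ikb] := Icov b.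
exists (maxn ka kb) => // k /=; rewrite geq_max => /andP[hka hkb].
apply: (@brunn_minkowski_line_bounded _ _ _ k%:R) => //; try exact: measurableI.
- by exists a; split => //; exact: Ile Ika.
- by exists b; split => //; exact: Ile Ikb.
- by move=> x [_]; rewrite /I /= in_itv.
- by move=> x [_]; rewrite /I /= in_itv.
- by move=> x y [Ax _] [By _]; exact: ABC.
Qed.

(** Fubini for the region below the graph of [F], restricted to levels in []0, 1[]. *)
Lemma layer_cake01 (F : measurableTypeR R -> \bar R) :
  measurable_fun setT F -> (forall x, (0 <= F x)%E) ->
  (\int[leb]_(t in `]0%R, 1%R[) leb [set x | (t%:E <= F x)%E] =
   \int[leb]_x Order.min (F x) 1)%E.
Proof.
move=> mF F0.
pose W := [set p : measurableTypeR R * measurableTypeR R |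
   ((p.2)%:E <= F p.1)%E /\ `]0%R, 1%R[%classic p.2].
have mW : measurable W.
  have -> : W = ([set: _] `&` [set p | ((p.2)%:E <= F p.1)%E]) `&` (snd @^-1` `]0%R, 1%R[%classic).
    by apply/seteqP; split => p /=; [move=> [? ?]|move=> [[_ ?] ?]].
  apply: measurableI; last by apply: preimage_measurable.
  apply: measurable_lee => //.
    by apply/measurable_EFinP; exact: measurable_snd.
  exact: (measurableT_comp mF measurable_fst).
have W1 : (leb \x leb)%E W = (\int[leb]_x Order.min (F x) 1)%E.
  rewrite /product_measure1; apply: eq_integral => x _ /=.
  have -> : xsection W x = `]0%R, 1%R[%classic `&` [set t | (t%:E <= F x)%E].
    by apply/seteqP; split => t; rewrite /xsection /= inE /W /= => -[].
  case: (F x) (F0 x) => [r|_|//].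
    rewrite lee_fin => r0.
    have [r1|r1] := ltP r 1.
      rewrite (_ : _ `&` _ = `]0%R, r]%classic); last first.
        apply/seteqP; split => t; rewrite /= !in_itv /= lee_fin.
          by move=> [/andP[-> _] ->].
        by move=> /andP[-> tr]; rewrite tr (le_lt_trans tr r1).
      rewrite lebesgue_measure_itv /= lte_fin.
      rewrite min_l ?lee_fin ?ltW // sube0.
      by case: ltP => //= r0'; congr EFin; apply/le_anti; rewrite r0 r0'.
    rewrite (_ : _ `&` _ = `]0%R, 1%R[%classic); last first.
      apply/seteqP; split => t; rewrite /= !in_itv /= lee_fin; first by case.
      by move=> /andP[-> t1]; rewrite t1 (le_trans (ltW t1) r1).
    by rewrite lebesgue_measure_itv /= lte_fin ltr01 sube0 min_r // lee_fin.
  rewrite (_ : _ `&` _ = `]0%R, 1%R[%classic); last first.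
    by apply/seteqP; split => t; rewrite /= !in_itv /= ?leey; [case|].
  by rewrite lebesgue_measure_itv /= lte_fin ltr01 sube0 min_r // leey.
have W2 : (leb \x^ leb)%E W = (\int[leb]_(t in `]0%R, 1%R[) leb [set x | (t%:E <= F x)%E])%E.
  rewrite /product_measure2 [RHS]integral_mkcond; apply: eq_integral => t _ /=.
  rewrite patchE; case: ifPn => [/set_mem ht|ht].
    congr (leb _); apply/seteqP; split => x; rewrite /ysection /= inE /W /=; tauto.
  rewrite (_ : ysection _ _ = set0) ?measure0 // -subset0 => x.
  by rewrite /ysection /= inE => -[_ h]; move/negP: ht; apply; rewrite inE.
rewrite -W2 -W1; apply/esym; apply: product_measure_unique => // A B mA mB.
exact: product_measure2E.
Qed.

Lemma measurable_fun_superlevel (F : measurableTypeR R -> \bar R) :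
  measurable_fun setT F ->
  measurable_fun setT (fun t : measurableTypeR R => leb [set x | (t%:E <= F x)%E]).
Proof.
move=> mF.
pose W := [set p : measurableTypeR R * measurableTypeR R | ((p.2)%:E <= F p.1)%E].
have mW : measurable W.
  have -> : W = [set: _] `&` [set p | ((p.2)%:E <= F p.1)%E] by rewrite setTI.
  apply: measurable_lee => //.
    by apply/measurable_EFinP; exact: measurable_snd.
  exact: (measurableT_comp mF measurable_fst).
apply: eq_measurable_fun (measurable_fun_ysection leb mW) => t _ /=.
by congr (leb _); apply/seteqP; split => x; rewrite /ysection /= inE.
Qed.

(** A normalized form of the Prekopa-Leindler inequality: as [a] and [b] have the same supremum 1,
    the one-dimensional inequality holds at every level below 1, and integration over the levels
    gives a sum of integrals. Levels of [c] above 1 are discarded. *)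
Lemma prekopa_line (a b c : measurableTypeR R -> \bar R) :
  measurable_fun setT a -> measurable_fun setT b -> measurable_fun setT c ->
  (forall x, (0 <= a x <= 1)%E) -> (forall x, (0 <= b x <= 1)%E) ->
  (forall x, (0 <= c x)%E) ->
  (forall t, 0 < t < 1 -> exists x, (t%:E <= a x)%E) ->
  (forall t, 0 < t < 1 -> exists x, (t%:E <= b x)%E) ->
  (forall t x y, 0 < t < 1 -> (t%:E <= a x)%E -> (t%:E <= b y)%E -> (t%:E <= c (x + y)%R)%E) ->
  (\int[leb]_x a x + \int[leb]_x b x <= \int[leb]_x c x)%E.
Proof.
move=> ma mb mc a01 b01 c0 sa sb abc.
have a0 x : (0 <= a x)%E by have /andP[] := a01 x.
have b0 x : (0 <= b x)%E by have /andP[] := b01 x.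
have ea : (\int[leb]_x a x = \int[leb]_x Order.min (a x) 1)%E.
  by apply: eq_integral => x _; rewrite min_l //; have /andP[] := a01 x.
have eb : (\int[leb]_x b x = \int[leb]_x Order.min (b x) 1)%E.
  by apply: eq_integral => x _; rewrite min_l //; have /andP[] := b01 x.
have mS (F : measurableTypeR R -> \bar R) t : measurable_fun setT F ->
    measurable [set x | (t%:E <= F x)%E].
  by move=> mF; rewrite -[X in measurable X]setTI; exact: emeasurable_fun_c_infty.
rewrite ea eb -!layer_cake01 //.
apply: (@le_trans _ _ (\int[leb]_x Order.min (c x) 1)%E); last first.
  apply: ge0_le_integral => //.
  - by move=> x _; rewrite le_min c0 lee01.
  - exact: measurable_mine.
  - by move=> x _; rewrite ge_min lexx.
have mL (F : measurableTypeR R -> \bar R) : measurable_fun setT F ->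
    measurable_fun (`]0%R, 1%R[%classic : set (measurableTypeR R))
      (fun t : measurableTypeR R => leb [set x | (t%:E <= F x)%E]).
  by move=> mF; apply: measurable_funTS; exact: measurable_fun_superlevel.
rewrite -layer_cake01 // -ge0_integralD //; try exact: mL.
apply: ge0_le_integral => //.
- by move=> t _; rewrite adde_ge0.
- by apply: emeasurable_funD; exact: mL.
- exact: mL.
- move=> t; rewrite /= in_itv /= => t01.
  by apply: brunn_minkowski_line => //; [exact: mS|exact: mS|exact: mS|exact: sa|exact: sb|move=> x y; exact: abc].
Qed.

Lemma exists_root (a : R) n : (0 < n)%N -> 0 <= a -> exists2 p, 0 <= p & p ^+ n = a.
Proof.
move=> n0 a0; exists (a `^ n%:R^-1); first exact: powR_ge0.
by rewrite -powR_mulrn ?powR_ge0 // -powRrM mulVf ?powRr1 // pnatr_eq0 -lt0n.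
Qed.

(** Convexity of [z ^+ n.+1] for the weights [p / (p + q)] and [q / (p + q)], cleared of
    denominators. The induction step is Chebyshev's observation that [x ^+ n.+1 - y ^+ n.+1] and
    [x - y] have the same sign. *)
Lemma power_mean_ineq n (p q x y : R) : 0 <= p -> 0 <= q -> 0 <= x -> 0 <= y ->
  (p * x + q * y) ^+ n.+1 <= (p + q) ^+ n * (p * x ^+ n.+1 + q * y ^+ n.+1).
Proof.
move=> p0 q0 x0 y0; elim: n => [|n IH]; first by rewrite expr0 !expr1 mul1r.
rewrite [leLHS]exprSr.
apply: (le_trans (ler_wpM2r _ IH)); first by rewrite addr_ge0 ?mulr_ge0.
rewrite [(p + q) ^+ n.+1]exprSr -!mulrA ler_wpM2l ?exprn_ge0 ?addr_ge0 //.
rewrite -subr_ge0 [X in 0 <= X](_ : _ =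
   p * q * ((x ^+ n.+1 - y ^+ n.+1) * (x - y))); last by rewrite !exprS; ring.
apply: mulr_ge0; first exact: mulr_ge0.
have [xy|yx] := leP x y.
  by apply: mulr_le0; rewrite subr_le0 // lerXn2r.
by apply: mulr_ge0; rewrite subr_ge0 ?lerXn2r // ltW.
Qed.

(** Volumes enter through numbers whose powers they dominate, so that roots of infinite volumes
    never occur. [C] is any measurable set containing the sum, because the sum of two measurable
    sets need not be measurable. *)
Definition brunn_minkowski_dim n := forall (A B C : set 'rV[R]_n) (u v : R),
  measurable A -> measurable B -> measurable C -> 0 < u -> 0 < v ->
  ((u ^+ n)%:E <= lebesgue_rV n A)%E -> ((v ^+ n)%:E <= lebesgue_rV n B)%E ->
  (forall x y, A x -> B y -> C (x + y)) ->
  (((u + v) ^+ n)%:E <= lebesgue_rV n C)%E.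

Lemma lebesgue_rV0 (A : set 'rV[R]_0) : (0 < lebesgue_rV 0 A)%E ->
  A 0 /\ lebesgue_rV 0 A = 1%E.
Proof.
rewrite /= /dirac /= indicE; case: (boolP (_ \in _)) => [/set_mem A0 _|_].
  by [].
by rewrite ltxx.
Qed.

(** With [r ^+ n = t] this is the inequality for [r * p] and [r * q]. In dimension 0 there is no
    such root; there a set of positive measure contains the only point and has measure 1, which
    exceeds [t]. *)
Lemma brunn_minkowski_sections n (A B C : set 'rV[R]_n) (p q t : R) : brunn_minkowski_dim n ->
  measurable A -> measurable B -> measurable C -> 0 < p -> 0 < q -> 0 < t ->
  ((t * p ^+ n)%:E <= lebesgue_rV n A)%E -> ((t * q ^+ n)%:E <= lebesgue_rV n B)%E ->
  t < 1 ->
  (forall x y, A x -> B y -> C (x + y)) ->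
  ((t * (p + q) ^+ n)%:E <= lebesgue_rV n C)%E.
Proof.
move=> IH mA mB mC p0 q0 t0 hA hB t1 ABC.
case: n => [|n] in A B C IH mA mB mC hA hB ABC *.
  have pos (X : set 'rV[R]_0) (r : R) : ((t * r ^+ 0)%:E <= lebesgue_rV 0 X)%E -> X 0.
    by rewrite expr0 mulr1 => h; apply: (lebesgue_rV0 _).1; apply: lt_le_trans h; rewrite lte_fin.
  have C0 : C 0 by rewrite -(addr0 0); apply: ABC; [exact: pos hA|exact: pos hB].
  by rewrite expr0 mulr1 /= /dirac /= indicE mem_set // lee_fin ltW.
have [r r0 rt] := exists_root (ltn0Sn n) (ltW t0).
have {}r0 : 0 < r.
  by rewrite lt_neqAle r0 andbT; apply/eqP => r00; move: t0; rewrite -rt -r00 expr0n ltxx.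
rewrite -rt -!exprMn mulrDr in hA hB *.
by apply: IH ABC => //; rewrite mulr_gt0.
Qed.

(** [p] is the root of the supremum of the section volumes: the cube makes the supremum finite, and
    the positive measure of [A] makes it positive. *)
Lemma exists_section_sup n (A : set 'rV[R]_n.+1) (M : R) : measurable A ->
  A `<=` cube n.+1 (- M) M -> 0 <= M -> (0 < lebesgue_rV n.+1 A)%E ->
  exists p : R, [/\ 0 < p,
    forall x, (lebesgue_rV n [set y | A (cons_rV (x, y))] <= (p ^+ n)%:E)%E &
    forall t, 0 < t < 1 -> exists x,
      ((t * p ^+ n)%:E <= lebesgue_rV n [set y | A (cons_rV (x, y))])%E].
Proof.
move=> mA AM M0 A0; set a := fun x : R => lebesgue_rV n [set y | A (cons_rV (x, y))].
have a0 x : (0 <= a x)%E by exact: measure_ge0.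
have [x0 ax0] : exists x, (0 < a x)%E.
  apply: contrapT => /forallNP h; move: A0; rewrite lebesgue_rVE.
  rewrite (_ : integral _ _ _ = 0%E) ?ltxx //.
  by apply: integral0_eq => x _; apply/le_anti; rewrite a0 andbT leNgt; apply/negP/h.
have aM x : (a x <= ((M + M) ^+ n)%:E)%E.
  rewrite -{1}(opprK M) addrC -lebesgue_cube; last by rewrite (@le_trans _ _ 0) // oppr_le0.
  apply: le_measure; rewrite ?inE; [exact: measurable_section|exact: measurable_cube|].
  by move=> y /AM h i; have := h (lift ord0 i); rewrite cons_rVS.
case: n => [|n] in A mA AM A0 a a0 x0 ax0 aM *.
  (* Sections of dimension 0 have measure 0 or 1 and [p ^+ 0 = 1], so any positive [p] would do. *)
  exists 1; split => [//|x|t /andP[t0 t1]]; first by rewrite expr0; have := aM x; rewrite expr0.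
  exists x0; rewrite expr0 mulr1; have [_ ->] := lebesgue_rV0 ax0.
  by rewrite lee_fin ltW.
pose s := ereal_sup (range a).
have s_le : (s <= ((M + M) ^+ n.+1)%:E)%E by apply: ub_ereal_sup => _ [x _ <-].
have s_ge x : (a x <= s)%E by apply: ereal_sup_ubound; exists x.
have s0 : (0 < s)%E by exact: lt_le_trans (s_ge x0).
have sfin : s \is a fin_num by rewrite ge0_fin_numE ?(le_lt_trans s_le) ?ltry // ltW.
have fs0 : 0 < fine s by rewrite fine_gt0 // s0 (le_lt_trans s_le) // ltry.
have [p p0 ps] := exists_root (ltn0Sn n) (ltW fs0).
exists p; split => [|x|t /andP[t0 t1]].
- by rewrite lt_neqAle p0 andbT; apply/eqP => p00; move: fs0; rewrite -ps -p00 expr0n ltxx.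
- by rewrite ps fineK //; exact: s_ge.
- have : ((t * fine s)%:E < s)%E.
    by rewrite -{2}(fineK sfin) lte_fin gtr_pMl.
  by move=> /ereal_sup_gt[_ [x _ <-]] h; exists x; rewrite ps ltW.
Qed.

(* p ^+ n and q ^+ n are the suprema of the volumes of the sections of A and B.
   The section volumes divided by these suprema have supremum 1, so their
   superlevel sets at each level t < 1 are nonempty, and the inequality on the
   line applies to them. *)
Lemma brunn_minkowski_step_bounded n (A B C : set 'rV[R]_n.+1) (M u v : R) :
  brunn_minkowski_dim n -> 0 <= M ->
  A `<=` cube n.+1 (- M) M -> B `<=` cube n.+1 (- M) M ->
  measurable A -> measurable B -> measurable C -> 0 < u -> 0 < v ->
  ((u ^+ n.+1)%:E <= lebesgue_rV n.+1 A)%E -> ((v ^+ n.+1)%:E <= lebesgue_rV n.+1 B)%E ->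
  (forall x y, A x -> B y -> C (x + y)) ->
  (((u + v) ^+ n.+1)%:E <= lebesgue_rV n.+1 C)%E.
Proof.
move=> IH M0 AM BM mA mB mC u0 v0 hA hB ABC.
have [|p [p0 Ap Ap']] := exists_section_sup mA AM M0.
  by apply: lt_le_trans hA; rewrite lte_fin exprn_gt0.
have [|q [q0 Bq Bq']] := exists_section_sup mB BM M0.
  by apply: lt_le_trans hB; rewrite lte_fin exprn_gt0.
pose F (r : R) (X : set 'rV[R]_n.+1) (x : measurableTypeR R) :=
  ((r ^+ n)^-1%:E * lebesgue_rV n [set y | X (cons_rV (x, y))])%E.
have mF r X : measurable X -> measurable_fun setT (F r X).
  move=> mX; apply: emeasurable_funM => //; exact: measurable_fun_section.
have F0 r X x : 0 < r -> (0 <= F r X x)%E.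
  by move=> r0; rewrite mule_ge0 // lee_fin invr_ge0 exprn_ge0 // ltW.
have leF r X t x : 0 < r -> (t%:E <= F r X x)%E =
    ((t * r ^+ n)%:E <= lebesgue_rV n [set y | X (cons_rV (x, y))])%E.
  by move=> r0; rewrite /F muleC lee_pdivlMr ?exprn_gt0 // EFinM.
have Fle r X x : 0 < r -> (F r X x <= 1)%E =
    (lebesgue_rV n [set y | X (cons_rV (x, y))] <= (r ^+ n)%:E)%E.
  by move=> r0; rewrite /F muleC lee_pdivrMr ?exprn_gt0 // mul1e.
have intF r X : 0 < r -> measurable X ->
    (\int[leb]_x F r X x = (r ^+ n)^-1%:E * lebesgue_rV n.+1 X)%E.
  move=> r0 mX; rewrite ge0_integralZl //; last by rewrite lee_fin invr_ge0 exprn_ge0 // ltW.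
  - by rewrite lebesgue_rVE.
  - exact: measurable_fun_section.
have pq0 : 0 < p + q by rewrite addr_gt0.
have h : (\int[leb]_x F p A x + \int[leb]_x F q B x <= \int[leb]_x F (p + q)%R C x)%E.
  apply: prekopa_line; [exact: mF|exact: mF|exact: mF|..].
  - by move=> x; apply/andP; split; [exact: F0|rewrite Fle].
  - by move=> x; apply/andP; split; [exact: F0|rewrite Fle].
  - by move=> x; rewrite F0.
  - by move=> t /Ap'[x hx]; exists x; rewrite leF.
  - by move=> t /Bq'[x hx]; exists x; rewrite leF.
  - move=> t x y /andP[t0 t1]; rewrite !leF // => h1 h2.
    apply: (brunn_minkowski_sections IH _ _ _ p0 q0 t0 h1 h2 t1); try exact: measurable_section.
    move=> z w; rewrite /= => Az Bw; have := ABC _ _ Az Bw.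
    rewrite (_ : _ + _ = cons_rV (x + y, z + w)) //.
    apply/rowP => i; rewrite mxE; case: (unliftP ord0 i) => [j|] ->.
      by rewrite !cons_rVS /= mxE.
    by rewrite !cons_rV0.
rewrite !intF // [leRHS]muleC lee_pdivlMr ?exprn_gt0 // in h.
apply: le_trans h.
apply: (@le_trans _ _ (((p ^+ n)^-1 * u ^+ n.+1 + (q ^+ n)^-1 * v ^+ n.+1) * (p + q) ^+ n)%:E).
  rewrite lee_fin [leRHS]mulrC.
  (* In this form the claim is the power mean inequality with weights [p], [q] at the points
     [u / p], [v / q]. *)
  have px (r w : R) : 0 < r -> (r ^+ n)^-1 * w ^+ n.+1 = r * (w / r) ^+ n.+1.
    move=> r0; have rn0 : r != 0 by rewrite gt_eqF.
    rewrite -{1}(divfK rn0 w) exprMn [r ^+ n.+1]exprS.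
    have := expf_neq0 n rn0; move: (r ^+ n) ((w / r) ^+ n.+1) => z y z0.
    by field.
  rewrite !px //.
  have {1}-> : u + v = p * (u / p) + q * (v / q) by rewrite !(mulrC _ (_ / _)) !divfK ?gt_eqF.
  by apply: power_mean_ineq; rewrite ltW // divr_gt0.
rewrite EFinM lee_pmul2r ?fin_numE // ?lte_fin ?exprn_gt0 // EFinD leeD //.
  by rewrite EFinM lee_wpmul2l // lee_fin invr_ge0 exprn_ge0 // ltW.
by rewrite EFinM lee_wpmul2l // lee_fin invr_ge0 exprn_ge0 // ltW.
Qed.

Lemma cube_cvg n (A : set 'rV[R]_n) : measurable A ->
  (fun k => lebesgue_rV n (A `&` cube n (- k%:R) k%:R)) @ \oo --> lebesgue_rV n A.
Proof.
move=> mA.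
have {2}-> : A = \bigcup_k (A `&` cube n (- k%:R) k%:R).
  rewrite -setI_bigcupr; apply/seteqP; split => [x Ax|x []//].
  split => //.
  pose M := \big[Num.max/0]_i `|x 0 i|.
  exists (truncn M).+1 => // i; rewrite -ltr_norml.
  by apply: le_lt_trans (truncnS_gt _); rewrite /M; exact: le_bigmax.
apply: nondecreasing_cvg_mu => [k||k l kl].
- by apply: measurableI => //; exact: measurable_cube.
- by apply: bigcup_measurable => k _; apply: measurableI => //; exact: measurable_cube.
- rewrite subsetEset; apply: setIS => x h i; have := h i.
  have : (k%:R : R) <= l%:R by rewrite ler_nat.
  by move: (k%:R) (l%:R) (x 0 i) => r s t rs /andP[h1 h2]; apply/andP; split; lra.
Qed.

Lemma lt_cube n (A : set 'rV[R]_n) (a : R) : measurable A -> (a%:E < lebesgue_rV n A)%E ->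
  \forall k \near \oo, (a%:E < lebesgue_rV n (A `&` cube n (- k%:R) k%:R))%E.
Proof.
move=> mA aA.
have [k0 hk0] : exists k, (a%:E < lebesgue_rV n (A `&` cube n (- k%:R) k%:R))%E.
  apply: contrapT => /forallNP h; move: aA; rewrite ltNge => /negP; apply.
  rewrite -(cvg_lim _ (cube_cvg mA)) //; apply: lime_le; first exact: cvgP (cube_cvg mA).
  by apply: nearW => k; rewrite leNgt; apply/negP/h.
exists k0 => // k /= k0k; apply: (lt_le_trans hk0).
apply: le_measure; rewrite ?inE; try by apply: measurableI => //; exact: measurable_cube.
apply: setIS => x h i; have := h i.
have : (k0%:R : R) <= k%:R by rewrite ler_nat.
by move: (k%:R) (k0%:R) (x 0 i) => r s t rs /andP[h1 h2]; apply/andP; split; lra.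
Qed.

(** Replacing [u ^+ n.+1] and [v ^+ n.+1] by [t] times their value, [t < 1], makes the hypotheses
    strict, so that they survive truncation to a large cube. Finally [t] tends to 1. *)
Lemma brunn_minkowski_step n : brunn_minkowski_dim n -> brunn_minkowski_dim n.+1.
Proof.
move=> IH A B C u v mA mB mC u0 v0 hA hB ABC.
have key t : 0 < t < 1 -> ((t * (u + v) ^+ n.+1)%:E <= lebesgue_rV n.+1 C)%E.
  move=> /andP[t0 t1].
  have [r r0 rt] := exists_root (ltn0Sn n) (ltW t0).
  have {}r0 : 0 < r.
    by rewrite lt_neqAle r0 andbT; apply/eqP => r00; move: t0; rewrite -rt -r00 expr0n ltxx.
  rewrite -rt -exprMn mulrDr.
  have lt (w : R) (X : set 'rV[R]_n.+1) : 0 < w -> ((w ^+ n.+1)%:E <= lebesgue_rV n.+1 X)%E ->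
      (((r * w) ^+ n.+1)%:E < lebesgue_rV n.+1 X)%E.
    by move=> w0; apply: lt_le_trans; rewrite lte_fin exprMn rt gtr_pMl // exprn_gt0.
  have hA' := lt_cube mA (lt _ _ u0 hA); have hB' := lt_cube mB (lt _ _ v0 hB).
  have [k /andP[]] : exists k : nat,
      (((r * u) ^+ n.+1)%:E < lebesgue_rV n.+1 (A `&` cube n.+1 (- k%:R) k%:R))%E &&
      (((r * v) ^+ n.+1)%:E < lebesgue_rV n.+1 (B `&` cube n.+1 (- k%:R) k%:R))%E.
    by near \oo => k; exists k; apply/andP; split; near: k.
  move=> hA1 hB1.
  apply: (@brunn_minkowski_step_bounded _ (A `&` cube n.+1 (- k%:R) k%:R) (B `&` cube n.+1 (- k%:R) k%:R)
     _ k%:R) => //; rewrite ?mulr_gt0 //.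
  - by apply: measurableI => //; exact: measurable_cube.
  - by apply: measurableI => //; exact: measurable_cube.
  - exact: ltW.
  - exact: ltW.
  - by move=> x y [Ax _] [By _]; exact: ABC.
have X0 : 0 < (u + v) ^+ n.+1 by rewrite exprn_gt0 // addr_gt0.
move: X0 key; move: (_ ^+ _) => X X0.
case: (lebesgue_rV n.+1 C) => [c| |] key; last 2 first.
- by rewrite leey.
- by have := key 2^-1; rewrite invr_gt0 ltr0n invf_lt1 // ltr1n => /(_ isT).
rewrite lee_fin leNgt; apply/negP => cX.
have c0 : 0 < c.
  have := key 2^-1; rewrite invr_gt0 ltr0n invf_lt1 // ltr1n => /(_ isT).
  by rewrite lee_fin; apply: lt_le_trans; rewrite mulr_gt0.
(* This [t] lies strictly between [c / X] and 1, and [t * X] is the midpoint of [c] and [X], which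
   exceeds [c]. *)
have := key ((c / X + 1) / 2); rewrite lee_fin.
have cX1 : c / X < 1 by rewrite ltr_pdivrMr // mul1r.
have cX0 : 0 < c / X by rewrite divr_gt0.
have -> : (c / X + 1) / 2 * X = (c + X) / 2.
  by rewrite mulrAC mulrDl divfK ?gt_eqF // mul1r.
move=> /(_ _)/wrap[]; first by apply/andP; split; lra.
by move: cX; lra.
Unshelve. all: by end_near. Qed.

Theorem brunn_minkowski n : brunn_minkowski_dim n.
Proof.
elim: n => [|n IH]; last exact: brunn_minkowski_step.
move=> A B C u v mA mB mC _ _; rewrite !expr0 => hA hB ABC.
have C0 : C 0.
  rewrite -(addr0 0); apply: ABC; apply: (lebesgue_rV0 _).1.
    by apply: lt_le_trans hA.
  by apply: lt_le_trans hB.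
by rewrite /= /dirac /= indicE mem_set.
Qed.

End brunn_minkowski.

(** * Balls and Schwarz symmetrization *)

Section euclidean_norm.
Context {R : realType} {n : nat}.
Implicit Types x y z : 'rV[R]_n.

Lemma dotpC x y : dotp x y = dotp y x.
Proof. by apply: eq_bigr => i _; rewrite mulrC. Qed.

Lemma dotpDl x y z : dotp (x + y) z = dotp x z + dotp y z.
Proof. by rewrite -big_split; apply: eq_bigr => i _ /=; rewrite mxE mulrDl. Qed.

Lemma dotpZl a x y : dotp (a *: x) y = a * dotp x y.
Proof. by rewrite /dotp mulr_sumr; apply: eq_bigr => i _; rewrite mxE mulrA. Qed.

Lemma dotpDr x y z : dotp z (x + y) = dotp z x + dotp z y.
Proof. by rewrite dotpC dotpDl !(dotpC _ z). Qed.

Lemma dotpZr a x y : dotp y (a *: x) = a * dotp y x.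
Proof. by rewrite dotpC dotpZl dotpC. Qed.

Lemma dotp_ge0 x : 0 <= dotp x x.
Proof. by apply: sumr_ge0 => i _; rewrite -expr2 sqr_ge0. Qed.

Lemma enorm_ge0 x : 0 <= enorm x. Proof. exact: sqrtr_ge0. Qed.

Lemma sqr_enorm x : enorm x ^+ 2 = dotp x x.
Proof. by rewrite sqr_sqrtr // dotp_ge0. Qed.

Lemma dotp_le_enorm x y : dotp x y <= enorm x * enorm y.
Proof.
have h : dotp x y ^+ 2 <= dotp x x * dotp y y.
  have [y0|y0] := eqVneq (dotp y y) 0.
    (* When [dotp y y = 0] the quadratic in [t] degenerates to an affine function; being nonnegative
       for all [t], it has slope 0. *)
    have q t : 0 <= dotp x x + 2 * t * dotp x y.
      have := dotp_ge0 (x + t *: y).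
      rewrite !(dotpDl, dotpDr, dotpZl, dotpZr) y0 (dotpC y x).
      by rewrite [X in 0 <= X -> _](_ : _ = dotp x x + 2 * t * dotp x y) //; ring.
    have xy0 : dotp x y = 0.
      apply/eqP/negPn/negP => xy0.
      have := q (- (dotp x x + 1) / (2 * dotp x y)).
      rewrite (_ : _ + _ = -1); last by field.
      by rewrite lerNr oppr0 ler10.
    by rewrite xy0 y0 mulr0 expr0n.
  have yy : 0 < dotp y y by rewrite lt_neqAle eq_sym y0 dotp_ge0.
  have := dotp_ge0 (dotp y y *: x + (- dotp x y) *: y).
  rewrite !(dotpDl, dotpDr, dotpZl, dotpZr) (dotpC y x).
  rewrite [X in 0 <= X](_ : _ = dotp y y * (dotp x x * dotp y y - dotp x y ^+ 2)); last by ring.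
  by rewrite pmulr_rge0 // subr_ge0.
rewrite (le_trans (ler_norm _)) // -sqrtr_sqr -sqrtrM ?dotp_ge0 // ler_wsqrtr //.
Qed.

Lemma enormD x y : enorm (x + y) <= enorm x + enorm y.
Proof.
rewrite -(@ler_pXn2r _ 2) ?nnegrE ?addr_ge0 ?enorm_ge0 //.
rewrite sqrrD !sqr_enorm !(dotpDl, dotpDr) (dotpC y x).
have := dotp_le_enorm x y; lra.
Qed.

Lemma enormZ a x : enorm (a *: x) = `|a| * enorm x.
Proof.
rewrite /enorm dotpZl dotpC dotpZl mulrA -expr2 sqrtrM ?sqr_ge0 //.
by rewrite sqrtr_sqr.
Qed.

Lemma enormN x : enorm (- x) = enorm x.
Proof. by rewrite -scaleN1r enormZ normrN normr1 mul1r. Qed.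

Lemma coor_le_enorm x i : `|x 0 i| <= enorm x.
Proof.
rewrite -sqrtr_sqr ler_wsqrtr // /dotp (bigD1 i) //= expr2 lerDl.
by apply: sumr_ge0 => j _; rewrite -expr2 sqr_ge0.
Qed.

Lemma enorm_le_sum x : enorm x <= \sum_i `|x 0 i|.
Proof.
have s0 : 0 <= \sum_i `|x 0 i| by apply: sumr_ge0.
rewrite -(ger0_norm s0) -sqrtr_sqr ler_wsqrtr // expr2 mulr_suml.
apply: ler_sum => i _; apply: (@le_trans _ _ (`|x 0 i| * `|x 0 i|)).
  by rewrite -normrM ler_norm.
rewrite ler_wpM2l // (bigD1 i) //= lerDl; exact: sumr_ge0.
Qed.

Lemma enorm_le_bound x e : (forall i, `|x 0 i| <= e) -> enorm x <= n%:R * e.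
Proof.
move=> h; apply: (le_trans (enorm_le_sum x)).
apply: (@le_trans _ _ (\sum_(i < n) e)); first exact: ler_sum.
by rewrite sumr_const card_ord mulr_natl.
Qed.

Lemma measurable_eball (r : R) : measurable (@eball R n r).
Proof.
have [r0|r0] := leP r 0.
  rewrite (_ : eball r = set0) // -subset0 => x /=; rewrite /eball /= ltNge.
  by rewrite (le_trans r0) // enorm_ge0.
have -> : @eball R n r = (fun x => dotp x x) @^-1` `]-oo, r ^+ 2[%classic.
  apply/seteqP; split => x /=; rewrite /eball /= in_itv /= -sqr_enorm ltr_pXn2r //;
    by rewrite nnegrE ?enorm_ge0 // ltW.
apply: preimage_measurable => //.
apply: measurable_sum => i; apply: measurable_funM; exact: measurable_coor.
Qed.

End euclidean_norm.

Section balls.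
Context {R : realType} {n : nat}.
Local Notation mu := (@lebesgue_rV R n).

Lemma cubeN_neq0 (U : set 'rV[R]_n) x : open U -> U x ->
  exists2 e, 0 < e & forall y, cube n (- e) e y -> U (x + y).
Proof.
move=> oU Ux; have [e /= e0 eU] := (nbhs_ballP _ _).1 (oU _ Ux).
exists e => // y hy; apply: eU; split => // i j; rewrite !ord1 /ball /= mxE.
by rewrite opprD addNKr normrN ltr_norml hy.
Qed.

Lemma open_lebesgue_gt0 (U : set 'rV[R]_n) : open U -> U !=set0 -> (0 < mu U)%E.
Proof.
move=> oU [x Ux]; have [e e0 eU] := cubeN_neq0 oU Ux.
apply: (@lt_le_trans _ _ (mu (cube n (- e) e))).
  by rewrite lebesgue_cube ?lte_fin ?exprn_gt0 //; lra.
rewrite -(lebesgue_rV_translate x (open_measurable_rV oU)).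
apply: le_measure; rewrite ?inE; first exact: measurable_cube.
  by apply: preimage_measurable; [exact: measurable_translate|exact: open_measurable_rV].
by move=> y /eU; rewrite /= addrC.
Qed.

(** [k] is the root of the volume of the unit ball. Writing volumes of balls as powers turns the
    Brunn-Minkowski inequality into one between radii. *)
Lemma lebesgue_eball (n_gt0 : (0 < n)%N) : exists2 k : R, 0 < k &
  forall r, 0 <= r -> mu (eball r) = ((k * r) ^+ n)%:E.
Proof.
have n0 : 0 < n%:R :> R by rewrite ltr0n.
have h1 : (0 < mu (eball 1))%E.
  (* The Euclidean norm is at most [n] times the largest coordinate, here at most
     [n%:R * e = 1 / 2]. *)
  pose e : R := (n%:R * 2)^-1.
  have e0 : 0 < e by rewrite invr_gt0 mulr_gt0.
  apply: (@lt_le_trans _ _ (mu (cube n (- e) e))).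
    by rewrite lebesgue_cube ?lte_fin ?exprn_gt0 //; lra.
  apply: le_measure; rewrite ?inE; [exact: measurable_cube|exact: measurable_eball|].
  move=> x hx; rewrite /eball /=.
  apply: (@le_lt_trans _ _ (n%:R * e)).
    by apply: enorm_le_bound => i; rewrite ler_norml; have /andP[h1 h2] := hx i; rewrite !ltW.
  by rewrite /e invfM mulrA divff ?gt_eqF // mul1r invf_lt1 // ltr1n.
have h2 : (mu (eball 1) < +oo)%E.
  apply: (@le_lt_trans _ _ (mu (cube n (-1) 1))).
    apply: le_measure; rewrite ?inE; [exact: measurable_eball|exact: measurable_cube|].
    move=> x hx i; rewrite -ltr_norml; exact: (le_lt_trans (coor_le_enorm x i)).
  by rewrite lebesgue_cube ?ltry //; lra.
have w0 : 0 < fine (mu (eball 1)) by rewrite fine_gt0 // h1.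
have [k k0 kw] := exists_root n_gt0 (ltW w0).
exists k => [|r].
  by rewrite lt_neqAle k0 andbT; apply/eqP => k00; move: w0; rewrite -kw -k00 expr0n gtn_eqF // ltxx.
rewrite le_eqVlt => /predU1P[<-|r0].
  rewrite mulr0 expr0n gtn_eqF // (_ : eball 0 = set0) ?measure0 // -subset0 => x.
  by rewrite /eball /= ltNge enorm_ge0.
have -> : @eball R n r = (fun x => r^-1 *: x) @^-1` eball 1.
  apply/seteqP; split => x; rewrite /eball /= enormZ gtr0_norm ?invr_gt0 //;
    by rewrite mulrC ltr_pdivrMr // mul1r.
rewrite lebesgue_rV_scale ?invr_gt0 //; last exact: measurable_eball.
by rewrite invrK exprMn kw mulrC EFinM fineK // ge0_fin_numE // measure_ge0.
Qed.

End balls.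

Section radius.
Context {R : realType} {n : nat}.
Variable n_gt0 : (0 < n)%N.
Local Notation mu := (@lebesgue_rV R n).

Lemma eball_inj (r r' : R) : 0 <= r -> 0 <= r' -> mu (eball r) = mu (eball r') -> r = r'.
Proof.
have [k k0 kE] := @lebesgue_eball R n n_gt0.
move=> r0 r'0; rewrite !kE // => -[] /eqP.
rewrite eqrXn2 ?mulr_ge0 //; try exact: ltW.
by move=> /eqP /mulfI; apply; rewrite gt_eqF.
Qed.

Lemma exists_radius (E : set 'rV[R]_n) : (mu E < +oo)%E ->
  exists2 r : R, 0 <= r & mu (eball r) = mu E.
Proof.
move=> Efin; have [k k0 kE] := @lebesgue_eball R n n_gt0.
have E0 : 0 <= fine (mu E) by rewrite fine_ge0.
have [p p0 pE] := exists_root n_gt0 E0.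
exists (p / k); first by rewrite divr_ge0 // ltW.
rewrite kE; last by rewrite divr_ge0 // ltW.
by rewrite mulrCA divff ?gt_eqF // mulr1 pE fineK // ge0_fin_numE.
Qed.

Lemma sym_ballE (E : set 'rV[R]_n) (r : R) : 0 <= r -> mu (eball r) = mu E ->
  sym_ball E = eball r.
Proof.
move=> r0 rE; apply/seteqP; split => x /=; last by move=> xr; exists r.
move=> [r' r'E xr'].
have r'0 : 0 <= r' by apply: (le_trans (enorm_ge0 x)); apply: ltW.
by rewrite (_ : r = r') //; apply: eball_inj => //; rewrite rE.
Qed.

End radius.

(** * Superlevel sets and modulus of continuity of the symmetral *)

Section schwarz_levels.
Context {R : realType} {n : nat}.
Variable n_gt0 : (0 < n)%N.
Local Notation mu := (@lebesgue_rV R n).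
Variables (f : 'rV[R]_n -> R) (M : R).
Hypothesis mf : measurable_fun setT f.
Hypothesis f_le : forall x, f x <= M.
Hypothesis f_fin : forall t : R, 0 < t -> (mu [set x | (t <= f x)%R] < +oo)%E.

Lemma measurable_superlevel t : measurable [set x | t <= f x].
Proof.
rewrite (_ : [set x | t <= f x] = f @^-1` `[t, +oo[%classic); last first.
  by apply/seteqP; split => x /=; rewrite in_itv /= andbT.
exact: preimage_measurable.
Qed.

Lemma schwarz_radius : exists r : R -> R,
  [/\ forall t, 0 < t -> 0 <= r t /\ mu (eball (r t)) = mu [set x | t <= f x],
   forall t x, 0 < t -> enorm x < r t -> t <= schwarz f x &
   forall t x, 0 < t -> t < schwarz f x -> enorm x < r t].
Proof.
have hr t : exists r : R, 0 < t -> 0 <= r /\ mu (eball r) = mu [set x | t <= f x].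
  have [t0|t0] := ltP 0 t; last first.
    by exists 0.
  by have [q q0 qE] := exists_radius n_gt0 (f_fin t0); exists q.
have {hr} [r hr] := choice hr.
pose S (x : 'rV[R]_n) : set R := [set t | 0 < t /\ enorm x < r t].
have r_anti t u : 0 < t -> t <= u -> r u <= r t.
  move=> t0 tu; have u0 := lt_le_trans t0 tu.
  have [rt0 rtE] := hr t t0; have [ru0 ruE] := hr u u0.
  have [k k0 kE] := @lebesgue_eball R n n_gt0.
  have : (mu (eball (r u)) <= mu (eball (r t)))%E.
    rewrite rtE ruE; apply: le_measure; rewrite ?inE; try exact: measurable_superlevel.
    by move=> x; exact: le_trans.
  rewrite !kE // lee_fin ler_pXn2r ?nnegrE ?mulr_ge0 ?(ltW k0) //.
  by rewrite ler_pM2l.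
have SM x t : S x t -> t <= M.
  move=> [t0]; apply: contraTT; rewrite -!ltNge => Mt; rewrite -leNgt.
  have [rt0 rtE] := hr t t0.
  rewrite (_ : r t = 0) ?enorm_ge0 //; apply: (eball_inj n_gt0) => //.
  rewrite rtE; congr (mu _); apply/seteqP; split => y /=.
    by move=> tf; have := le_trans tf (f_le y); rewrite leNgt Mt.
  by rewrite /eball /= ltNge enorm_ge0.
have mS x : measurable (S x : set (measurableTypeR R)).
  apply: is_interval_measurable => s t /= [s0 hs] [t0 ht] u /andP[su ut]; split.
    exact: lt_le_trans su.
  apply: (lt_le_trans ht); apply: r_anti => //; exact: lt_le_trans su.
have schE x : schwarz f x = fine (lebesgue_measure (S x)).
  rewrite /schwarz /Rintegral; congr fine.
  transitivity (\int[lebesgue_measure]_(t in `]0%R, +oo[) (\1_(S x) t)%:E)%E.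
    apply: eq_integral => t; rewrite inE /= in_itv /= andbT => t0.
    have [rt0 rtE] := hr t t0.
    rewrite (sym_ballE n_gt0 rt0 rtE) !indicE; congr ((_%:R)%:E).
    rewrite /in_mem /= /mem /= /in_set.
    by congr nat_of_bool; apply/asboolP/asboolP => [|[_]] // h; split.
  rewrite integral_indic //; congr lebesgue_measure.
  by apply/seteqP; split => t /=; rewrite in_itv /= andbT; [case|move=> [? ?]].
(* [schwarz] takes [fine] of an integral, and an infinite integral would give the junk value 0; the
   bound [M] excludes this. *)
have Sfin x : (lebesgue_measure (S x : set (measurableTypeR R)) < +oo)%E.
  apply: (@le_lt_trans _ _ (lebesgue_measure (`]0, M]%classic : set (measurableTypeR R)))).
    apply: le_measure; rewrite ?inE // => t Sxt; rewrite /= in_itv /= (SM x) // andbT.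
    by case: Sxt.
  by rewrite /= lebesgue_measure_itv /=; case: ifP => // _; rewrite sube0 ltry.
exists r; split => [//|t x t0 xt|t x t0].
  rewrite schE -lee_fin fineK ?ge0_fin_numE //.
  apply: (@le_trans _ _ (lebesgue_measure (`]0, t]%classic : set (measurableTypeR R)))).
    by rewrite /= lebesgue_measure_itv /= lte_fin t0 sube0.
  apply: le_measure; rewrite ?inE // => u; rewrite /= in_itv /= => /andP[u0 ut].
  by split => //; apply: (lt_le_trans xt); exact: r_anti.
apply: contraTT; rewrite -!leNgt => rx.
rewrite schE -lee_fin fineK ?ge0_fin_numE //.
apply: (@le_trans _ _ (lebesgue_measure (`]0, t[%classic : set (measurableTypeR R)))).
  apply: le_measure; rewrite ?inE // => u [u0 xu]; rewrite /= in_itv /= u0 /=.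
  rewrite ltNge; apply/negP => tu; move: xu; rewrite ltNge => /negP; apply.
  exact: (le_trans (r_anti _ _ t0 tu)).
by rewrite /= lebesgue_measure_itv /= lte_fin t0 sube0.
Qed.

Lemma schwarz_ge0 x : 0 <= schwarz f x.
Proof. by apply: Rintegral_ge0 => t _; rewrite indicE. Qed.

Lemma schwarz_modulus (s rho : R) (K : set 'rV[R]_n) : 0 < s -> 0 < rho ->
  measurable K -> (mu (eball rho) <= mu K)%E ->
  (forall xi x t, K xi -> 0 < t -> f x - f (x + t *: xi) <= t `^ s) ->
  forall x y, schwarz f y - schwarz f x <= (enorm (x - y) / rho) `^ s.
Proof.
move=> s0 rho0 mK rhoK hK x y.
have [r [hr hr1 hr2]] := schwarz_radius.
rewrite leNgt; apply/negP => gap.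
set d := enorm (x - y) in gap *.
have d0 : 0 <= (d / rho) `^ s by exact: powR_ge0.
(* Both levels move inward by [e] to meet the strict inequalities for the radii. A third of the
   excess leaves [v - u] above the modulus by exactly [e]. *)
pose e := (schwarz f y - schwarz f x - (d / rho) `^ s) / 3.
have e0 : 0 < e by rewrite /e divr_gt0 // subr_gt0.
pose v := schwarz f y - e; pose u := schwarz f x + e.
have sx := schwarz_ge0 x.
have uv : (d / rho) `^ s < v - u.
  have : 3 * e = schwarz f y - schwarz f x - (d / rho) `^ s by rewrite mulrC divfK.
  move=> h; rewrite /v /u; lra.
have u0 : 0 < u by rewrite ltr_wpDl.
have v0 : 0 < v by lra.
have yv : enorm y < r v by apply: hr2; rewrite // gtrBl.
have xu : r u <= enorm x.
  rewrite leNgt; apply/negP => /(hr1 _ _ u0); rewrite /u; move: e0; lra.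
(* This makes [t ^ s = v - u]: a step of length [t] along a vector of [K] starting in [{f >= v}]
   ends in [{f >= u}]. *)
pose t := (v - u) `^ s^-1.
have vu0 : 0 < v - u by exact: le_lt_trans uv.
have t0 : 0 < t by exact: powR_gt0.
have ts : t `^ s = v - u by rewrite /t -powRrM mulVf ?powRr1 ?gt_eqF // ltW.
have [k k0 kE] := @lebesgue_eball R n n_gt0.
have [rv0 rvE] := hr _ v0; have [ru0 ruE] := hr _ u0.
have rv0' : 0 < r v by apply: le_lt_trans yv; exact: enorm_ge0.
have mtK : measurable ((fun x : 'rV[R]_n => t^-1 *: x) @^-1` K).
  by apply: preimage_measurable => //; exact: measurable_scale_rV.
have BM : (((k * r v + k * (t * rho)) ^+ n)%:E <= mu [set x | (u <= f x)%R])%E.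
  apply: (@brunn_minkowski R n _ _ _ _ _ (measurable_superlevel v) mtK (measurable_superlevel u)).
  - by rewrite mulr_gt0.
  - by rewrite !mulr_gt0.
  - by rewrite -rvE kE.
  - rewrite lebesgue_rV_scale ?invr_gt0 // invrK.
    rewrite (_ : k * (t * rho) = t * (k * rho)); last by rewrite mulrCA.
    rewrite exprMn EFinM; apply: lee_wpmul2l; first by rewrite lee_fin exprn_ge0 // ltW.
    by rewrite -kE // ltW.
  - move=> z w /= vz Kw; have := hK _ z t Kw t0.
    rewrite scalerA divff ?gt_eqF // scale1r ts; move: vz; lra.
rewrite -ruE kE // lee_fin -mulrDr in BM.
have {}BM : r v + t * rho <= r u.
  have trho : 0 <= t * rho by rewrite ltW // mulr_gt0.
  rewrite -(ler_pM2l k0) -(ler_pXn2r n_gt0) // nnegrE mulr_ge0 ?(ltW k0) //.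
  exact: addr_ge0.
(* [r v + t * rho <= r u <= enorm x <= d + enorm y < d + r v]. *)
have dr : t * rho < d.
  have := enormD (x - y) y; rewrite subrK -/d => h.
  by move: BM xu yv h; move: (enorm x) (enorm y) (r u) (r v) (t * rho) => *; lra.
have : t `^ s < (d / rho) `^ s.
  have tdr : t < d / rho by rewrite ltr_pdivlMr.
  apply: gt0_ltr_powR => //; rewrite nnegrE; first exact: ltW.
  by rewrite ltW // (lt_trans t0).
by rewrite ts ltNge (ltW uv).
Qed.

End schwarz_levels.

(** * Finite differences *)

Section finite_differences.
Context {R : realType} {n : nat}.
Local Notation mu := (@lebesgue_rV R n).
Implicit Types (g : 'rV[R]_n -> R) (q : R -> R).

Lemma continuous_rVP g : continuous g <->
  forall (x : 'rV[R]_n) (e : R), 0 < e ->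
  exists2 d : R, 0 < d & forall y : 'rV[R]_n, (forall i, `|x 0 i - y 0 i| < d) -> `|g x - g y| < e.
Proof.
split => [cg x e e0|h x A /nbhs_ballP[e e0 eA]].
  have /nbhs_ballP[d /= d0 dg] : nbhs x (g @^-1` ball (g x) e).
    by apply: cg; exact: nbhsx_ballx.
  exists d => // y xy; apply: dg; split => // i j.
  by rewrite !ord1; exact: xy.
have [d d0 dg] := h x e e0.
apply/nbhs_ballP; exists d => // y [_ xy]; apply: eA.
by apply: dg => i; exact: xy.
Qed.

Definition fd_set q s g : set 'rV[R]_n :=
  [set xi | forall x t, 0 < t -> q (g (x + t *: xi) - g x) <= t `^ s].

Lemma pos_partE (a : R) : pos_part a = (a + `|a|) / 2.
Proof.
by rewrite /pos_part; case: (ltrgt0P a) => a0; rewrite ?a0; lra.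
Qed.

Lemma neg_partE (a : R) : neg_part a = pos_part (- a).
Proof. by []. Qed.

Lemma pos_part_ge0 (a : R) : 0 <= pos_part a.
Proof. by rewrite /pos_part le_max lexx orbT. Qed.

Lemma pos_part_le (a : R) : pos_part a <= `|a|.
Proof. by rewrite /pos_part ge_max ler_norm normr_ge0. Qed.

Lemma neg_part_le (a : R) : neg_part a <= `|a|.
Proof. by rewrite neg_partE -normrN pos_part_le. Qed.

Lemma continuous_pos_part : continuous (pos_part : R -> R).
Proof.
rewrite (_ : pos_part = fun a => (a + `|a|) / 2); last by apply/funext => a; rewrite pos_partE.
move=> a; apply: cvgMl; apply: cvgD; [exact: cvg_id|exact: (@norm_continuous _ R^o)].
Qed.

Lemma continuous_neg_part : continuous (neg_part : R -> R).
Proof.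
move=> a; apply: (continuous_comp (f := -%R) (g := pos_part)).
  exact: opp_continuous.
exact: continuous_pos_part.
Qed.

Lemma poweR_le1 (X : \bar R) (a : R) : 0 < a -> (0 <= X)%E ->
  (X `^ a <= 1)%E = (X <= 1)%E.
Proof.
move=> a0 X0.
have mono b (Y Z : \bar R) : 0 < b -> (0 <= Y)%E -> (Y <= Z)%E -> (Y `^ b <= Z `^ b)%E.
  move=> b0 Y0 YZ; apply: gt0_ler_poweR => //; rewrite ?ltW // in_itv /= ?Y0 ?leey //.
  by rewrite (le_trans Y0 YZ).
apply/idP/idP => h.
  have := mono a^-1 _ _ _ (poweR_ge0 _ _) h.
  by rewrite invr_gt0 -poweRrM divff ?gt_eqF // poweRe1 // poweR1r; apply.
by have := mono a _ _ a0 X0 h; rewrite poweR1r.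
Qed.

(** Comparison with 1 is insensitive to a positive power, so the outer exponent [s^-1] disappears
    and no value of the gauge has to be computed. *)
Lemma Pi_fdE q s g : 0 < s -> (forall a, 0 <= q a) ->
  unit_set (frac_gauge q s g) = fd_set q s g.
Proof.
move=> s0 q0; apply/seteqP; rewrite /unit_set /frac_gauge.
pose S xi := [set (z.2 `^ (- s) * q (g (z.1 + z.2 *: xi)%R - g z.1))%:E
  | z in [set: 'rV[R]_n] `*` `]0%R, +oo[].
have Sm xi x t : 0 < t -> S xi (t `^ (- s) * q (g (x + t *: xi) - g x))%:E.
  by move=> t0; exists (x, t) => //; split => //=; rewrite in_itv /= t0.
have S0 xi : (0 <= ereal_sup (S xi))%E.
  apply: le_trans (ereal_sup_ubound (Sm xi 0 1 ltr01)).
  by rewrite lee_fin mulr_ge0 // powR_ge0.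
have si : 0 < s^-1 by rewrite invr_gt0.
split => xi /=; rewrite (poweR_le1 si (S0 xi)) => h.
  move=> x t t0; have := le_trans (ereal_sup_ubound (Sm xi x t t0)) h.
  by rewrite lee_fin powRN ler_pdivrMl ?powR_gt0 // mulr1.
apply: ub_ereal_sup => _ /= [[x t] [_ /= t0] <-].
rewrite in_itv /= andbT in t0.
by rewrite lee_fin powRN ler_pdivrMl ?powR_gt0 // mulr1; exact: h.
Qed.

(** Measurability of all the bodies is obtained from closedness. *)
Lemma closed_fd_set q s g : continuous q -> continuous g -> closed (fd_set q s g).
Proof.
move=> cq cg.
have -> : fd_set q s g = \bigcap_(z in [set z : 'rV[R]_n * R | 0 < z.2])
    ((fun xi => q (g (z.1 + z.2 *: xi) - g z.1)) @^-1` [set r | r <= z.2 `^ s]).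
  apply/seteqP; split => xi h; first by move=> [x t] /= t0; exact: h.
  by move=> x t t0; exact: (h (x, t)).
apply: closed_bigI => -[x t] /= t0.
apply: closed_comp; last exact: closed_le.
have ch : continuous (fun xi : 'rV[R]_n => g (x + t *: xi) - g x).
  apply/continuous_rVP => xi e e0.
  have [d d0 hd] := (continuous_rVP g).1 cg (x + t *: xi) e e0.
  exists (d / t) => [|y hy]; first exact: divr_gt0.
  rewrite opprB addrA subrK; apply: hd => i; rewrite !mxE opprD addrACA subrr add0r -mulrBr.
  by rewrite normrM gtr0_norm // mulrC -ltr_pdivlMr.
by move=> xi _; exact: (continuous_comp (ch xi) (cq _)).
Qed.

Lemma vol_negpow_le (K K' : set 'rV[R]_n) a : 0 <= a -> (mu K <= mu K')%E ->
  (vol_negpow K' a <= vol_negpow K a)%E.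
Proof.
move=> a0 KK'; rewrite /vol_negpow.
have : (0 <= mu K)%E by []; have : (0 <= mu K')%E by [].
move: KK'; move: (mu K) (mu K') => X Y XY Y0 X0.
have : (X `^ a <= Y `^ a)%E.
  by apply: gt0_ler_poweR => //; rewrite in_itv /= leey andbT.
have := poweR_ge0 X a; have := poweR_ge0 Y a.
move: (X `^ a)%E (Y `^ a)%E => {XY X0 Y0 X Y} [x| |] [y| |] //=; rewrite /inve /= ?lee_fin.
(* A body of volume 0 has the inverse [+oo], the largest possible value. *)
- move=> y0 x0 xy; have [x00|x00] := eqVneq x 0; first by rewrite leey.
  have x_gt0 : 0 < x by rewrite lt_neqAle eq_sym x00.
  have y_gt0 : 0 < y by exact: lt_le_trans xy.
  by rewrite gt_eqF // lee_fin lef_pV2.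
- move=> _ x0 _; case: ifP => _; first by rewrite leey.
  by rewrite lee_fin invr_ge0.
Qed.

Lemma holder_continuous (g : 'rV[R]_n -> R) s rho : 0 < s -> 0 < rho ->
  (forall x y, g y - g x <= (enorm (x - y) / rho) `^ s) -> continuous g.
Proof.
move=> s0 rho0 h; apply/continuous_rVP => x e' e'0.
pose e := e' / 2; have e0 : 0 < e by rewrite divr_gt0.
(* The coordinates control the Euclidean norm up to the factor [n]; dividing by [n%:R + 1] also
   covers [n = 0]. *)
pose d := rho * e `^ s^-1 / (n%:R + 1).
have n1 : 0 < n%:R + 1 :> R by rewrite ltr_wpDl.
have d0 : 0 < d by rewrite divr_gt0 // mulr_gt0 // powR_gt0.
exists d => // y xy; apply: (@le_lt_trans _ _ e); last by rewrite /e; lra.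
have ball i : `|(x - y) 0 i| <= d by rewrite !mxE ltW.
have dxy : enorm (x - y) / rho <= e `^ s^-1.
  rewrite ler_pdivrMr // mulrC; apply: (le_trans (enorm_le_bound ball)).
  rewrite /d mulrCA ler_piMr ?mulr_ge0 ?powR_ge0 ?(ltW rho0) //.
  by rewrite ler_pdivrMr // mul1r lerDl.
have es : (enorm (x - y) / rho) `^ s <= e.
  have s_neq0 : s != 0 by rewrite gt_eqF.
  rewrite -[leRHS](powRr1 (ltW e0)) -(mulVf s_neq0) powRrM.
  apply: ge0_ler_powR; rewrite ?nnegrE ?powR_ge0 ?(ltW s0) //.
  by rewrite divr_ge0 ?enorm_ge0 // ltW.
rewrite ler_norml lerNl opprB; apply/andP; split.
  exact: le_trans es.
by apply: le_trans es; rewrite -(enormN (x - y)) opprB.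
Qed.

(** * Comparison of the bodies of a function with those of its symmetral *)

Section comparison.
Variable n_gt0 : (0 < n)%N.
Variables (f : 'rV[R]_n -> R) (M : R).
Hypothesis cf : continuous f.
Hypothesis f_le : forall x, f x <= M.
Hypothesis f_fin : forall t : R, 0 < t -> (mu [set x | (t <= f x)%R] < +oo)%E.

(** [K] may be any measurable set of directions along which [f] decreases slowly, not only a body;
    this leaves room for the reflection in the case of the positive part. *)
Lemma fd_set_schwarz q s (K : set 'rV[R]_n) : 0 < s ->
  continuous q -> (forall a, q a <= `|a|) -> measurable K ->
  (forall xi x t, K xi -> 0 < t -> f x - f (x + t *: xi) <= t `^ s) ->
  (mu K <= mu (fd_set q s (schwarz f)))%E.
Proof.
move=> s0 cq qabs mK hK.
have mf := continuous_measurable_rV cf.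
have [k k0 kE] := @lebesgue_eball R n n_gt0.
(* Only a positive radius gives a modulus for the symmetral, and with it the continuity that makes
   its body measurable. *)
have key rho : 0 < rho -> (mu (eball rho) <= mu K)%E ->
    (mu (eball rho) <= mu (fd_set q s (schwarz f)))%E.
  move=> rho0 rhoK.
  have H := schwarz_modulus n_gt0 mf f_le f_fin s0 rho0 mK rhoK hK.
  have cfs := holder_continuous s0 rho0 H.
  apply: le_measure; rewrite ?inE; first exact: measurable_eball.
    by apply: closed_measurable_rV; exact: closed_fd_set.
  move=> xi /= xirho x t t0; apply: (le_trans (qabs _)).
  have hle : (enorm (t *: xi) / rho) `^ s <= t `^ s.
    apply: ge0_ler_powR; rewrite ?nnegrE ?(ltW s0) ?(ltW t0) ?divr_ge0 ?enorm_ge0 ?(ltW rho0) //.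
    by rewrite enormZ gtr0_norm // ler_pdivrMr // ler_pM2l // ltW.
  rewrite ler_norml lerNl opprB; apply/andP; split.
    by have := H (x + t *: xi) x; rewrite [X in enorm X]addrC addKr => h; exact: le_trans hle.
  have := H x (x + t *: xi); rewrite opprD addNKr enormN => h; exact: le_trans hle.
(* No ball has the volume of [K] when that is infinite; then balls of every radius fit into the body
   of the symmetral. *)
have [Koo|Kfin] := eqVneq (mu K) +oo%E.
  rewrite Koo leye_eq; apply/eqP/eqyP => r.
  intros r0.
  have [p p0 pr] := exists_root n_gt0 (ltW r0).
  have {}p0 : 0 < p.
    by rewrite lt_neqAle p0 andbT; apply/eqP => p00; move: r0; rewrite -pr -p00 expr0n gtn_eqF // ltxx.
  have pk0 : 0 < p / k by exact: divr_gt0.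
  have := key _ pk0; rewrite kE ?(ltW pk0) // mulrCA divff ?gt_eqF // mulr1 pr Koo leey.
  exact.
have Klty : (mu K < +oo)%E by rewrite ltey.
have [rho rho0 rhoE] := exists_radius n_gt0 Klty.
rewrite -rhoE; move: rho0; rewrite le_eqVlt => /predU1P[<-|rho0].
  by rewrite kE // mulr0 expr0n gtn_eqF //=; exact: measure_ge0.
by apply: key => //; rewrite rhoE.
Qed.

Lemma fd_pos_schwarz s : 0 < s ->
  (mu (fd_set pos_part s f) <= mu (fd_set pos_part s (schwarz f)))%E.
Proof.
move=> s0; have cl := @closed_fd_set _ s _ continuous_pos_part cf.
rewrite -lebesgue_rV_opp; last exact: closed_measurable_rV.
apply: fd_set_schwarz => //; [exact: continuous_pos_part|exact: pos_part_le| |].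
  apply: preimage_measurable; [exact: measurable_opp_rV|exact: closed_measurable_rV].
move=> xi x t /= h t0; have := h (x + t *: xi) t t0; rewrite scalerN addrK.
by apply: le_trans; rewrite /pos_part le_max lexx.
Qed.

Lemma fd_neg_schwarz s : 0 < s ->
  (mu (fd_set neg_part s f) <= mu (fd_set neg_part s (schwarz f)))%E.
Proof.
move=> s0; have cl := @closed_fd_set _ s _ continuous_neg_part cf.
apply: fd_set_schwarz => //; [exact: continuous_neg_part|exact: neg_part_le| |].
  exact: closed_measurable_rV.
move=> xi x t /= h t0; have := h x t t0.
by apply: le_trans; rewrite /neg_part le_max opprB lexx.
Qed.

Lemma fd_norm_schwarz s : 0 < s ->
  (mu (fd_set normr s f) <= mu (fd_set normr s (schwarz f)))%E.
Proof.
have cn : continuous (normr : R -> R) by exact: (@norm_continuous _ R^o).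
move=> s0; have cl := @closed_fd_set _ s _ cn cf.
apply: fd_set_schwarz => //; first exact: closed_measurable_rV.
move=> xi x t /= h t0; have := h x t t0.
by apply: le_trans; rewrite -normrN opprB ler_norm.
Qed.

End comparison.

(** * Continuity, boundedness and superlevel sets of Sobolev functions *)

Section sobolev_facts.
Variable f : 'rV[R]_n -> R.
Hypothesis fW : sobolev_1_infty f.
Hypothesis f_ge0 : forall x, 0 <= f x.

Lemma sobolev_lipschitz : exists2 M : R, 0 < M & forall x y, `|f x - f y| <= M * `|x - y|.
Proof.
case: fW => _ _ fL.
near (+oo : set_system R) => M; exists M; first by near: M; exact: nbhs_pinfty_gt.
move=> y z; have h : (M.-lipschitz f) by near: M.
by apply: (h (y, z)).
Unshelve. all: by end_near. Qed.

Lemma sobolev_continuous : continuous f.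
Proof.
have [M M0 hM] := sobolev_lipschitz.
apply/continuous_rVP => x e e0; exists (e / M / 2); first by rewrite !divr_gt0.
move=> y xy; apply: (le_lt_trans (hM x y)).
apply: (@le_lt_trans _ _ (M * (e / M / 2))).
  rewrite ler_pM2l // /normr /= mx_normrE; apply/bigmax_leP; split.
    by rewrite ltW // !divr_gt0.
  by move=> [i j] _; rewrite !ord1 !mxE ltW //; exact: xy.
by rewrite mulrA mulrCA divff ?gt_eqF // mulr1; lra.
Qed.

(** Markov's inequality for an integrable function. *)
Lemma sobolev_superlevel_fin t : 0 < t -> (mu [set x | (t <= f x)%R] < +oo)%E.
Proof.
move=> t0; case: fW => -[/Lfun1_integrable /integrableP[mf intf] _ _] _ _.
have := le_integral_abse mu measurableT mf t0; rewrite setTI => h.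
have {h} : (t%:E * mu [set x | (t <= f x)%R] < +oo)%E.
  apply: le_lt_trans intf; apply: le_trans h; rewrite lee_pmul2l //.
  apply: le_measure; rewrite ?inE.
  - by apply: measurable_superlevel; exact: continuous_measurable_rV sobolev_continuous.
  - rewrite -[X in measurable X]setTI; apply: emeasurable_fun_c_infty => //.
    exact: measurableT_comp.
  - by move=> x /=; rewrite lee_fin => h; rewrite ger0_norm.
case: (mu _) => [r _| |//]; first exact: ltry.
by rewrite gt0_muley.
Qed.

(** An essential bound of a continuous function holds everywhere, because nonempty open sets have
    positive measure. *)
Lemma sobolev_bounded : exists M, forall x, f x <= M.
Proof.
case: (fW) => _ [fL _ _] _.
have fin : ('N[mu]_+oo[EFin \o f] < +oo)%E.
  by have := set_mem (sub_Lfun_finLfun fL).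
have muT : (0 < mu [set: 'rV[R]_n])%E by apply: open_lebesgue_gt0 => //; [exact: openT|exists 0].
(* The norm for the exponent [+oo] is the essential supremum only if the whole space has positive
   measure. *)
rewrite unlock muT in fin.
have [M hM] : exists M : R, (ess_sup mu (abse \o (EFin \o f)) <= M%:E)%E.
  move: fin; case: (ess_sup _ _) => [r _| //|_]; first by exists r.
  by exists 0; rewrite leNye.
exists M => x; rewrite leNgt; apply/negP => Mx.
have /ess_supP[N [mN N0 hN]] := hM.
pose U := f @^-1` `]M, +oo[%classic.
have oU : open U by have /continuousP := sobolev_continuous; apply; exact: interval_open.
have : (0 < mu U)%E by apply: open_lebesgue_gt0 => //; exists x; rewrite /U /= in_itv /= Mx.
rewrite ltNge -N0 => /negP; apply; apply: le_measure; rewrite ?inE //; first exact: open_measurable_rV.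
move=> y; rewrite /U /= in_itv /= andbT => My; apply: hN => /=.
by rewrite lee_fin => /(le_trans (ler_norm _)); rewrite leNgt My.
Qed.

End sobolev_facts.

End finite_differences.

(** * Smooth functions *)

Section lines.
Context {R : realType} {n : nat}.
Implicit Types (f g : 'rV[R]_n -> R) (x v : 'rV[R]_n).

(** In this form a derivative passes through affine changes of the argument by rewriting the point,
    without handling limits. *)
Lemma is_derive_lineP (V : normedModType R) (f : V -> R) (x v : V) (L : R) :
  is_derive x v f L <->
  forall e : R, 0 < e -> exists2 d : R, 0 < d &
    forall h : R, h != 0 -> `|h| < d -> `|f (h *: v + x) - f x - h * L| <= e * `|h|.
Proof.
have E h (r : R) : h != 0 -> `|L - h^-1 *: r| = `|r - h * L| / `|h|.
  move=> h0; rewrite -normf_div /GRing.scale /= distrC; congr normr.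
  by field.
split => [[df dv] e e0|H].
  have cv : h^-1 *: (f (h *: v + x) - f x) @[h --> 0^'] --> L.
    by rewrite -dv; exact: df.
  have /cvgrPdist_le/(_ e e0)[d /= d0 hd] := cv.
  exists d => // h h0 hlt; have := hd h; rewrite /= sub0r normrN => /(_ hlt h0).
  by rewrite E // ler_pdivrMr ?normr_gt0.
have cv : h^-1 *: (f (h *: v + x) - f x) @[h --> 0^'] --> L.
  apply/cvgrPdist_le => e e0; have [d d0 hd] := H e e0.
  exists d => // h /=; rewrite sub0r normrN => hlt h0.
  by rewrite E // ler_pdivrMr ?normr_gt0 // hd.
apply: DeriveDef; first by apply/cvg_ex; exists L.
exact/cvg_lim.
Qed.

Lemma is_derive_line (V : normedModType R) (f : V -> R) (x v : V) (s L : R) :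
  is_derive (s *: v + x) v f L -> is_derive s 1 (fun r => f (r *: v + x)) L.
Proof.
move=> /is_derive_lineP H; apply/is_derive_lineP => e e0.
have [d d0 hd] := H e e0; exists d => // h h0 hlt.
rewrite [h *: 1]mulr1 scalerDl -[_ + _ + x]addrA; exact: hd.
Qed.

(** By the mean value theorem. The symmetric range [|s| <= |a|] treats both signs of [a] at once. *)
Lemma mvt_deviation (psi dpsi : R -> R) (a L e : R) :
  (forall s : R, is_derive s (1 : R) psi (dpsi s)) ->
  (forall s : R, `|s| <= `|a| -> `|dpsi s - L| <= e) ->
  `|psi a - psi 0 - a * L| <= e * `|a|.
Proof.
move=> dp hL.
have cpsi : continuous psi.
  move=> s; apply/differentiable_continuous/derivable1_diffP.
  exact: (@ex_derive _ _ _ _ _ _ _ (dp s)).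
have [a0|a0|a0] := ltrgtP a 0; last first.
- by rewrite a0 subrr mul0r subr0 !normr0 mulr0.
- have [c] := MVT a0 (fun s _ => dp s) (continuous_subspaceT cpsi).
  rewrite in_itv /= => /andP[c0 ca] ->; rewrite subr0 mulrC -mulrBr normrM mulrC.
  by rewrite ler_wpM2r // hL // !gtr0_norm // ltW.
- have [c] := MVT a0 (fun s _ => dp s) (continuous_subspaceT cpsi).
  rewrite in_itv /= => /andP[ca c0]; rewrite sub0r => h.
  have -> : psi a - psi 0 = a * dpsi c by rewrite -opprB h; ring.
  rewrite -mulrBr normrM mulrC ler_wpM2r // hL // !ltr0_norm // lerN2 ltW //.
Qed.

Lemma is_Ck_continuous k f : is_Ck k f -> continuous f.
Proof. by case: k => [|k] // []. Qed.

Lemma is_CkW k f : is_Ck k.+1 f -> is_Ck k f.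
Proof.
elim: k f => [|k IH] f; first by case.
move=> [cf df]; split => // i; have [dfi ck] := df i; split => //.
exact: IH.
Qed.

Lemma is_Ck_cst k (c : R) : is_Ck k (fun _ : 'rV[R]_n => c).
Proof.
elim: k c => [|k IH] c; first exact: cst_continuous.
split => [|i]; first exact: cst_continuous.
split => [x|]; first exact: derivable_cst.
rewrite (_ : partial i _ = fun=> 0); first exact: IH.
by apply/funext => x; rewrite /partial derive_cst.
Qed.

Lemma is_CkD k f g : is_Ck k f -> is_Ck k g -> is_Ck k (fun x => f x + g x).
Proof.
have cD (u w : 'rV[R]_n -> R) : continuous u -> continuous w -> continuous (fun x => u x + w x).
  by move=> cu cw x; exact: (continuousD (cu x) (cw x)).
elim: k f g => [|k IH] f g; first exact: cD.
move=> [cf df] [cg dg]; split => [|i]; first exact: cD.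
have [dfi fk] := df i; have [dgi gk] := dg i; split => [x|].
  exact: derivableD.
rewrite (_ : partial i _ = fun x => partial i f x + partial i g x); first exact: IH.
by apply/funext => x; rewrite /partial -deriveD.
Qed.

Lemma is_CkM k f g : is_Ck k f -> is_Ck k g -> is_Ck k (fun x => f x * g x).
Proof.
have cM (u w : 'rV[R]_n -> R) : continuous u -> continuous w -> continuous (fun x => u x * w x).
  by move=> cu cw x; exact: (continuousM (cu x) (cw x)).
elim: k f g => [|k IH] f g; first exact: cM.
move=> fk1 gk1; have fk0 := is_CkW fk1; have gk0 := is_CkW gk1.
case: fk1 gk1 => cf df [cg dg]; split => [|i]; first exact: cM.
have [dfi fk] := df i; have [dgi gk] := dg i; split => [x|].
  exact: derivableM.
rewrite (_ : partial i _ = fun x => f x * partial i g x + g x * partial i f x).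
  by apply: is_CkD; exact: IH.
by apply/funext => x; rewrite /partial -deriveM.
Qed.

Lemma is_Ck_sum k (I : Type) (r : seq I) (F : I -> 'rV[R]_n -> R) :
  (forall i, is_Ck k (F i)) -> is_Ck k (fun x => \sum_(i <- r) F i x).
Proof.
move=> h; elim: r => [|i r IH].
  by under eq_fun do rewrite big_nil; exact: is_Ck_cst.
by under eq_fun do rewrite big_cons; exact: is_CkD.
Qed.

Lemma is_Ck_prod k (I : Type) (r : seq I) (F : I -> 'rV[R]_n -> R) :
  (forall i, is_Ck k (F i)) -> is_Ck k (fun x => \prod_(i <- r) F i x).
Proof.
move=> h; elim: r => [|i r IH].
  by under eq_fun do rewrite big_nil; exact: is_Ck_cst.
by under eq_fun do rewrite big_cons; exact: is_CkM.
Qed.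

Lemma is_CkX k f m : is_Ck k f -> is_Ck k (fun x => f x ^+ m).
Proof.
move=> h; elim: m => [|m IH].
  by under eq_fun do rewrite expr0; exact: is_Ck_cst.
by under eq_fun do rewrite exprS; exact: is_CkM.
Qed.

(** These are the vertices of the coordinate path from 0 to [v]. *)
Definition truncate_row (v : 'rV[R]_n) m : 'rV[R]_n := \row_i (if (i < m)%N then v 0 i else 0).

Lemma C1_is_derive f x v : is_Ck 1 f ->
  is_derive x v f (\sum_i v 0 i * partial i f x).
Proof.
move=> [_ df]; apply/is_derive_lineP.
(* The segment from x to x + h v is replaced by a path along the coordinate axes. *)
have tn : truncate_row v n = v by apply/rowP => i; rewrite mxE ltn_ord.
suff key m : (m <= n)%N -> forall e : R, 0 < e -> exists2 d : R, 0 < d &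
    forall h : R, h != 0 -> `|h| < d ->
    `|f (h *: truncate_row v m + x) - f x -
      h * \sum_(i < n | (i < m)%N) v 0 i * partial i f x| <= e * `|h|.
  move=> e e0; have [d d0 hd] := key n (leqnn n) e e0; exists d => // h h0 hlt.
  have := hd h h0 hlt; rewrite tn; congr (`|_ - h * _| <= _).
  by apply: eq_bigl => i; rewrite ltn_ord.
elim: m => [_ e e0|m IH mn e e0].
  exists 1 => // h h0 _; rewrite big_pred0 // mulr0 subr0.
  rewrite (_ : h *: _ + x = x) ?subrr ?normr0 ?mulr_ge0 ?(ltW e0) //.
  by apply/rowP => i; rewrite !mxE ltn0 mulr0 add0r.
pose j : 'I_n := Ordinal mn.
pose c := v 0 j.
have e2 : 0 < e / 2 by rewrite divr_gt0.
have [d1 d10 h1] := IH (ltnW mn) _ e2.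
have c1 : 0 < 1 + `|c| by rewrite ltr_pwDl.
(* Times [|h * c|] this tolerance is at most [e / 2 * |h|]; the summand 1 allows [c = 0]. *)
have ec : 0 < e / 2 / (1 + `|c|) by rewrite divr_gt0.
have cj : continuous (partial j f) by have [_] := df j.
have [d2 d20 h2] := (continuous_rVP (partial j f)).1 cj x _ ec.
(* [V] exceeds every coordinate of [v], so [|h| < d2 / V] keeps the whole path within [d2] of [x],
   coordinatewise. *)
pose V := 1 + \sum_i `|v 0 i|.
have V0 : 0 < V by rewrite ltr_pwDl // sumr_ge0.
have vV i : `|v 0 i| < V.
  rewrite /V (bigD1 i) //= addrCA ltrDl ltr_pwDl // sumr_ge0 //.
exists (Num.min d1 (d2 / V)); first by rewrite lt_min d10 divr_gt0.
move=> h hn0; rewrite lt_min => /andP[hd1 hd2].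
pose y := h *: truncate_row v m + x.
have tS : h *: truncate_row v m.+1 + x = (h * c) *: delta_mx 0 j + y.
  apply/rowP => i; rewrite !mxE eqxx /= ltnS leq_eqVlt addrA; congr (_ + _).
  have [im|im] /= := eqVneq (i : nat) m.
    have -> : i = j by apply/val_inj.
    by rewrite eqxx ltnn mulr1 mulr0 addr0.
  have -> : (i == j) = false by apply/negP => /eqP ij; move: im; rewrite ij /= eqxx.
  by rewrite mulr0 add0r.
have bigS : \sum_(i < n | (i < m.+1)%N) v 0 i * partial i f x =
   c * partial j f x + \sum_(i < n | (i < m)%N) v 0 i * partial i f x.
  rewrite (bigD1 j) //=; congr (_ + _); apply: eq_bigl => i.
  by rewrite ltnS ltn_neqAle andbC.
have dl (s : R) : is_derive s (1 : R) (fun r : R => f (r *: delta_mx 0 j + y))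
    (partial j f (s *: delta_mx 0 j + y)).
  by apply: is_derive_line; apply: derivableP; have [dfj _] := df j.
have := @mvt_deviation _ _ (h * c) (partial j f x) (e / 2 / (1 + `|c|)) dl.
rewrite scale0r add0r -tS => /(_ _)/wrap[].
  move=> s hs; rewrite distrC ltW //; apply: h2 => i.
  rewrite distrC /y !mxE eqxx /= addrA addrK.
  have hd2' : `|h| * V < d2 by rewrite -ltr_pdivlMr.
  have hvV k : `|h| * `|v 0 k| < d2.
    by apply: le_lt_trans hd2'; rewrite ler_pM2l ?normr_gt0 // ltW.
  have [->|ij] := eqVneq i j.
    by rewrite ltnn mulr0 mulr1 addr0; apply: le_lt_trans hs _; rewrite normrM; exact: hvV.
  rewrite mulr0 add0r; case: ifP => _; first by rewrite normrM; exact: hvV.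
  by rewrite mulr0 normr0.
move=> hm; have := h1 h hn0 hd1; rewrite -/y => hy.
rewrite bigS mulrDr [X in `|X|](_ : _ =
  (f (h *: truncate_row v m.+1 + x) - f y - h * c * partial j f x) +
  (f y - f x - h * (\sum_(i < n | (i < m)%N) v 0 i * partial i f x))); last by ring.
apply: (le_trans (ler_normD _ _)); rewrite [e in leRHS]splitr mulrDl lerD //.
apply: (le_trans hm); rewrite normrM mulrCA mulrC.
by rewrite ler_wpM2r // mulrAC ler_pdivrMr // ler_wpM2l ?(ltW e2) // lerDr.
Qed.

(** By the chain rule the partial derivatives of the composite are linear combinations of those of
    [f], composed with the same affine map, so induction on [k] applies. *)
Lemma is_Ck_affine k f (A : 'M[R]_n) (b : 'rV[R]_n) : is_Ck k f ->
  is_Ck k (fun x => f (x *m A + b)).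
Proof.
have cT (g : 'rV[R]_n -> R) : continuous g -> continuous (fun x => g (x *m A + b)).
  move=> cg; apply/continuous_rVP => x e e0.
  have [d d0 hd] := (continuous_rVP g).1 cg (x *m A + b) e e0.
  pose S := 1 + \sum_i \sum_j `|A i j|.
  have S0 : 0 < S by rewrite ltr_pwDl // sumr_ge0 // => i _; rewrite sumr_ge0.
  exists (d / S); first by rewrite divr_gt0.
  move=> y xy; apply: hd => j.
  rewrite !mxE opprD addrACA subrr addr0 -sumrB.
  apply: (le_lt_trans (ler_norm_sum _ _ _)).
  apply: (@le_lt_trans _ _ (\sum_i (d / S) * `|A i j|)).
    by apply: ler_sum => i _; rewrite -mulrBl normrM ler_wpM2r // ltW // xy.
  rewrite -mulr_sumr mulrAC ltr_pdivrMr // ltr_pM2l //.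
  rewrite /S ltr_pwDl // ler_sum // => i _.
  by rewrite (bigD1 j) //= lerDl sumr_ge0.
elim: k f => [|k IH] f; first exact: cT.
move=> fk1; have [cf df] := fk1.
have f1 : is_Ck 1 f.
  by split => // i; have [? /is_Ck_continuous] := df i.
have dT j x : is_derive x (delta_mx 0 j) (fun x => f (x *m A + b))
    (\sum_i A j i * partial i f (x *m A + b)).
  have := C1_is_derive (x *m A + b) (row j A) f1.
  under eq_bigr do rewrite mxE.
  move=> /is_derive_lineP H; apply/is_derive_lineP => e e0.
  have [d d0 hd] := H e e0; exists d => // h h0 hlt.
  rewrite mulmxDl -scalemxAl -rowE -[_ + _ + b]addrA; exact: hd.
split => [|j]; first exact: cT.
split => [x|]; first exact: (@ex_derive _ _ _ _ _ _ _ (dT j x)).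
rewrite (_ : partial j _ = fun x => \sum_i A j i * partial i f (x *m A + b)).
  apply: is_Ck_sum => i; apply: is_CkM; first exact: is_Ck_cst.
  by apply: IH; have [] := df i.
by apply/funext => x; exact: (@derive_val _ _ _ _ _ _ _ (dT j x)).
Qed.

End lines.

Section flat_function.
Context {R : realType}.

(* The functions [t^-k exp(-1/t)] extended by [0] to [t <= 0]: up to
   coefficients, this family is closed under derivation. *)
Definition flat (k : nat) (t : R) : R := if 0 < t then t^-1 ^+ k * expR (- t^-1) else 0.

Lemma flat_gt0 k t : 0 < t -> 0 < flat k t.
Proof. by move=> t0; rewrite /flat t0 mulr_gt0 ?expR_gt0 // exprn_gt0 // invr_gt0. Qed.

Lemma flat_le0 k t : t <= 0 -> flat k t = 0.
Proof. by rewrite /flat leNgt; case: ifP. Qed.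

Lemma flat_ge0 k t : 0 <= flat k t.
Proof. by have [t0|t0] := leP t 0; [rewrite flat_le0|rewrite ltW // flat_gt0]. Qed.

Lemma flat0_le1 t : flat 0 t <= 1.
Proof.
have [t0|t0] := leP t 0; first by rewrite flat_le0.
by rewrite /flat t0 expr0 mul1r -expR0 ler_expR oppr_le0 invr_ge0 ltW.
Qed.

Lemma flatS k t : flat k t = t * flat k.+1 t.
Proof.
rewrite /flat; case: ifPn => [t0|_]; last by rewrite mulr0.
by rewrite exprS !mulrA divff ?mul1r // gt_eqF.
Qed.

(** With [y = 1 / t] the claim is [y ^+ k.+1 <= k.+1%:R ^+ k.+1 * expR y], the power [k.+1] of
    [z <= expR z] at [z = y / k.+1%:R]. *)
Lemma flat_le_linear k t : 0 <= t -> flat k t <= k.+1%:R ^+ k.+1 * t.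
Proof.
rewrite le_eqVlt => /predU1P[<-|t0]; first by rewrite flat_le0 // mulr0.
rewrite /flat t0; set y := t^-1; have y0 : 0 < y by rewrite invr_gt0.
have ty : t = y^-1 by rewrite invrK.
rewrite ty ler_pdivlMr // mulrAC -exprSr expRN ler_pdivrMr ?expR_gt0 //.
have k0 : 0 < k.+1%:R :> R by rewrite ltr0n.
have {1}-> : y = k.+1%:R * (y / k.+1%:R) by rewrite mulrC divfK // gt_eqF.
rewrite exprMn ler_wpM2l ?exprn_ge0 ?(ltW k0) //.
have {2}-> : y = k.+1%:R * (y / k.+1%:R) by rewrite mulrC divfK // gt_eqF.
rewrite expRM_natl lerXn2r ?nnegrE ?expR_ge0 // ?divr_ge0 ?(ltW y0) ?(ltW k0) //.
by apply: le_trans (expR_ge1Dx _); rewrite lerDr.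
Qed.

Lemma is_derive_flat k (t : R) :
  is_derive t (1 : R) (flat k) (flat k.+2 t - k%:R * flat k.+1 t).
Proof.
apply/is_derive_lineP => e e0.
have [t0|t0|<-] := ltgtP 0 t.
- have t_neq0 : t != 0 by rewrite gt_eqF.
  have D : is_derive t (1 : R) (fun s : R => s^-1 ^+ k * expR (- s^-1))
      (t^-1 ^+ k.+2 * expR (- t^-1) - k%:R * (t^-1 ^+ k.+1 * expR (- t^-1))).
    have dinv : is_derive t (1 : R) (fun s : R => s^-1) (- t ^- 2).
      have did := is_derive_id t (1 : R).
      have dd : derivable (@id R) t 1 by exact: ex_derive.
      apply: DeriveDef; first exact: (derivableV (f := @id R)).
      by rewrite (deriveV (f := @id R)) // derive_val /GRing.scale /= mulr1.
    have dinvk : is_derive t (1 : R) (fun s : R => s^-1 ^+ k) (k%:R * t^-1 ^+ k.-1 * (- t ^- 2)).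
      have := @is_deriveX R R^o (fun s : R => s^-1) k t 1 _ dinv.
      rewrite (_ : (fun s : R => s^-1) ^+ k = (fun s : R => s^-1 ^+ k)) //.
      by apply/funext => s; rewrite exprfctE.
    have dexp : is_derive t (1 : R) (fun s : R => expR (- s^-1)) (expR (- t^-1) * t ^- 2).
      apply: (@is_derive1_comp _ expR (fun s : R => - s^-1)).
      rewrite -[t ^- 2]opprK; exact: is_deriveN.
    have := is_deriveM dinvk dexp.
    congr is_derive; rewrite /GRing.scale /=.
    case: k {dinvk} => [|k]; first by rewrite !expr0 !mul0r; field.
    by rewrite /= !exprS; field.
  have [d d0 hd] := (is_derive_lineP _ _ _ _).1 D e e0.
  exists (Num.min d t); first by rewrite lt_min d0.
  move=> h h0; rewrite lt_min => /andP[hd1 ht].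
  have ht0 : 0 < h * 1 + t by move: ht; rewrite mulr1 ltr_norml; lra.
  by have := hd h h0 hd1; rewrite /flat t0 /GRing.scale /= ht0.
- exists (- t); first by rewrite oppr_gt0.
  move=> h h0 ht; rewrite !flat_le0 ?(ltW t0) //.
    by rewrite mulr0 subrr mulr0 subrr normr0 mulr_ge0 // ltW.
  by rewrite [h *: 1]mulr1; move: ht; rewrite ltr_norml; lra.
(* At 0 the identity [flat k h = h * flat k.+1 h] and the linear bound for [flat k.+1] give an
   increment of at most [C * h ^+ 2]. *)
- pose C : R := k.+2%:R ^+ k.+2.
  have C0 : 0 < C by rewrite exprn_gt0.
  exists (e / C); first exact: divr_gt0.
  move=> h h0 hlt; rewrite !(flat_le0 _ (lexx 0)) mulr0 subrr mulr0 !subr0 addr0 [h *: 1]mulr1.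
  have [h_le0|h_gt0] := leP h 0; first by rewrite flat_le0 // normr0 mulr_ge0 // ltW.
  rewrite gtr0_norm ?flat_gt0 // gtr0_norm // flatS mulrC ler_wpM2r ?(ltW h_gt0) //.
  apply: (le_trans (flat_le_linear _ (ltW h_gt0))); rewrite -/C mulrC -ler_pdivlMr // ltW //.
  by rewrite -[ltLHS]gtr0_norm.
Qed.

End flat_function.

(** * Smooth functions of compact support *)

Section test_functions.
Context {R : realType} {n : nat}.
Implicit Types (f g : 'rV[R]_n -> R) (x v : 'rV[R]_n).

Definition smooth f := forall k, is_Ck k f.

Lemma smooth_flat (a b : R) (i : 'I_n) k : smooth (fun x => flat k (a * x 0 i + b)).
Proof.
have D l x v : is_derive x v (fun x => flat l (a * x 0 i + b))
    (a * v 0 i * (flat l.+2 (a * x 0 i + b) - l%:R * flat l.+1 (a * x 0 i + b))).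
  apply/is_derive_lineP => e e0.
  set c := a * v 0 i; set t := a * x 0 i + b.
  have c1 : 0 < 1 + `|c| by rewrite ltr_pwDl.
  have [d d0 hd] := (is_derive_lineP _ _ _ _).1 (is_derive_flat l t) (e / (1 + `|c|)) (divr_gt0 e0 c1).
  exists (d / (1 + `|c|)); first exact: divr_gt0.
  move=> h h0 hlt.
  have -> : a * (h *: v + x) 0 i + b = h * c + t by rewrite !mxE /c /t; ring.
  have [c0|c0] := eqVneq c 0.
    by rewrite c0 mulr0 add0r mul0r mulr0 subrr subr0 normr0 mulr_ge0 // ltW.
  have hc : `|h * c| < d.
    rewrite normrM; apply: (@le_lt_trans _ _ (`|h| * (1 + `|c|))).
      by rewrite ler_wpM2l // lerDr.
    by rewrite -ltr_pdivlMr.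
  have := hd (h * c) (mulf_neq0 h0 c0) hc.
  rewrite [_ *: 1]mulr1 => hh; rewrite [h * (c * _)]mulrA; apply: (le_trans hh).
  have aux (E C H : R) : 0 <= E -> 0 <= C -> 0 <= H -> E / (1 + C) * (H * C) <= E * H.
    move=> E0 C0 H0; have C1 : 0 < 1 + C by rewrite ltr_pwDl.
    rewrite (_ : _ / _ * _ = E * H * (C / (1 + C))); last by ring.
    by rewrite ler_piMr ?mulr_ge0 // ler_pdivrMr // mul1r lerDr.
  by rewrite (normrM h c); apply: aux => //; exact: ltW.
have cf l : continuous (fun x : 'rV[R]_n => flat l (a * x 0 i + b)).
  have cl : continuous (flat l : R -> R).
    move=> s; apply/differentiable_continuous/derivable1_diffP.
    exact: (@ex_derive _ _ _ _ _ _ _ (is_derive_flat l s)).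
  apply/continuous_rVP => x e e0.
  have /cvgrPdist_lt/(_ e e0)[d /= d0 hd] := cl (a * x 0 i + b).
  have a1 : 0 < 1 + `|a| by rewrite ltr_pwDl.
  exists (d / (1 + `|a|)); first exact: divr_gt0.
  move=> y xy; apply: hd => /=.
  rewrite opprD addrACA subrr addr0 -mulrBr normrM.
  apply: (@le_lt_trans _ _ ((1 + `|a|) * `|x 0 i - y 0 i|)).
    by rewrite ler_wpM2r // lerDr.
  by rewrite mulrC -ltr_pdivlMr.
move=> m; elim: m k => [|m IH] k; first exact: cf.
split => [|j]; first exact: cf.
split => [x|]; first exact: (@ex_derive _ _ _ _ _ _ _ (D k x (delta_mx 0 j))).
rewrite (_ : partial j _ = fun x => a * (delta_mx 0 j : 'rV[R]_n) 0 i *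
   (flat k.+2 (a * x 0 i + b) + - k%:R * flat k.+1 (a * x 0 i + b))).
  apply: is_CkM; first exact: is_Ck_cst.
  by apply: is_CkD; [|apply: is_CkM; first exact: is_Ck_cst]; exact: IH.
apply/funext => x; rewrite mulNr.
exact: (@derive_val _ _ _ _ _ _ _ (D k x (delta_mx 0 j))).
Qed.

Lemma compact_closureP (S : set 'rV[R]_n) :
  compact (closure S) <-> exists M : R, forall x, S x -> forall i, `|x 0 i| <= M.
Proof.
split => [/compact_bounded[M [_ hM]]|[M hM]].
  exists (M + 1) => x Sx i; apply: le_trans (hM (M + 1) _ x (@subset_closure _ S x Sx)).
    rewrite /normr /= mx_normrE; exact: (le_bigmax _ (fun j => `|x j.1 j.2|) (0, i)).
  by rewrite ltrDl.
apply: bounded_closed_compact; last exact: closed_closure.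
pose B := [set x : 'rV[R]_n | forall i, `|x 0 i| <= M].
have cB : closed B.
  have -> : B = \bigcap_(i in [set: 'I_n]) ((fun x : 'rV[R]_n => `|x 0 i|) @^-1` [set r | r <= M]).
    by apply/seteqP; split => [x h i _|x h i]; [exact: h|exact: h].
  apply: closed_bigI => i _; apply: closed_comp; last exact: closed_le.
  move=> x _; have cc : continuous (fun x : 'rV[R]_n => `|x 0 i|).
    apply/continuous_rVP => y e e0; exists e => // z yz.
    exact: le_lt_trans (ler_dist_dist _ _) (yz i).
  exact: cc.
exists `|M|; split => // N MN x /(_ _)Sx.
have Bx : B x by apply: cB; apply: closure_subset Sx => y; exact: hM.
rewrite /normr /= mx_normrE; apply/bigmax_leP; split.
  by rewrite ltW // (le_lt_trans _ MN).
move=> [i j] _ /=; rewrite ord1; apply: (le_trans (Bx j)).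
by rewrite (le_trans (ler_norm _)) // ltW.
Qed.

Lemma test_functionP f : test_function f <-> smooth f /\
  exists M : R, forall x, f x != 0 -> forall i, `|x 0 i| <= M.
Proof. by split => -[sf h]; split => //; exact/compact_closureP. Qed.

(** A bump that is positive exactly inside the open box. The factors 1 and -1 are kept so that each
    side of the box is literally an instance of [smooth_flat]. *)
Definition box_bump (a b : 'rV[R]_n) x : R :=
  \prod_i (flat 0 (1 * x 0 i + (- a 0 i)) * flat 0 (-1 * x 0 i + b 0 i)).

Lemma box_bump_ge0 a b x : 0 <= box_bump a b x.
Proof. by apply: prodr_ge0 => i _; rewrite mulr_ge0 // flat_ge0. Qed.

Lemma box_bump_gt0 (a b x : 'rV[R]_n) : (forall i, a 0 i < x 0 i < b 0 i) -> 0 < box_bump a b x.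
Proof.
move=> h; apply: prodr_gt0 => i _; have /andP[h1 h2] := h i.
by rewrite mulr_gt0 // flat_gt0 // ?mul1r ?mulN1r ?subr_gt0 // addrC subr_gt0.
Qed.

Lemma box_bump_neq0 a b x : box_bump a b x != 0 -> forall i, a 0 i < x 0 i < b 0 i.
Proof.
move=> /prodf_neq0 h i; have := h i isT; rewrite mulf_eq0 negb_or => /andP[h1 h2].
apply/andP; split; rewrite ltNge; apply/negP => xi.
  by move: h1; rewrite flat_le0 ?eqxx // mul1r subr_le0.
by move: h2; rewrite flat_le0 ?eqxx // mulN1r addrC subr_le0.
Qed.

Lemma box_bump_test a b : test_function (box_bump a b).
Proof.
apply/test_functionP; split => [k|].
  by apply: is_Ck_prod => i; apply: is_CkM; exact: smooth_flat.
exists (\sum_i (`|a 0 i| + `|b 0 i|)) => x /box_bump_neq0 h i.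
apply: (@le_trans _ _ (`|a 0 i| + `|b 0 i|)); last first.
  by rewrite (bigD1 i) //= lerDl sumr_ge0 // => j _; rewrite addr_ge0.
have /andP[h1 h2] := h i; rewrite ler_norml; apply/andP; split.
  by have := ler_norm (- a 0 i); rewrite normrN; have := normr_ge0 (b 0 i); lra.
by have := ler_norm (b 0 i); have := normr_ge0 (a 0 i); lra.
Qed.

Lemma test_function_mul f g : smooth f -> test_function g -> test_function (fun x => f x * g x).
Proof.
move=> sf /test_functionP[sg [M hM]]; apply/test_functionP; split.
  by move=> k; exact: is_CkM.
by exists M => x; rewrite mulf_eq0 negb_or => /andP[_ /hM].
Qed.

Lemma test_function_affine f (A B : 'M[R]_n) (b : 'rV[R]_n) : A *m B = 1%:M ->
  test_function f -> test_function (fun x => f (x *m A + b)).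
Proof.
move=> AB /test_functionP[sf [M hM]]; apply/test_functionP; split.
  by move=> k; exact: is_Ck_affine.
exists (\sum_j \sum_i (M + `|b 0 i|) * `|B i j|) => x /hM h j.
have xE : x = (x *m A + b - b) *m B by rewrite addrK -mulmxA AB mulmx1.
have M0 : 0 <= M := le_trans (normr_ge0 _) (h j).
apply: (@le_trans _ _ (\sum_i (M + `|b 0 i|) * `|B i j|)); last first.
  rewrite [leRHS](bigD1 j) //= lerDl sumr_ge0 // => k _; rewrite sumr_ge0 // => i _.
  by rewrite mulr_ge0 // addr_ge0.
rewrite xE mxE; apply: (le_trans (ler_norm_sum _ _ _)); apply: ler_sum => i _.
rewrite normrM ler_wpM2r // mxE; apply: (le_trans (ler_normD _ _)).
by rewrite lerD // mxE normrN.
Qed.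

End test_functions.

(** * Weak gradients *)

Section fundamental_lemma.
Context {R : realType} {n : nat}.
Local Notation mu := (@lebesgue_rV R n).
Implicit Types (f g F : 'rV[R]_n -> R) (x v : 'rV[R]_n).

Lemma test_function_continuous f : test_function f -> continuous f.
Proof. by move=> [sf _]; exact: is_Ck_continuous (sf 0). Qed.

Lemma smooth_continuous f : smooth f -> continuous f.
Proof. by move=> sf; exact: is_Ck_continuous (sf 0). Qed.

Lemma smooth_partial f i : smooth f -> smooth (partial i f).
Proof. by move=> sf k; have [_ /(_ i)[]] := sf k.+1. Qed.

Lemma test_function_bounded f : test_function f -> exists2 C, 0 <= C & forall x, `|f x| <= C.
Proof.
move=> tf; have cf := test_function_continuous tf; case: tf => _ cK.
have := @continuous_compact _ _ f _ (continuous_subspaceT cf) cK.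
move=> /compact_bounded[M [_ hM]]; exists `|M + 1|; first exact: normr_ge0.
move=> x; have [fx0|fx0] := eqVneq (f x) 0; first by rewrite fx0 normr0.
apply: le_trans (ler_norm _); apply: (hM (M + 1)); first by rewrite ltrDl.
by exists x => //; exact: subset_closure.
Qed.

Lemma test_function_partial f i : test_function f -> test_function (partial i f).
Proof.
move=> /test_functionP[sf [M hM]]; apply/test_functionP; split; first exact: smooth_partial.
exists M => x px j; rewrite leNgt; apply/negP => Mx; move/eqP: px; apply.
have e0 : 0 < `|x 0 j| - M by rewrite subr_gt0.
suff D : is_derive x (delta_mx 0 i) f 0 by exact: derive_val.
apply/is_derive_lineP => e e0'; exists (`|x 0 j| - M) => // h h0 hlt.
have f0 (y : 'rV[R]_n) : `|x 0 j - y 0 j| < `|x 0 j| - M -> f y = 0.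
  move=> xy; apply/eqP; apply: contraTT xy => /hM/(_ j) yM; rewrite -leNgt.
  by have := lerB_dist (x 0 j) (y 0 j); lra.
rewrite (f0 x) ?subrr ?normr0 // f0 ?mulr0 ?subr0 ?normr0 ?mulr_ge0 ?(ltW e0') //.
rewrite distrC !mxE addrK; apply: le_lt_trans hlt.
by rewrite eqxx /=; case: (_ == _); rewrite ?mulr1 // mulr0 normr0.
Qed.

Lemma bounded_of_le (f : 'rV[R]_n -> R) (A : set 'rV[R]_n) (C : R) :
  (forall x, A x -> `|f x| <= C) -> [bounded f x | x in A].
Proof.
move=> h; exists C; split; first exact: num_real.
by move=> N CN x Ax; exact: le_trans (h x Ax) (ltW CN).
Qed.

Lemma compact_measurable_rV (K : set 'rV[R]_n) : compact K -> measurable K.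
Proof.
move=> cK; by apply: closed_measurable_rV; apply: compact_closed.
Qed.

Lemma compact_coor_bounded (K : set 'rV[R]_n) : compact K ->
  exists M : R, forall x, K x -> forall i, `|x 0 i| <= M.
Proof.
move=> cK; apply/compact_closureP; rewrite (_ : closure K = K) //.
by apply/esym/closure_id; apply: compact_closed.
Qed.

Lemma integrable_mul_test F f : locally_integrable_rV F -> test_function f ->
  mu.-integrable setT (EFin \o (fun x => F x * f x)).
Proof.
move=> iF tf; have [C C0 hC] := test_function_bounded tf.
have cf := test_function_continuous tf; case: (tf) => _ cK.
set K := closure _ in cK; have mK := compact_measurable_rV cK.
have : mu.-integrable K (EFin \o (fun x => F x * f x)).
  apply: (integrableMl mK (f := EFin \o F) (h := f)); first exact: iF.
  - by apply: measurable_funTS; exact: continuous_measurable_rV.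
  - by apply: bounded_of_le => x _; exact: hC.
move/(integrable_mkcond _ mK); congr integrable; apply/funext => x /=.
rewrite patchE; case: ifPn => // /negP xK; congr EFin.
have [->|fx0] := eqVneq (f x) 0; first by rewrite mulr0.
by exfalso; apply: xK; rewrite inE; exact: subset_closure.
Qed.

Lemma smooth_measurable f : smooth f -> measurable_fun setT f.
Proof. by move=> /smooth_continuous; exact: continuous_measurable_rV. Qed.

Section approximation.
Variable w : 'rV[R]_n -> R.
Hypothesis w0 : forall x, 0 <= w x.
Hypothesis iw : mu.-integrable setT (EFin \o w).

Let mw : measurable_fun setT w.
Proof. by apply/measurable_EFinP; exact: measurable_int iw. Qed.

Let dist f g := (\int[mu]_x (`|f x - g x| * w x)%:E)%E.

Definition unit_valued f := measurable_fun setT f /\ forall x, 0 <= f x <= 1.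

(* The sets whose indicator is a limit of smooth functions in L^1(w) form a
   sigma-algebra containing the half-spaces. *)
Definition smooth_approx f := forall e : R, 0 < e -> exists g,
  [/\ smooth g, forall x, 0 <= g x <= 1 & (dist f g <= e%:E)%E].

Let mdist f g : measurable_fun setT f -> measurable_fun setT g ->
  measurable_fun setT (fun x => (`|f x - g x| * w x)%:E).
Proof.
move=> mf mg; apply/measurable_EFinP; apply: measurable_funM => //.
by apply: measurableT_comp => //; exact: measurable_funB.
Qed.

Lemma smooth_approx_smooth f : smooth f -> (forall x, 0 <= f x <= 1) -> smooth_approx f.
Proof.
move=> sf f01 e e0; exists f; split => //; rewrite /dist integral0_eq ?lee_fin ?ltW // => x _.
by rewrite subrr normr0 mul0r.
Qed.

Lemma smooth_approxC f : smooth_approx f -> smooth_approx (fun x => 1 - f x).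
Proof.
move=> af e e0; have [g [sg g01 hg]] := af e e0; exists (fun x => 1 + -1 * g x); split.
- by move=> k; apply: is_CkD; [exact: is_Ck_cst|apply: is_CkM; [exact: is_Ck_cst|exact: sg]].
- by move=> x; rewrite mulN1r; have /andP[h1 h2] := g01 x; apply/andP; split; lra.
- suff -> : dist (fun x => 1 - f x) (fun x => 1 + -1 * g x) = dist f g by [].
  apply: eq_integral => x _.
  by rewrite mulN1r opprD opprK addrACA subrr add0r addrC distrC.
Qed.

(** Values in the unit interval let the errors of the two factors simply add. *)
Lemma smooth_approxM f g : unit_valued f -> unit_valued g ->
  smooth_approx f -> smooth_approx g -> smooth_approx (fun x => f x * g x).
Proof.
move=> [mf f01] [mg g01] af ag e e0.
have e2 : 0 < e / 2 by rewrite divr_gt0.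
have [f' [sf f'01 hf]] := af _ e2; have [g' [sg g'01 hg]] := ag _ e2.
have mf' := smooth_measurable sf; have mg' := smooth_measurable sg.
exists (fun x => f' x * g' x); split.
- by move=> k; apply: is_CkM; [exact: sf|exact: sg].
- move=> x; have /andP[h1 h2] := f'01 x; have /andP[h3 h4] := g'01 x.
  by rewrite mulr_ge0 // mulr_ile1.
apply: (@le_trans _ _ (dist f f' + dist g g')%E); last first.
  by rewrite [e]splitr EFinD leeD.
rewrite /dist -ge0_integralD //; try exact: mdist; last 2 first.
- by move=> x _; rewrite lee_fin mulr_ge0.
- by move=> x _; rewrite lee_fin mulr_ge0.
apply: ge0_le_integral => //.
- by move=> x _; rewrite lee_fin mulr_ge0.
- by apply: mdist; exact: measurable_funM.
- by apply: emeasurable_funD; exact: mdist.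
- move=> x _; rewrite -EFinD lee_fin -mulrDl ler_wpM2r //.
  have -> : f x * g x - f' x * g' x = (f x - f' x) * g x + f' x * (g x - g' x) by ring.
  apply: (le_trans (ler_normD _ _)); rewrite !normrM lerD //.
    by rewrite ler_piMr // ger0_norm; have /andP[] := g01 x.
  by rewrite ler_piMl // ger0_norm; have /andP[] := f'01 x.
Qed.

Lemma smooth_approx_lim (f_ : nat -> 'rV[R]_n -> R) f :
  (forall k, unit_valued (f_ k)) -> unit_valued f ->
  (forall x, f_ ^~ x @ \oo --> f x) -> (forall k, smooth_approx (f_ k)) -> smooth_approx f.
Proof.
move=> uf_ [mf f01] f_f af e e0.
have e2 : 0 < e / 2 by rewrite divr_gt0.
have mf_ k : measurable_fun setT (f_ k) by have [] := uf_ k.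
have mM (u : 'rV[R]_n -> R) : measurable_fun setT u -> measurable_fun setT (fun x => (u x * w x)%:E).
  by move=> mu'; apply/measurable_EFinP; exact: measurable_funM.
have [] := @dominated_convergence _ _ _ mu setT measurableT
  (fun k x => (f_ k x * w x)%:E) (fun x => (f x * w x)%:E) (EFin \o w)
  (fun k => mM _ (mf_ k)) (mM _ mf) _ iw _.
- apply: aeW => x _; apply: cvg_EFin; first exact: nearW.
  by apply: cvgM; [exact: f_f|exact: cvg_cst].
- apply: aeW => x k _; rewrite lee_fin normrM (ger0_norm (w0 x)) ler_piMl //.
  by have [_ /(_ x)/andP[h1 h2]] := uf_ k; rewrite ger0_norm.
move=> _ cv _.
have [k hk] : exists k, (dist f (f_ k) <= (e / 2)%:E)%E.
  apply: contrapT => /forallNP h.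
  have : ((e / 2)%:E <= 0 :> \bar R)%E.
    rewrite -(cvg_lim _ cv) //; apply: lime_ge; first exact: cvgP cv.
    apply: nearW => k; have /negP := h k; rewrite -ltNge => /ltW.
    congr (_ <= _)%E; apply: eq_integral => x _.
    by rewrite -EFinB -mulrBl /= normrM (ger0_norm (w0 x)) distrC.
  by rewrite lee_fin leNgt e2.
have [g [sg g01 hg]] := af k _ e2; exists g; split => //.
have mg := smooth_measurable sg.
apply: (@le_trans _ _ (dist f (f_ k) + dist (f_ k) g)%E); last first.
  by rewrite [e]splitr EFinD leeD.
rewrite /dist -ge0_integralD //; try exact: mdist; last 2 first.
- by move=> x _; rewrite lee_fin mulr_ge0.
- by move=> x _; rewrite lee_fin mulr_ge0.
apply: ge0_le_integral => //.
- by move=> x _; rewrite lee_fin mulr_ge0.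
- exact: mdist.
- by apply: emeasurable_funD; exact: mdist.
- by move=> x _; rewrite -EFinD lee_fin -mulrDl ler_wpM2r // ler_distD.
Qed.

Lemma unit_valued_indic (A : set 'rV[R]_n) : measurable A -> unit_valued \1_A.
Proof.
by move=> mA; split => // x; rewrite indicE; case: (_ \in _); rewrite /= ?lexx ler01.
Qed.

Lemma cvg_1_sub_exp (a : R) : 0 <= a <= 1 ->
  (fun k => 1 - (1 - a) ^+ k) @ \oo --> (if 0 < a then 1 else 0 : R).
Proof.
move=> /andP[a0 a1]; case: ifPn => [a_gt0|]; last first.
  rewrite -leNgt => a_le0; have -> : a = 0 by apply/le_anti; rewrite a0 a_le0.
  by under eq_fun do rewrite subr0 expr1n subrr; exact: cvg_cst.
rewrite -[X in _ --> X]subr0; apply: cvgB; first exact: cvg_cst.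
by apply: cvg_expr; rewrite ger0_norm ?subr_ge0 // ltrBlDr ltrDl.
Qed.

(** A smooth [u] with values in [[0, 1]] that is positive exactly on the half-space is sharpened to
    [1 - (1 - u) ^+ k], which tends to the indicator. *)
Lemma smooth_approx_halfspace (i : 'I_n) (c : R) :
  smooth_approx \1_[set x : 'rV[R]_n | c < x 0 i].
Proof.
pose u x : R := flat 0 (1 * x 0 i + - c).
have su : smooth u by exact: smooth_flat.
have u01 x : 0 <= u x <= 1 by rewrite flat_ge0 flat0_le1.
pose f_ k x := 1 - (1 - u x) ^+ k.
have f_E k : f_ k = fun x => 1 + -1 * (1 + -1 * u x) ^+ k.
  by apply/funext => x; rewrite /f_ !mulN1r.
have sf k : smooth (f_ k).
  rewrite f_E => m; apply: is_CkD; first exact: is_Ck_cst.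
  apply: is_CkM; first exact: is_Ck_cst.
  apply: is_CkX; apply: is_CkD; first exact: is_Ck_cst.
  by apply: is_CkM; [exact: is_Ck_cst|exact: su].
have f01 k x : 0 <= f_ k x <= 1.
  have /andP[h1 h2] := u01 x; rewrite /f_ subr_ge0 lerBlDr lerDl.
  by rewrite exprn_ile1 ?subr_ge0 ?exprn_ge0 ?subr_ge0 // lerBlDr lerDl.
have mH : measurable [set x : 'rV[R]_n | c < x 0 i].
  rewrite (_ : [set _ | _] = (fun x => x 0 i) @^-1` `]c, +oo[%classic).
    by apply: preimage_measurable => //; exact: measurable_coor.
  by apply/seteqP; split => x /=; rewrite in_itv /= andbT.
apply: (@smooth_approx_lim f_).
- by move=> k; split; [exact: smooth_measurable|exact: f01].
- exact: unit_valued_indic.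
- move=> x; have := cvg_1_sub_exp (u01 x).
  rewrite indicE (_ : (x \in _) = (0 < u x)); first by case: ifP.
  apply/idP/idP; rewrite inE /= => h; first by rewrite flat_gt0 // mul1r subr_gt0.
  rewrite ltNge; apply/negP => xc; move: h.
  by rewrite /u flat_le0 ?ltxx // mul1r subr_le0.
- by move=> k; exact: smooth_approx_smooth.
Qed.

Lemma smooth_approx_measurable (A : set 'rV[R]_n) : measurable A -> smooth_approx \1_A.
Proof.
pose D : set (set 'rV[R]_n) := [set A | measurable A /\ smooth_approx \1_A].
have indC (B : set 'rV[R]_n) : \1_(~` B) = (fun x => 1 - \1_B x) :> (_ -> R).
  apply/funext => x; rewrite !indicE in_setC.
  by case: (_ \in _) => /=; rewrite ?subrr ?subr0.
have DC B : D B -> D (~` B).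
  by move=> [mB aB]; split; [exact: measurableC|rewrite indC; exact: smooth_approxC].
have D0 : D set0.
  split => //; rewrite indic0; apply: smooth_approx_smooth => [k|x]; first exact: is_Ck_cst.
  by rewrite lexx ler01.
have DI B C : D B -> D C -> D (B `&` C).
  move=> [mB aB] [mC aC]; split; first exact: measurableI.
  rewrite (_ : \1_(B `&` C) = fun x => \1_B x * \1_C x :> R); last first.
    by apply/funext => x; rewrite indicI.
  by apply: smooth_approxM => //; exact: unit_valued_indic.
(* At each point the indicators of the finite intersections are eventually constant, so the limit
   lemma applies. *)
have Dcap (B : (set 'rV[R]_n)^nat) : (forall k, D (B k)) -> D (\bigcap_k B k).
  move=> DB; have DBm m : D (\bigcap_(k < m) B k).
    elim: m => [|m IH].
      rewrite (_ : \bigcap_(k < 0) B k = ~` set0); first exact: DC.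
      by rewrite setC0; apply/seteqP; split.
    rewrite (_ : \bigcap_(k < m.+1) B k = (\bigcap_(k < m) B k) `&` B m); first exact: DI.
    apply/seteqP; split => [x h|x [h1 h2] k /=].
      by split => [k km|]; apply: h => //=; exact: ltnW.
    by rewrite ltnS leq_eqVlt => /predU1P[->//|]; exact: h1.
  have mB : measurable (\bigcap_k B k) by apply: bigcapT_measurable => k; have [] := DB k.
  split => //; apply: (@smooth_approx_lim (fun m => \1_(\bigcap_(k < m) B k))).
  - by move=> k; apply: unit_valued_indic; have [] := DBm k.
  - exact: unit_valued_indic.
  - move=> x; have [Bx|] := pselect ((\bigcap_k B k) x).
      rewrite (_ : (fun m => _) = fun=> 1) ?indicE ?mem_set //; first exact: cvg_cst.
      by apply/funext => m; rewrite indicE mem_set // => k _; exact: Bx.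
    move=> nBx; have [k nBk] : exists k, ~ B k x by apply/existsNP => h; apply: nBx => k _.
    apply: cvg_near_cst; exists k.+1 => // m /= km.
    by rewrite !indicE !memNset // => /(_ k); auto.
  - by move=> m; have [] := DBm m.
have DU (B : (set 'rV[R]_n)^nat) : (forall k, D (B k)) -> D (\bigcup_k B k).
  move=> DB; rewrite -[X in D X]setCK setC_bigcup; apply: (DC); apply: Dcap => k; exact: (DC).
move=> mA; suff : D A by case.
apply: (smallest_sub _ _ mA).
  by split => //= B DB; rewrite setTD; exact: DC.
(* A generator is the preimage of a Borel set of the line under a coordinate; a second generation
   argument, on the line, reduces that set to open rays. *)
rewrite -bigcup_seq /= => B [i _] [C mC <-]; rewrite setTI.
suff : [set C' | D ((fun x => x 0 i) @^-1` C')] C by [].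
rewrite RGenOInfty.measurableE in mC.
apply: (smallest_sub _ _ mC).
  split => /=.
  - by rewrite preimage_set0.
  - by move=> B' DB'; rewrite setTD preimage_setC; exact: DC.
  - by move=> F' DF'; rewrite preimage_bigcup; exact: DU.
move=> _ [c ->] /=.
have E : [set x : 'rV[R]_n | c < x 0 i] = (fun x : 'rV[R]_n => x 0 i) @^-1` `]c, +oo[%classic.
  by apply/seteqP; split => x /=; rewrite in_itv /= andbT.
suff : D [set x : 'rV[R]_n | c < x 0 i] by rewrite E.
split; last exact: smooth_approx_halfspace.
by rewrite E; apply: preimage_measurable => //; exact: measurable_coor.
Qed.

End approximation.

(** The signed fundamental lemma of the calculus of variations. For a cutoff [chi], the indicator of
    [{F < 0}] is approximated by a smooth [g] in [L^1] with weight [|F| * chi]. As [g * chi] is an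
    admissible test function, the integral of [F * chi] over [{F < 0}] is at least [- e] for every
    [e > 0]; its integrand being nonpositive, it vanishes almost everywhere. *)
Lemma ae_ge0_test F : measurable_fun setT F -> locally_integrable_rV F ->
  (forall f, test_function f -> (forall x, 0 <= f x) -> 0 <= \int[mu]_x (F x * f x)) ->
  {ae mu, forall x, 0 <= F x}.
Proof.
move=> mF iF H.
pose N := [set x | F x < 0].
have mN : measurable N.
  rewrite (_ : N = F @^-1` `]-oo, 0[%classic); first exact: preimage_measurable.
  by apply/seteqP; split => x /=; rewrite in_itv.
have key (k : nat) : mu (N `&` cube n (- k%:R) k%:R) = 0.
  (* The cutoff is positive on the whole open cube, so dividing it out loses no point there. *)
  pose chi := box_bump (const_mx (- k%:R) : 'rV[R]_n) (const_mx k%:R).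
  have tchi : test_function chi := box_bump_test _ _.
  have chi0 x : 0 <= chi x by exact: box_bump_ge0.
  pose w x := `|F x| * chi x.
  have iFc := integrable_mul_test iF tchi.
  have iw : mu.-integrable setT (EFin \o w).
    have := integrable_abse iFc; congr integrable; apply/funext => x /=.
    by rewrite normrM (ger0_norm (chi0 x)).
  have mchi : measurable_fun setT chi.
    by apply: smooth_measurable; have [] := tchi.
  pose u x := F x * chi x * \1_N x.
  have iu : mu.-integrable setT (EFin \o u).
    apply: (integrableMl measurableT (f := EFin \o (fun x => F x * chi x)) (h := \1_N)) => //.
    by apply: (@bounded_of_le _ _ 1) => x _; rewrite indicE; case: (_ \in _); rewrite ?normr1 ?normr0.
  have u_le0 x : u x <= 0.
    rewrite /u indicE; case: (boolP (x \in N)) => [/set_mem Nx|_]; last by rewrite mulr0.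
    by rewrite mulr1 mulr_le0_ge0 // ltW.
  have u_ge : 0 <= \int[mu]_x u x.
    apply/ler_addgt0Pr => e e0.
    have w0 x : 0 <= w x by rewrite mulr_ge0.
    have [g [sg g01 hg]] := smooth_approx_measurable w0 iw mN e0.
    have tg := test_function_mul sg tchi.
    have ig := integrable_mul_test iF tg.
    have := H _ tg (fun x => mulr_ge0 (proj1 (andP (g01 x))) (chi0 x)) => h.
    apply: (le_trans h).
    have mg := smooth_measurable sg.
    pose d x := `|\1_N x - g x| * w x.
    have id : mu.-integrable setT (EFin \o d).
      apply: (integrableMr measurableT (h := fun x => `|\1_N x - g x|) (g := EFin \o w)) => //.
        by apply: measurableT_comp => //; apply: measurable_funB.
      apply: (@bounded_of_le _ _ 1) => x _; have /andP[h1 h2] := g01 x.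
      rewrite normr_id ler_norml indicE; case: (_ \in _) => /=; apply/andP; split; lra.
    have hd : \int[mu]_x d x <= e.
      by rewrite -lee_fin; apply: le_trans hg; rewrite /Rintegral fineK // integrable_fin_num.
    apply: (@le_trans _ _ (\int[mu]_x (u x + d x))).
      apply: le_Rintegral => //.
        have := integrableD measurableT iu id; congr integrable.
      move=> x _; rewrite /u /d /w.
      rewrite -subr_ge0 (_ : _ - _ = chi x * (F x * (\1_N x - g x) + `|F x| * `|\1_N x - g x|)); last by ring.
      rewrite mulr_ge0 // -normrM.
      by have := ler_norm (- (F x * (\1_N x - g x))); rewrite normrN; lra.
    by rewrite RintegralD // lerD2l.
  have iu0 : (\int[mu]_x `|(EFin \o u) x| = 0)%E.
    have -> : (\int[mu]_x `|(EFin \o u) x| = - \int[mu]_x (EFin \o u) x)%E.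
      rewrite -integralN; last first.
        by apply: fin_num_adde_defl; rewrite fin_numN; have /integrable_neg_fin_num := iu; exact.
      by apply: eq_integral => x _ /=; rewrite ler0_norm.
    apply/eqP; rewrite oppe_eq0; apply/eqP.
    rewrite -[LHS]fineK; last exact: integrable_fin_num.
    congr EFin; apply/le_anti; rewrite -/(Rintegral _ _ _) u_ge andbT.
    rewrite -oppr_ge0 /Rintegral -fineN -integralN; last first.
      by apply: fin_num_adde_defl; rewrite fin_numN; have /integrable_neg_fin_num := iu; exact.
    by apply: fine_ge0; apply: integral_ge0 => x _ /=; rewrite lee_fin oppr_ge0.
  have mu' : measurable_fun setT (EFin \o u) by exact: measurable_int iu.
  have /(ae_eq_integral_abs mu measurableT mu')[Z [mZ Z0 hZ]] := iu0.
  apply/le_anti; rewrite measure_ge0 andbT -Z0; apply: le_measure; rewrite ?inE //.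
    by apply: measurableI => //; exact: measurable_cube.
  move=> x [Nx cx]; apply: hZ => /= /(_ I) [].
  rewrite /u indicE mem_set // mulr1 => /eqP; rewrite mulf_eq0 => /orP[/eqP F0|/eqP c0].
    by move: Nx; rewrite /N /= F0 ltxx.
  suff : 0 < chi x by rewrite c0 ltxx.
  by apply: box_bump_gt0 => i; rewrite !mxE; exact: cx.
exists N; split => //.
  rewrite -(cvg_lim _ (cube_cvg mN)) //.
  by under eq_fun do rewrite key; exact: lim_cst.
by move=> x /= /negP; rewrite -ltNge.
Qed.

End fundamental_lemma.

(** * Integrals under measure-preserving maps *)

Section change_of_variables.
Context {R : realType} {n : nat}.
Local Notation mu := (@lebesgue_rV R n).
Variable T : 'rV[R]_n -> 'rV[R]_n.
Hypothesis mT : measurable_fun setT T.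
Hypothesis muT : forall E, measurable E -> mu (T @^-1` E) = mu E.

Let pushT (F : 'rV[R]_n -> \bar R) :
  (\int[pushforward mu T]_x F x = \int[mu]_x F x)%E.
Proof. by apply: eq_measure_integral => A mA _; exact: muT. Qed.

Lemma integrable_preserving (F : 'rV[R]_n -> \bar R) :
  mu.-integrable setT F -> mu.-integrable setT (F \o T).
Proof.
move=> /integrableP[mF iF]; apply/integrableP; split; first exact: measurableT_comp.
rewrite (_ : integral _ _ _ = \int[mu]_x `|F x|)%E //.
rewrite -pushT ge0_integral_pushforward //.
exact: measurableT_comp.
Qed.

Lemma integral_preserving (F : 'rV[R]_n -> \bar R) :
  mu.-integrable setT F -> (\int[mu]_x F (T x) = \int[mu]_x F x)%E.
Proof.
move=> iF; rewrite -[RHS]pushT integral_pushforward //.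
  exact: measurable_int iF.
exact: integrable_preserving.
Qed.

Lemma Rintegral_preserving (F : 'rV[R]_n -> R) :
  mu.-integrable setT (EFin \o F) -> \int[mu]_x F (T x) = \int[mu]_x F x.
Proof. by move=> iF; rewrite /Rintegral -(integral_preserving iF). Qed.

End change_of_variables.

Section weak_gradient.
Context {R : realType} {n : nat}.
Local Notation mu := (@lebesgue_rV R n).
Implicit Types (f g F : 'rV[R]_n -> R) (x v xi : 'rV[R]_n).

Lemma integrable_Rsum (I : Type) (r : seq I) (A : set 'rV[R]_n) (F : I -> 'rV[R]_n -> R) :
  measurable A -> (forall i, mu.-integrable A (EFin \o F i)) ->
  mu.-integrable A (EFin \o (fun x => \sum_(i <- r) F i x)) /\
  \int[mu]_(x in A) (\sum_(i <- r) F i x) = \sum_(i <- r) \int[mu]_(x in A) F i x.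
Proof.
move=> mA iF; elim: r => [|i r [IH1 IH2]].
  rewrite (_ : (fun x => _) = fun=> 0); last by apply/funext => x; rewrite big_nil.
  rewrite big_nil; split; first exact: integrable0.
  by rewrite Rintegral_cst // mul0r.
have E : (fun x => \sum_(j <- i :: r) F j x) = (fun x => F i x + \sum_(j <- r) F j x).
  by apply/funext => x; rewrite big_cons.
split; first by rewrite E; have := integrableD mA (iF i) IH1; congr integrable.
by rewrite E RintegralD // IH2 big_cons.
Qed.

Definition dirder v f x : R := \sum_i v 0 i * partial i f x.

Lemma test_function_translate f v : test_function f -> test_function (fun x => f (x + v)).
Proof.
move=> tf; have := @test_function_affine R n f 1%:M 1%:M v (mul1mx _) tf.
by under eq_fun do rewrite mulmx1.
Qed.

Lemma dirder_translate f v b x : smooth f ->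
  dirder v (fun y => f (y + b)) x = dirder v f (x + b).
Proof.
move=> sf; apply: eq_bigr => i _; congr (_ * _).
rewrite /partial; apply: derive_val.
have D : is_derive (x + b) (delta_mx 0 i) f ('D_(delta_mx 0 i) f (x + b)).
  by apply: derivableP; have [_ /(_ i)[]] := sf 1%N.
move/is_derive_lineP : D => D; apply/is_derive_lineP => e e0.
have [d d0 hd] := D e e0; exists d => // h h0 hlt.
by rewrite -[_ + _ + b]addrA; exact: hd.
Qed.

Lemma locally_integrable_continuous f : continuous f -> locally_integrable_rV f.
Proof.
move=> cf K cK; have mK := compact_measurable_rV cK.
have [M hM] := compact_coor_bounded cK.
apply: measurable_bounded_integrable => //.
- apply: (@le_lt_trans _ _ (mu (cube n (- (`|M| + 1)) (`|M| + 1)))).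
    apply: le_measure; rewrite ?inE //; first exact: measurable_cube.
    move=> x /hM h i; rewrite -ltr_norml.
    by apply: (le_lt_trans (h i)); apply: (le_lt_trans (ler_norm M)); rewrite ltrDl.
  by rewrite lebesgue_cube ?ltry //; have := normr_ge0 M; lra.
- by apply: (measurable_funS measurableT) => //; exact: continuous_measurable_rV.
- have := continuous_compact (continuous_subspaceT cf) cK.
  move=> /compact_bounded[C [_ hC]]; apply: (@bounded_of_le _ _ _ _ (C + 1)) => x Kx.
  by apply: (hC (C + 1)); [rewrite ltrDl|exists x].
Qed.

Lemma locally_integrable_cst (c : R) : locally_integrable_rV (fun _ : 'rV[R]_n => c).
Proof.
apply: locally_integrable_continuous; apply/continuous_rVP => x e e0.
by exists 1 => // y _; rewrite subrr normr0.
Qed.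

Lemma integrable_test f : test_function f -> mu.-integrable setT (EFin \o f).
Proof.
move=> tf; have := integrable_mul_test (locally_integrable_cst 1) tf; congr integrable; apply/funext => x /=.
by rewrite mul1r.
Qed.

Lemma Rintegral_box_bump_gt0 (a b : 'rV[R]_n) : (forall i, a 0 i < b 0 i) ->
  0 < \int[mu]_x box_bump a b x.
Proof.
move=> ab.
have tb := box_bump_test a b.
have ib : mu.-integrable setT (EFin \o box_bump a b) by exact: integrable_test.
rewrite lt_neqAle Rintegral_ge0 ?andbT; last by move=> x _; exact: box_bump_ge0.
apply/eqP => h0.
have mb : measurable_fun setT (EFin \o box_bump a b) by exact: measurable_int ib.
have : (\int[mu]_x `|(EFin \o box_bump a b) x| = 0)%E.
  rewrite -[LHS]fineK; last first.
    by apply: integrable_fin_num => //; exact: (integrable_abse ib).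
  congr EFin; rewrite [RHS]h0; congr fine; apply: eq_integral => x _ /=.
  by rewrite ger0_norm // box_bump_ge0.
move=> /(ae_eq_integral_abs mu measurableT mb)[Z [mZ Z0 hZ]].
pose U := [set x : 'rV[R]_n | 0 < box_bump a b x].
have cb := test_function_continuous tb.
have oU : open U.
  rewrite (_ : U = box_bump a b @^-1` `]0, +oo[%classic).
    by move/continuousP : cb; apply; exact: interval_open.
  by apply/seteqP; split => x /=; rewrite in_itv /= andbT.
have : (0 < mu U)%E.
  apply: open_lebesgue_gt0 => //; exists (\row_i ((a 0 i + b 0 i) / 2)).
  apply: box_bump_gt0 => i; rewrite mxE; have := ab i => abi.
  by apply/andP; split; lra.
rewrite ltNge -Z0 => /negP; apply; apply: le_measure; rewrite ?inE //.
  exact: open_measurable_rV.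
move=> x Ux; apply: hZ => /= /(_ I) [] bx; move: Ux; rewrite /U /= bx ltxx //.
Qed.

Lemma test_function_dirder f xi : test_function f -> test_function (dirder xi f).
Proof.
move=> tf; have /test_functionP[sf [M hM]] := tf.
apply/test_functionP; split.
    by move=> k; apply: is_Ck_sum => i; apply: is_CkM; [exact: is_Ck_cst|exact: smooth_partial].
exists M => x; apply: contraNP => /existsNP[j /negP]; rewrite -ltNge => Mx.
apply/eqP; apply: big1 => i _.
have /test_functionP[_ _] := test_function_partial i tf.
have -> : partial i f x = 0; last by rewrite mulr0.
apply: derive_val; apply/is_derive_lineP => e e0.
have d0 : 0 < `|x 0 j| - M by rewrite subr_gt0.
exists (`|x 0 j| - M) => // r r0 rlt.
have f0 (y : 'rV[R]_n) : `|x 0 j - y 0 j| < `|x 0 j| - M -> f y = 0.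
  move=> xy; apply/eqP; apply: contraTT xy => /hM/(_ j) yM; rewrite -leNgt.
  by have := lerB_dist (x 0 j) (y 0 j); lra.
rewrite (f0 x) ?subrr ?normr0 // f0 ?mulr0 ?subr0 ?normr0 ?mulr_ge0 ?(ltW e0) //.
rewrite distrC !mxE addrK; apply: le_lt_trans rlt.
by rewrite eqxx /=; case: (_ == _); rewrite ?mulr1 // mulr0 normr0.
Qed.

Section equivalence.
Variables (g : 'rV[R]_n -> R) (G : 'rV[R]_n -> 'rV[R]_n).
Hypothesis wG : is_weak_grad g G.

Let lg : locally_integrable_rV g. Proof. by case: wG. Qed.

Lemma measurable_dotp_grad xi : measurable_fun setT (fun x => dotp (G x) xi).
Proof.
by apply: measurable_sum => i; apply: measurable_funM => //; have [_ /(_ i)[]] := wG.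
Qed.

Lemma integrable_dotp_grad xi : locally_integrable_rV (fun x => dotp (G x) xi).
Proof.
move=> K cK; have mK := compact_measurable_rV cK.
apply: (integrable_Rsum (F := fun i x => G x 0 i * xi 0 i) _ mK _).1 => i.
have [_ /(_ i)[_ liG _]] := wG.
have := integrableZl mK (xi 0 i) (liG K cK); congr integrable.
by apply/funext => x /=; rewrite mulrC.
Qed.

Lemma integrable_grad_test i f : test_function f ->
  mu.-integrable setT (EFin \o (fun x => G x 0 i * f x)).
Proof.
by move=> tf; apply: (integrable_mul_test (F := fun x => G x 0 i)) => //; have [_ /(_ i)[]] := wG.
Qed.

Lemma weak_grad_dirder f xi : test_function f ->
  \int[mu]_x (g x * dirder xi f x) = - \int[mu]_x (dotp (G x) xi * f x).
Proof.
move=> tf.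
transitivity (\int[mu]_x (\sum_i xi 0 i * (g x * partial i f x))).
  by apply: eq_Rintegral => x _; rewrite mulr_sumr; apply: eq_bigr => i _; ring.
have i1 i : mu.-integrable setT (EFin \o (fun x => g x * partial i f x)).
  by apply: integrable_mul_test => //; exact: test_function_partial.
have i2 i := integrable_grad_test i tf.
have iZ (a : R) (u : 'rV[R]_n -> R) : mu.-integrable setT (EFin \o u) ->
    mu.-integrable setT (EFin \o (fun x => a * u x)).
  by move=> iu; have := integrableZl measurableT a iu; congr integrable.
rewrite (integrable_Rsum (F := fun i x => xi 0 i * (g x * partial i f x)) _ measurableT _).2; last first.
  by move=> i; exact: iZ.
rewrite (_ : \int[mu]_x (dotp (G x) xi * f x) = \int[mu]_x (\sum_i xi 0 i * (G x 0 i * f x))); last first.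
  by apply: eq_Rintegral => x _; rewrite mulr_suml; apply: eq_bigr => i _; ring.
rewrite (integrable_Rsum (F := fun i x => xi 0 i * (G x 0 i * f x)) _ measurableT _).2; last first.
  by move=> i; exact: iZ.
rewrite -sumrN; apply: eq_bigr => i _; rewrite !RintegralZl // -mulrN; congr (_ * _).
by have [_ /(_ i)[_ _]] := wG; exact.
Qed.

(** The shift sits on the smooth factor, so differentiation under the integral is legitimate; it
    produces [- dirder xi f], and the integration by parts that defines the weak gradient cancels
    the sign. *)
Lemma is_derive_Rintegral_shift f xi (s : R) : test_function f ->
  is_derive s (1 : R) (fun t => \int[mu]_x (g x * f (x - t *: xi)))
    (\int[mu]_x (dotp (G x) xi * f (x - s *: xi))).
Proof.
move=> tf; have /test_functionP[sf [M hM]] := tf.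
pose h t x := g x * f (x - t *: xi).
have tt t : test_function (fun x => f (x - t *: xi)) by exact: test_function_translate.
have ih t : mu.-integrable setT (EFin \o h t) by exact: integrable_mul_test.
have tdir : test_function (dirder xi f) by exact: test_function_dirder.
have dh t x : is_derive t (1 : R) (h ^~ x) (- (g x * dirder xi f (x - t *: xi))).
  have D : is_derive t (1 : R) (fun r => f (r *: (- xi) + x)) (- dirder xi f (x - t *: xi)).
    apply: is_derive_line; have := C1_is_derive (t *: - xi + x) (- xi) (sf 1%N).
    congr is_derive; rewrite /dirder -sumrN; apply: eq_bigr => i _.
    by rewrite mxE mulNr scalerN addrC.
  move/is_derive_lineP: D => D; apply/is_derive_lineP => e e0.
  have g1 : 0 < 1 + `|g x| by rewrite ltr_pwDl.
  have [d d0 hd] := D _ (divr_gt0 e0 g1); exists d => // r r0 rlt.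
  have := hd r r0 rlt; rewrite !scalerN -!(addrC x) => hr.
  rewrite /h -mulrBr mulrN -mulrCA -mulrN -mulrBr normrM.
  rewrite mulrN in hr.
  apply: (le_trans (ler_wpM2l (normr_ge0 _) hr)).
  rewrite mulrA ler_wpM2r // mulrCA ler_piMr ?(ltW e0) //.
  by rewrite ler_pdivrMr // mul1r lerDr.
have [C C0 hC] := test_function_bounded tdir.
have [M' hM'] := (proj2 ((test_functionP (dirder xi f)).1 tdir)).
(* [B] contains the support of [dirder xi f (x - t *: xi)] for all [t] within distance 1 of [s],
   which makes [dom] a common integrable majorant. *)
pose B := [set x : 'rV[R]_n | forall i, `|x 0 i| <= `|M'| + (`|s| + 1) * \sum_i `|xi 0 i|].
have cB : compact (closure B) by apply/compact_closureP; eexists => x; exact.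
have mB := compact_measurable_rV cB.
pose dom x := \1_(closure B) x * (`|g x| * C).
have idom : mu.-integrable setT (EFin \o dom).
  have : mu.-integrable (closure B) (EFin \o (fun x => C * `|g x|)).
    have := integrableZl mB C (integrable_abse (lg cB)); congr integrable.
  move/(integrable_mkcond _ mB); congr integrable; apply/funext => x /=.
  rewrite patchE /dom indicE; case: ifPn => _ /=; first by rewrite mul1r mulrC.
  by rewrite mul0r.
have dom0 x : 0 <= dom x by rewrite mulr_ge0 ?mulr_ge0 // indicE.
have sI : `]s - 1, s + 1[%classic s by rewrite /= in_itv /=; apply/andP; split; lra.
have part t x : partial1of2 h t x = - (g x * dirder xi f (x - t *: xi)).
  by rewrite partial1of2E; exact: derive_val.
have ub t x : `]s - 1, s + 1[%classic t -> setT x -> `|partial1of2 h t x| <= dom x.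
  rewrite /= in_itv /= => /andP[t1 t2] _; rewrite part normrN normrM.
  have [d0|dn0] := eqVneq (dirder xi f (x - t *: xi)) 0; first by rewrite d0 normr0 mulr0.
  rewrite /dom indicE mem_set ?mul1r ?ler_wpM2l //.
  apply: subset_closure => i; have := hM' _ dn0 i; rewrite !mxE => hx.
  have ts : `|t| <= `|s| + 1.
    by rewrite ler_norml; have := ler_norm s; have := ler_norm (- s); rewrite normrN => *; apply/andP; split; lra.
  have hxi : `|t * xi 0 i| <= (`|s| + 1) * \sum_i `|xi 0 i|.
    rewrite normrM ler_pM // (bigD1 i) //= lerDl sumr_ge0 //.
  have := ler_normD (x 0 i - t * xi 0 i) (t * xi 0 i); rewrite subrK => hh.
  by have := ler_norm M'; lra.
have der t x : `]s - 1, s + 1[%classic t -> setT x -> derivable (h ^~ x) t 1.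
  by move=> _ _; exact: (@ex_derive _ _ _ _ _ _ _ (dh t x)).
have ih' t : `]s - 1, s + 1[%classic t -> mu.-integrable setT (EFin \o h t) by [].
apply: DeriveDef.
  exact: (@derivable_under_integral _ _ _ mu h setT measurableT _ _ _ sI ih' der dom dom0 idom ub).
rewrite -derive1E (@differentiation_under_integral _ _ _ mu h setT measurableT _ _ _ sI ih' der dom dom0 idom ub).
transitivity (- \int[mu]_x (g x * dirder xi (fun y => f (y - s *: xi)) x)).
  rewrite -[RHS]mulN1r -RintegralZl //; last first.
    apply: integrable_mul_test => //.
    rewrite (_ : dirder _ _ = fun x => dirder xi f (x + - (s *: xi))).
      exact: test_function_translate.
    by apply/funext => x; exact: dirder_translate.
  by apply: eq_Rintegral => x _; rewrite part dirder_translate // mulN1r.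
by rewrite weak_grad_dirder // opprK.
Qed.

Lemma Rintegral_shift f xi (t : R) : test_function f ->
  \int[mu]_x (g x * f (x - t *: xi)) = \int[mu]_x (g (x + t *: xi) * f x).
Proof.
move=> tf.
rewrite -(@Rintegral_preserving R n (fun x => x + t *: xi) (@measurable_translate R n _)
  (@lebesgue_rV_translate R n (t *: xi)) (fun x => g x * f (x - t *: xi))).
  by apply: eq_Rintegral => x _; rewrite addrK.
by apply: integrable_mul_test => //; exact: test_function_translate.
Qed.

End equivalence.
End weak_gradient.

(** * Gradient bounds and bounds on increments *)

Section gradient_bound.
Context {R : realType} {n : nat}.
Local Notation mu := (@lebesgue_rV R n).
Variables (g : 'rV[R]_n -> R) (G : 'rV[R]_n -> 'rV[R]_n).
Hypothesis cg : continuous g.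
Hypothesis wG : is_weak_grad g G.

Let lg : locally_integrable_rV g. Proof. by case: wG. Qed.

Let int_shift f xi (t : R) : test_function f ->
  mu.-integrable setT (EFin \o (fun x => g (x + t *: xi) * f x)).
Proof.
move=> tf.
have lgt : locally_integrable_rV (fun x => g (x + t *: xi)).
  apply: locally_integrable_continuous; apply/continuous_rVP => x e e0.
  have [d d0 hd] := (continuous_rVP g).1 cg (x + t *: xi) e e0.
  exists d => // y xy; apply: hd => i; rewrite !mxE opprD addrACA subrr addr0; exact: xy.
exact: (integrable_mul_test lgt tf).
Qed.

Let shift_diff f xi (t : R) : test_function f ->
  \int[mu]_x (g x * f (x - t *: xi)) - \int[mu]_x (g x * f (x - 0 *: xi)) =
  \int[mu]_x ((g (x + t *: xi) - g x) * f x).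
Proof.
move=> tf; rewrite !(Rintegral_shift wG) // -RintegralB //; try exact: int_shift.
by apply: eq_Rintegral => x _; rewrite scale0r addr0 mulrBl.
Qed.

Let integrable_dotp_test f xi : test_function f ->
  mu.-integrable setT (EFin \o (fun x => dotp (G x) xi * f x)).
Proof. by move=> tf; apply: integrable_mul_test => //; exact: (integrable_dotp_grad wG). Qed.

Let ae_dotp_le f xi : {ae mu, forall x, dotp (G x) xi <= 1} -> test_function f ->
  (forall x, 0 <= f x) -> \int[mu]_x (dotp (G x) xi * f x) <= \int[mu]_x f x.
Proof.
move=> ae tf f0; have if_ := integrable_test tf; have iGf := integrable_dotp_test xi tf.
have mf : measurable_fun setT f by apply/measurable_EFinP; exact: measurable_int if_.
have mG := measurable_dotp_grad wG xi.
have id_ := integrableB measurableT if_ iGf.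
rewrite -subr_ge0 -RintegralB //.
(* The integrand is nonnegative only almost everywhere; it is replaced by its positive part, which
   is so everywhere. *)
rewrite /Rintegral (ae_eq_integral (EFin \o (fun x => maxr (f x - dotp (G x) xi * f x) 0))) //.
- rewrite -/(Rintegral _ _ _) Rintegral_ge0 // => x _.
  by rewrite /= le_max lexx orbT.
- exact: measurable_int id_.
- apply/measurable_EFinP; apply: measurable_maxr => //.
  by apply: measurable_funB => //; exact: measurable_funM.
- apply: filterS ae => x Gx _ /=; congr EFin; apply/esym/max_idPl.
  by rewrite subr_ge0 ler_piMl.
Qed.

(** If the increment at [x0] exceeded [t] by [e], it would exceed [t + e / 2] on a small box around
    [x0]. Testing with a bump of mass [P] on that box gives [(t + e / 2) * P <= h t - h 0], whereas
    the mean value theorem and the gradient bound give [h t - h 0 <= t * P]. *)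
Lemma ae_dotp_increment xi : {ae mu, forall x, dotp (G x) xi <= 1} ->
  forall (x : 'rV[R]_n) (t : R), 0 < t -> g (x + t *: xi) - g x <= t.
Proof.
move=> ae x0 t t0; rewrite leNgt; apply/negP; rewrite -subr_gt0.
set e := _ - t => e0.
(* Each of the two values of [g] may move by [e / 4], which leaves [e / 2] of the excess. *)
have e4 : 0 < e / 4 by rewrite divr_gt0.
have [d1 d10 hd1] := (continuous_rVP g).1 cg x0 _ e4.
have [d2 d20 hd2] := (continuous_rVP g).1 cg (x0 + t *: xi) _ e4.
pose d := minr d1 d2.
have d0 : 0 < d by rewrite lt_min d10 d20.
pose a : 'rV[R]_n := \row_i (x0 0 i - d); pose b : 'rV[R]_n := \row_i (x0 0 i + d).
pose phi := box_bump a b.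
have tphi : test_function phi := box_bump_test a b.
have phi0 x : 0 <= phi x := box_bump_ge0 a b x.
have P0 : 0 < \int[mu]_x phi x.
  by apply: Rintegral_box_bump_gt0 => i; rewrite !mxE; rewrite ltrD2l; apply: (lt_trans _ d0); rewrite oppr_lt0.
set P := \int[mu]_x phi x in P0.
have low x : (t + e / 2) * phi x <= (g (x + t *: xi) - g x) * phi x.
  have [->|px] := eqVneq (phi x) 0; first by rewrite !mulr0.
  apply: ler_wpM2r => //.
  have close i : `|x0 0 i - x 0 i| < d.
    have := box_bump_neq0 px i; rewrite !mxE ltr_norml => /andP[h1 h2].
    by apply/andP; split; lra.
  have : `|g x0 - g x| < e / 4.
    by apply: hd1 => i; apply: (lt_le_trans (close i)); rewrite ge_min lexx.
  have : `|g (x0 + t *: xi) - g (x + t *: xi)| < e / 4.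
    apply: hd2 => i; rewrite !mxE opprD addrACA subrr addr0.
    by apply: (lt_le_trans (close i)); rewrite ge_min lexx orbT.
  rewrite !ltr_norml => /andP[h1 h2] /andP[h3 h4].
  move: h1 h2 h3 h4; rewrite /e.
  move: (g x0) (g x) (g (x0 + _)) (g (x + _)) => *; lra.
pose h s := \int[mu]_x (g x * phi (x - s *: xi)).
pose D s := \int[mu]_x (dotp (G x) xi * phi (x - s *: xi)).
have dh s : is_derive s (1 : R) h (D s) by exact: is_derive_Rintegral_shift.
have [c _ hc] : exists2 c, c \in `]0, t[%R & h t - h 0 = D c * (t - 0).
  apply: MVT => //.
  by apply: derivable_within_continuous => s _; exact: (@ex_derive _ _ _ _ _ _ _ (dh s)).
have Dc : D c <= P.
  have tc : test_function (fun x => phi (x - c *: xi)) by exact: test_function_translate.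
  apply: (le_trans (ae_dotp_le ae tc _)) => [x|]; first exact: phi0.
  rewrite (@Rintegral_preserving R n (fun x => x - c *: xi) (@measurable_translate R n _)
    (@lebesgue_rV_translate R n (- (c *: xi))) phi) //.
  exact: integrable_test.
have : (t + e / 2) * P <= h t - h 0.
  rewrite shift_diff // -RintegralZl //; last exact: integrable_test.
  apply: le_Rintegral => //.
    by have := integrableZl measurableT (t + e / 2) (integrable_test tphi); congr integrable.
  have := integrableB measurableT (int_shift xi t tphi) (int_shift xi 0 tphi); congr integrable.
  by apply/funext => x /=; rewrite scale0r addr0 mulrBl.
rewrite hc subr0 => hP.
have : (t + e / 2) * P <= t * P.
  by apply: (le_trans hP); rewrite mulrC ler_wpM2l // ltW.
by rewrite ler_pM2r // gerDl leNgt divr_gt0.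
Qed.

(** For a nonnegative test function the difference quotient at 0 of the shifted integral is at most
    the integral of [f], hence so is its derivative, the integral of [dotp (G x) xi * f x]. As [f]
    is arbitrary, this is the weak form of the bound. *)
Lemma increment_ae_dotp xi :
  (forall (x : 'rV[R]_n) (t : R), 0 < t -> g (x + t *: xi) - g x <= t) ->
  {ae mu, forall x, dotp (G x) xi <= 1}.
Proof.
move=> inc.
suff : {ae mu, forall x, 0 <= 1 - dotp (G x) xi}.
  by apply: filterS => x; rewrite subr_ge0.
apply: (ae_ge0_test (F := fun x => 1 - dotp (G x) xi)).
- by apply: measurable_funB => //; exact: (measurable_dotp_grad wG).
- move=> K cK; have mK := compact_measurable_rV cK.
  have := integrableB mK (@locally_integrable_cst R n 1 K cK) (integrable_dotp_grad wG xi cK).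
  by congr integrable.
move=> f tf f0; have if_ := integrable_test tf.
rewrite (_ : \int[mu]_x _ = \int[mu]_x f x - \int[mu]_x (dotp (G x) xi * f x)); last first.
  rewrite -RintegralB //; last exact: integrable_dotp_test.
  by apply: eq_Rintegral => x _; rewrite mulrBl mul1r.
rewrite subr_ge0; set P := \int[mu]_x f x.
have := is_derive_Rintegral_shift wG xi 0 tf.
rewrite (_ : \int[mu]_x (dotp (G x) xi * f (x - 0 *: xi)) = \int[mu]_x (dotp (G x) xi * f x)); last first.
  by apply: eq_Rintegral => x _; rewrite scale0r subr0.
set D := \int[mu]_x (_ * f x).
move/is_derive_lineP => dh; apply/ler_addgt0Pr => e e0.
have [d d0 hd] := dh e e0.
have d2 : 0 < d / 2 by rewrite divr_gt0.
have := hd (d / 2); rewrite gt_eqF // gtr0_norm // => /(_ isT).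
have -> : d / 2 < d by rewrite gtr_pMr // invf_lt1 // ltr1n.
move=> /(_ isT); rewrite addr0 [_ *: 1]mulr1 shift_diff //.
have : \int[mu]_x ((g (x + (d / 2) *: xi) - g x) * f x) <= d / 2 * P.
  rewrite -RintegralZl //; apply: le_Rintegral => //.
  - have := integrableB measurableT (int_shift xi (d / 2) tf) (int_shift xi 0 tf); congr integrable.
    by apply/funext => x /=; rewrite scale0r addr0 mulrBl.
  - by have := integrableZl measurableT (d / 2) if_; congr integrable.
  by move=> x _; rewrite ler_wpM2r // inc.
move=> h1; rewrite ler_norml => /andP[h2 _].
have : d / 2 * D <= d / 2 * (P + e).
  by rewrite mulrDr (mulrC _ e); lra.
by rewrite ler_pM2l.
Qed.

Lemma ae_dotpP xi : {ae mu, forall x, dotp (G x) xi <= 1} <->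
  forall (x : 'rV[R]_n) (t : R), 0 < t -> g (x + t *: xi) - g x <= t.
Proof. by split; [exact: ae_dotp_increment|exact: increment_ae_dotp]. Qed.

Lemma ae_dotpNP xi : {ae mu, forall x, - dotp (G x) xi <= 1} <->
  forall (x : 'rV[R]_n) (t : R), 0 < t -> g x - g (x + t *: xi) <= t.
Proof.
have E x : - dotp (G x) xi = dotp (G x) (- xi) by rewrite -(scaleN1r xi) dotpZr mulN1r.
split => h.
  have /ae_dotpP h' : {ae mu, forall x, dotp (G x) (- xi) <= 1}.
    by apply: filterS h => x; rewrite E.
  by move=> x t t0; have := h' (x + t *: xi) t t0; rewrite scalerN addrK.
have : {ae mu, forall x, dotp (G x) (- xi) <= 1}.
  apply/ae_dotpP => x t t0.
  by have := h (x - t *: xi) t t0; rewrite scalerN subrK.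
by apply: filterS => x; rewrite E.
Qed.

End gradient_bound.

Section grad_gauge.
Context {R : realType} {n : nat}.
Local Notation mu := (@lebesgue_rV R n).
Variable g : 'rV[R]_n -> R.
Hypothesis cg : continuous g.
Hypothesis wg : is_weak_grad g (weak_grad g).

Lemma Pi_grad_posE : Pi_grad_pos g = fd_set pos_part 1 g.
Proof.
apply/seteqP; split => xi /=.
  move=> /ess_supP ae x t t0; rewrite powRr1 ?(ltW t0) // /pos_part ge_max (ltW t0) andbT.
  apply: (ae_dotpP cg wg xi).1 => //; apply: filterS ae => y /=.
  by rewrite lee_fin /pos_part ge_max => /andP[].
move=> h; apply/ess_supP.
have : {ae mu, forall x, dotp (weak_grad g x) xi <= 1}.
  apply/(ae_dotpP cg wg xi) => x t t0; have := h x t t0.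
  by rewrite powRr1 ?(ltW t0) // /pos_part ge_max => /andP[].
by apply: filterS => y hy; rewrite lee_fin /pos_part ge_max hy ler01.
Qed.

Lemma Pi_grad_negE : Pi_grad_neg g = fd_set neg_part 1 g.
Proof.
apply/seteqP; split => xi /=.
  move=> /ess_supP ae x t t0; rewrite powRr1 ?(ltW t0) // /neg_part ge_max (ltW t0) andbT opprB.
  apply: (ae_dotpNP cg wg xi).1 => //; apply: filterS ae => y /=.
  by rewrite lee_fin /neg_part ge_max => /andP[].
move=> h; apply/ess_supP.
have : {ae mu, forall x, - dotp (weak_grad g x) xi <= 1}.
  apply/(ae_dotpNP cg wg xi) => x t t0; have := h x t t0.
  by rewrite powRr1 ?(ltW t0) // /neg_part ge_max opprB => /andP[].
by apply: filterS => y hy; rewrite lee_fin /neg_part ge_max hy ler01.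
Qed.

Lemma Pi_gradE : Pi_grad g = fd_set normr 1 g.
Proof.
apply/seteqP; split => xi /=.
  move=> /ess_supP ae x t t0; rewrite powRr1 ?(ltW t0) // ler_norml lerNl opprB; apply/andP; split.
    apply: (ae_dotpNP cg wg xi).1 => //; apply: filterS ae => y /=.
    by rewrite lee_fin ler_norml lerNl => /andP[].
  apply: (ae_dotpP cg wg xi).1 => //; apply: filterS ae => y /=.
  by rewrite lee_fin ler_norml => /andP[].
move=> h; apply/ess_supP.
have a1 : {ae mu, forall x, - dotp (weak_grad g x) xi <= 1}.
  apply/(ae_dotpNP cg wg xi) => x t t0; have := h x t t0.
  by rewrite powRr1 ?(ltW t0) // ler_norml lerNl opprB => /andP[].
have a2 : {ae mu, forall x, dotp (weak_grad g x) xi <= 1}.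
  apply/(ae_dotpP cg wg xi) => x t t0; have := h x t t0.
  by rewrite powRr1 ?(ltW t0) // ler_norml => /andP[].
by apply: filterS2 a1 a2 => y h1 h2; rewrite lee_fin ler_norml lerNl h1 h2.
Qed.

End grad_gauge.

(** * The symmetral and the equality case *)

Section rearrangement.
Context {R : realType} {n : nat}.
Hypothesis n_gt0 : (0 < n)%N.
Local Notation mu := (@lebesgue_rV R n).
Variables (f : 'rV[R]_n -> R) (M : R).
Hypothesis mf : measurable_fun setT f.
Hypothesis f_le : forall x, f x <= M.
Hypothesis f_fin : forall t, 0 < t -> (mu [set x | (t <= f x)%R] < +oo)%E.
Hypothesis mF : measurable_fun setT (schwarz f).

(** The superlevel set at [t] contains the ball of the right volume and is contained in the balls of
    all lower levels; continuity of the measure from above closes the gap. *)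
Lemma lebesgue_superlevel_schwarz (t : R) : 0 < t ->
  mu [set x | (t <= schwarz f x)%R] = mu [set x | (t <= f x)%R].
Proof.
move=> t0; have [r [r_mu r_le r_ge]] := schwarz_radius n_gt0 mf f_le f_fin.
apply/le_anti/andP; split; last first.
  rewrite -(r_mu t t0).2; apply: le_measure; rewrite ?inE.
  - exact: measurable_eball.
  - exact: measurable_superlevel.
  - by move=> x /r_le; exact.
(* The maximum with [t / 2] keeps the levels positive, where superlevel sets have finite measure. *)
pose u k := maxr (t - k.+1%:R^-1) (t / 2).
have u0 k : 0 < u k by rewrite /u lt_max divr_gt0 ?orbT.
have ut k : u k < t.
  by rewrite /u gt_max gtrDl oppr_lt0 invr_gt0 ltr0n /= gtr_pMr // invf_lt1 // ltr1n.
have capE : \bigcap_k [set x | u k <= f x] = [set x | t <= f x].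
  apply/seteqP; split => x /=; last by move=> tx k _; exact: (le_trans (ltW (ut k)) tx).
  move=> h; rewrite leNgt; apply/negP => /ltr_add_invr[k]; rewrite -ltrBrDr => fk.
  by have := h k I; rewrite /= leNgt => /negP; apply; apply: (lt_le_trans fk); rewrite /u le_max lexx.
have cvg_u : mu [set x | u k <= f x] @[k --> \oo] --> mu [set x | t <= f x].
  rewrite -capE; apply: (@nonincreasing_cvg_mu _ _ _ mu (fun k => [set x | u k <= f x])) => //.
  - exact: f_fin.
  - by move=> k; exact: measurable_superlevel.
  - by rewrite capE; exact: measurable_superlevel.
  - move=> i j ij; apply/subsetPset => x /=; apply: le_trans.
    rewrite /u ge_max !le_max lexx orbT andbT lerD2l lerN2 lef_pV2 ?posrE ?ltr0n //.
    by rewrite ler_nat ltnS ij.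
rewrite -(cvg_lim _ cvg_u) //; apply: lime_ge; first by apply/cvg_ex; eexists; exact: cvg_u.
apply: nearW => k; rewrite -(r_mu _ (u0 k)).2; apply: le_measure; rewrite ?inE.
- exact: measurable_superlevel.
- exact: measurable_eball.
- by move=> x /= tx; apply: r_ge => //; exact: lt_le_trans tx.
Qed.

End rearrangement.

(** * Weak gradients under measure-preserving affine maps *)

Section affine_change.
Context {R : realType} {n : nat}.
Local Notation mu := (@lebesgue_rV R n).
Variables (A B : 'M[R]_n) (a : 'rV[R]_n).
Hypotheses (AB : A *m B = 1%:M) (BA : B *m A = 1%:M).
Hypothesis muA : forall E, measurable E -> mu ((fun x : 'rV[R]_n => x *m A) @^-1` E) = mu E.

Let S (y : 'rV[R]_n) := y *m B + a.

Let mS : measurable_fun setT S.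
Proof.
exact: (measurableT_comp (measurable_translate a) (measurable_mulmx B)).
Qed.

Let muS E : measurable E -> mu (S @^-1` E) = mu E.
Proof.
move=> mE; pose E' := (fun x : 'rV[R]_n => x + a) @^-1` E.
have mE' : measurable E' by apply: preimage_measurable => //; exact: measurable_translate.
rewrite -[RHS](lebesgue_rV_translate a mE) -(@muA (S @^-1` E)).
  by congr (mu _); apply/seteqP; split => x /=; rewrite /S -mulmxA AB mulmx1.
exact: preimage_measurable.
Qed.

Variables (f F : 'rV[R]_n -> R) (G : 'rV[R]_n -> 'rV[R]_n).
Hypothesis cF : continuous F.
Hypothesis FS : forall y, F y = f (S y).
Hypothesis wG : is_weak_grad f G.

Let rowB i : 'rV[R]_n := row i B.

Lemma partial_affine psi (i : 'I_n) (y : 'rV[R]_n) : is_Ck 1 psi ->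
  partial i (fun z => psi (S z)) y = dirder (rowB i) psi (S y).
Proof.
move=> /(C1_is_derive (S y) (rowB i)) /is_derive_lineP D.
apply: derive_val; apply/is_derive_lineP => e e0.
have [d d0 hd] := D e e0; exists d => // h h0 hlt.
have -> : S (h *: delta_mx 0 i + y) = h *: rowB i + S y.
  by rewrite /S /rowB rowE mulmxDl -scalemxAl addrA.
exact: hd.
Qed.

Let loc_int H : locally_integrable_rV H -> locally_integrable_rV (H \o S).
Proof.
move=> lH K cK; have mK := compact_measurable_rV cK.
have [M hM] := compact_coor_bounded cK.
pose L := closure [set S y | y in K].
have cL : compact L.
  apply/compact_closureP.
  exists (\sum_i \sum_j `|M| * `|B j i| + \sum_i `|a 0 i|) => _ [y Ky <-] i.
  rewrite /S !mxE; apply: (le_trans (ler_normD _ _)); apply: lerD; last first.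
    by rewrite (bigD1 i) //= lerDl sumr_ge0.
  apply: (@le_trans _ _ (\sum_j `|M| * `|B j i|)); last first.
    rewrite [leRHS](bigD1 i) //= lerDl sumr_ge0 // => k _.
    by rewrite sumr_ge0 // => j _; rewrite mulr_ge0.
  apply: (le_trans (ler_norm_sum _ _ _)); apply: ler_sum => j _.
  by rewrite normrM ler_wpM2r // (le_trans (hM y Ky j)) // ler_norm.
have mL := compact_measurable_rV cL.
have := (integrable_mkcond _ mL).1 (lH L cL) => /(integrable_preserving mS muS).
move=> /(integrableS measurableT mK (@subsetT _ K)); apply: eq_integrable => // y /set_mem Ky /=.
by rewrite patchE mem_set //; apply: subset_closure; exists y.
Qed.

(** The chain rule is applied to the test function only: a change of variables carries the integral
    to [f], where the weak gradient is known, and a second one brings it back. *)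
Lemma is_weak_grad_affine : is_weak_grad F (fun y => G (S y) *m B^T).
Proof.
split; first exact: locally_integrable_continuous.
move=> i.
have E : (fun y => (G (S y) *m B^T) 0 i) = (fun x => dotp (G x) (rowB i)) \o S.
  apply/funext => y /=; rewrite mxE; apply: eq_bigr => j _.
  by rewrite !mxE.
split.
- by rewrite E; apply: measurableT_comp => //; exact: (measurable_dotp_grad wG).
- by rewrite E; apply: loc_int; exact: (integrable_dotp_grad wG).
move=> phi tphi.
(* [psi] is [phi] composed with the inverse of [S]. *)
pose psi x := phi (x *m A + - (a *m A)).
have tpsi : test_function psi by exact: (test_function_affine _ AB).
have phiE : phi = fun y => psi (S y).
  by apply/funext => y; rewrite /psi /S mulmxDl -mulmxA BA mulmx1 addrK.
have lf : locally_integrable_rV f by case: wG.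
have tdir := test_function_dirder (rowB i) tpsi.
transitivity (\int[mu]_x ((fun x => f x * dirder (rowB i) psi x) (S x))).
  apply: eq_Rintegral => y _; rewrite FS phiE partial_affine //.
  by case: tpsi => sp _; exact: sp.
rewrite (Rintegral_preserving mS muS (integrable_mul_test lf tdir)).
rewrite (weak_grad_dirder wG) //; congr (- _).
rewrite -(Rintegral_preserving mS muS); last first.
  by apply: integrable_mul_test => //; exact: (integrable_dotp_grad wG).
by apply: eq_Rintegral => y _; rewrite phiE -[dotp _ _]/(((fun x => dotp (G x) (rowB i)) \o S) y) -E.
Qed.

End affine_change.

(** * Gradient bodies of the symmetral, and the equality case *)

Section sobolev_rearrangement.
Context {R : realType} {n : nat}.
Hypothesis n_gt0 : (0 < n)%N.
Local Notation mu := (@lebesgue_rV R n).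
Variable f : 'rV[R]_n -> R.
Hypothesis fW : sobolev_1_infty f.
Hypothesis f_ge0 : forall x, 0 <= f x.

Let cf : continuous f := sobolev_continuous fW.
Let f_fin := sobolev_superlevel_fin fW f_ge0.

Let weak_f : is_weak_grad f (weak_grad f).
Proof. by case: fW => -[]. Qed.

(** The Lipschitz constant [L] refers to the sup norm, which is below the Euclidean one, so the ball
    of radius [L^-1] serves as [K] with exponent 1. *)
Lemma continuous_schwarz : continuous (schwarz f).
Proof.
have [M f_le] := sobolev_bounded fW.
have [L L0 hL] := sobolev_lipschitz fW.
have rho0 : 0 < L^-1 by rewrite invr_gt0.
apply: (@holder_continuous _ _ _ 1 L^-1) => //.
apply: (@schwarz_modulus _ _ n_gt0 f M _ f_le f_fin 1 L^-1 (eball L^-1)) => //.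
- exact: continuous_measurable_rV.
- exact: measurable_eball.
move=> xi x t; rewrite /eball /= => xiL t0.
rewrite powRr1 ?(ltW t0) //; apply: (le_trans (ler_norm _)); apply: (le_trans (hL _ _)).
rewrite opprD addrA subrr add0r normrN.
apply: (@le_trans _ _ (L * enorm (t *: xi))).
  rewrite ler_pM2l // /normr /= mx_normrE; apply/bigmax_leP; split; first exact: enorm_ge0.
  by move=> [i j] _; rewrite !ord1; exact: coor_le_enorm.
rewrite enormZ gtr0_norm // mulrCA ler_piMr ?(ltW t0) //.
by rewrite mulrC -ler_pdivlMr // mul1r ltW.
Qed.

Lemma weak_grad_exists (g : 'rV[R]_n -> R) G : is_weak_grad g G -> is_weak_grad g (weak_grad g).
Proof. by move=> wG; apply: (@xgetPex _ _ [set G | is_weak_grad g G]); exists G. Qed.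

(* It need not be proved that the symmetral has a weak gradient: if it has none,
   weak_grad is the junk value 0 and the gradient body is the whole space. *)
Lemma vol_grad_schwarz (q : R -> R) : continuous q -> q 0 <= 1 ->
  (forall g : 'rV[R]_n -> R, continuous g -> is_weak_grad g (weak_grad g) ->
     unit_set (grad_gauge q g) = fd_set q 1 g) ->
  (mu (fd_set q 1 f) <= mu (fd_set q 1 (schwarz f)))%E ->
  (vol_negpow (unit_set (grad_gauge q (schwarz f))) n%:R^-1 <=
   vol_negpow (unit_set (grad_gauge q f)) n%:R^-1)%E.
Proof.
move=> cq q0 qE qle; have nn : 0 <= (n%:R^-1 : R) by rewrite invr_ge0.
have Ef := qE f cf weak_f.
have vol K K' K0 : K = fd_set q 1 f -> K' = K0 -> (mu (fd_set q 1 f) <= mu K0)%E ->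
    (vol_negpow K' n%:R^-1 <= vol_negpow K n%:R^-1)%E.
  by move=> -> ->; exact: vol_negpow_le.
have [wF|wF] := pselect (is_weak_grad (schwarz f) (weak_grad (schwarz f))).
  have EF := qE (schwarz f) continuous_schwarz wF.
  exact: (vol _ _ _ Ef EF qle).
have w0 : weak_grad (schwarz f) = fun=> 0.
  by apply: xgetPN => G /= wG; apply: wF; exact: weak_grad_exists wG.
have EF : unit_set (grad_gauge q (schwarz f)) = setT.
  rewrite -subTset => xi _.
  have d0 x : dotp (weak_grad (schwarz f) x) xi = 0.
    by rewrite w0 -(scale0r xi) dotpZl mul0r.
  by apply/ess_supP; apply: aeW => x; rewrite d0 lee_fin.
apply: (vol _ _ _ Ef EF).
apply: le_measure; [rewrite inE|rewrite inE; exact: measurableT|exact: subsetT].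
exact: closed_measurable_rV (closed_fd_set cq cf).
Qed.

Section equality.
Variables (A : 'M[R]_n) (a : 'rV[R]_n).
Hypothesis detA : \det A = 1.
Hypothesis fA : forall x, f x = schwarz f ((x - a) *m A).
Hypothesis f_neq0 : exists x, f x != 0.

Let uA : A \in unitmx. Proof. by rewrite unitmxE detA unitr1. Qed.

Lemma mulmx_preserving E : measurable E ->
  mu ((fun x : 'rV[R]_n => x *m A) @^-1` E) = mu E.
Proof.
move=> mE; have [M f_le] := sobolev_bounded fW.
have mf : measurable_fun setT f := continuous_measurable_rV cf.
have mF : measurable_fun setT (schwarz f) := continuous_measurable_rV continuous_schwarz.
have [x0 fx0] := f_neq0; have fx0_gt0 : 0 < f x0 by rewrite lt_neqAle eq_sym fx0 f_ge0.
(* Positivity of [t] makes the superlevel set finite in measure, and [t < f x0] makes it contain a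
   nonempty open set; the factor of [A] is read off from a set of such measure. *)
pose t := f x0 / 2; have t0 : 0 < t by rewrite divr_gt0.
pose Q := [set x | t <= schwarz f x].
have mQ : measurable Q by exact: measurable_superlevel.
have muQ : mu Q = mu [set x | t <= f x] by exact: (lebesgue_superlevel_schwarz n_gt0 mf f_le f_fin mF).
pose h (x : 'rV[R]_n) := x *m A.
have mh : measurable_fun setT h by exact: measurable_mulmx.
have mhQ : measurable (h @^-1` Q) by exact: preimage_measurable.
have hQ : mu (h @^-1` Q) = mu Q.
  rewrite muQ -(lebesgue_rV_translate (- a) mhQ); congr (mu _).
  by apply/seteqP; split => x /=; rewrite /Q /= -fA.
have Q_gt0 : (0 < mu Q)%E.
  rewrite muQ; apply: (@lt_le_trans _ _ (mu (f @^-1` `]t, +oo[%classic))).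
    apply: open_lebesgue_gt0; first by move/continuousP : cf; apply; exact: interval_open.
    by exists x0; rewrite /= in_itv /= andbT /t gtr_pMr // invf_lt1 // ltr1n.
  apply: le_measure; rewrite ?inE.
  - by apply: preimage_measurable => //; exact: measurable_itv.
  - exact: measurable_superlevel.
  - by move=> x /=; rewrite in_itv /= andbT => /ltW.
have Q_fin : (mu Q < +oo)%E by rewrite muQ; exact: f_fin.
have := @lebesgue_rV_pushforward R n h (fun x => x *m invmx A) Q E mh
  (@measurable_mulmx R n n _) (mulmxK uA) (mulmxKV uA) (fun x y => mulmxDl x y A) mE mQ.
rewrite hQ [RHS]muleC => EQ.
have Qf : mu Q \is a fin_num by rewrite ge0_fin_numE // ltW.
by apply/le_anti/andP; split; rewrite -(lee_pmul2r Qf Q_gt0) EQ lexx.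
Qed.

Lemma fd_set_affine (q : R -> R) (s : R) :
  fd_set q s f = (fun xi => xi *m A) @^-1` fd_set q s (schwarz f).
Proof.
have E (x xi : 'rV[R]_n) (t : R) : f (x + t *: xi) - f x =
    schwarz f ((x - a) *m A + t *: (xi *m A)) - schwarz f ((x - a) *m A).
  by rewrite (fA (x + _)) (fA x) addrAC mulmxDl scalemxAl.
apply/seteqP; split => xi /= h x t t0; last by rewrite E; exact: h.
have := h (x *m invmx A + a) t t0; rewrite E addrK mulmxKV //.
Qed.

Lemma lebesgue_fd_set_affine (q : R -> R) (s : R) : continuous q ->
  mu (fd_set q s f) = mu (fd_set q s (schwarz f)).
Proof.
move=> cq; rewrite fd_set_affine.
have mK := closed_measurable_rV (@closed_fd_set _ _ _ s _ cq continuous_schwarz).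
exact: (mulmx_preserving mK).
Qed.

(** Here the symmetral is [f] composed with an affine map and inherits its weak gradient. Equality
    requires this: with the junk gradient 0 the body of the symmetral would be the whole space. *)
Lemma is_weak_grad_schwarz : is_weak_grad (schwarz f) (weak_grad (schwarz f)).
Proof.
apply: weak_grad_exists.
apply: (is_weak_grad_affine (a := a) (mulmxV uA) (mulVmx uA) mulmx_preserving
  continuous_schwarz _ weak_f) => y.
by rewrite fA addrK mulmxKV.
Qed.

End equality.
End sobolev_rearrangement.

(** The affine map is onto, so the symmetral vanishes everywhere as well. *)
Lemma eq_schwarz_of_zero (R : realType) (n : nat) (f : 'rV[R]_n -> R) (A : 'M[R]_n) (a : 'rV[R]_n) :
  A \in unitmx -> (forall x, f x = schwarz f ((x - a) *m A)) ->
  (forall x, f x = 0) -> f = schwarz f.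
Proof.
move=> uA fA f0; apply/funext => y.
by have := fA (y *m invmx A + a); rewrite addrK mulmxKV // !f0.
Qed.

Theorem corollary5p6 (R : realType) (n : nat) (n_gt0 : (0 < n)%N)
    (f : 'rV[R]_n -> R)
    (fW : sobolev_1_infty f) (f_ge0 : forall x, 0 <= f x) :
  [/\ (* (i) *)
      forall s : R, 0 < s < 1 ->
        [/\ (vol_negpow (Pi_frac_pos s f) (s / n%:R) >=
               vol_negpow (Pi_frac_pos s (schwarz f)) (s / n%:R))%E,
            (vol_negpow (Pi_frac_neg s f) (s / n%:R) >=
               vol_negpow (Pi_frac_neg s (schwarz f)) (s / n%:R))%E &
            (vol_negpow (Pi_frac s f) (s / n%:R) >=
               vol_negpow (Pi_frac s (schwarz f)) (s / n%:R))%E],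
      (* (ii) *)
      [/\ (vol_negpow (Pi_grad_pos f) n%:R^-1 >=
             vol_negpow (Pi_grad_pos (schwarz f)) n%:R^-1)%E,
          (vol_negpow (Pi_grad_neg f) n%:R^-1 >=
             vol_negpow (Pi_grad_neg (schwarz f)) n%:R^-1)%E &
          (vol_negpow (Pi_grad f) n%:R^-1 >=
             vol_negpow (Pi_grad (schwarz f)) n%:R^-1)%E] &
      (* equality case *)
      forall (A : 'M[R]_n) (a : 'rV[R]_n), \det A = 1 ->
        (forall x, f x = schwarz f ((x - a) *m A)) ->
        (forall s : R, 0 < s < 1 ->
          [/\ vol_negpow (Pi_frac_pos s f) (s / n%:R) =
                vol_negpow (Pi_frac_pos s (schwarz f)) (s / n%:R),
              vol_negpow (Pi_frac_neg s f) (s / n%:R) =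
                vol_negpow (Pi_frac_neg s (schwarz f)) (s / n%:R) &
              vol_negpow (Pi_frac s f) (s / n%:R) =
                vol_negpow (Pi_frac s (schwarz f)) (s / n%:R)]) /\
        [/\ vol_negpow (Pi_grad_pos f) n%:R^-1 =
              vol_negpow (Pi_grad_pos (schwarz f)) n%:R^-1,
            vol_negpow (Pi_grad_neg f) n%:R^-1 =
              vol_negpow (Pi_grad_neg (schwarz f)) n%:R^-1 &
            vol_negpow (Pi_grad f) n%:R^-1 =
              vol_negpow (Pi_grad (schwarz f)) n%:R^-1]].
Proof.
have [M f_le] := sobolev_bounded fW.
have cf := sobolev_continuous fW.
have f_fin := sobolev_superlevel_fin fW f_ge0.
have pos0 (a : R) : 0 <= pos_part a by exact: pos_part_ge0.
have neg0 (a : R) : 0 <= neg_part a by rewrite neg_partE; exact: pos_part_ge0.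
have norm0 (a : R) : 0 <= normr a by exact: normr_ge0.
have cn : continuous (normr : R -> R) by exact: (@norm_continuous _ R^o).
have cp := @continuous_pos_part R.
have cneg := @continuous_neg_part R.
have sn0 (s : R) : 0 < s -> 0 <= s / n%:R by move=> s0; rewrite divr_ge0 // ltW.
have wf : is_weak_grad f (weak_grad f) by case: fW => -[].
split.
- move=> s /andP[s0 _]; split; apply: (vol_negpow_le (sn0 s s0)).
  + by rewrite /Pi_frac_pos !Pi_fdE //; exact: (fd_pos_schwarz n_gt0 cf f_le f_fin s0).
  + by rewrite /Pi_frac_neg !Pi_fdE //; exact: (fd_neg_schwarz n_gt0 cf f_le f_fin s0).
  + by rewrite /Pi_frac !Pi_fdE //; exact: (fd_norm_schwarz n_gt0 cf f_le f_fin s0).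
- split.
  + apply: (vol_grad_schwarz n_gt0 fW f_ge0 cp); first by rewrite /pos_part maxxx ler01.
      by move=> g; exact: Pi_grad_posE.
    exact: (fd_pos_schwarz n_gt0 cf f_le f_fin ltr01).
  + apply: (vol_grad_schwarz n_gt0 fW f_ge0 cneg); first by rewrite /neg_part oppr0 maxxx ler01.
      by move=> g; exact: Pi_grad_negE.
    exact: (fd_neg_schwarz n_gt0 cf f_le f_fin ltr01).
  + apply: (vol_grad_schwarz n_gt0 fW f_ge0 cn); first by rewrite normr0 ler01.
      by move=> g; exact: Pi_gradE.
    exact: (fd_norm_schwarz n_gt0 cf f_le f_fin ltr01).
- move=> A a detA fA.
  (* For [f = 0] there is no superlevel set to calibrate [A], but then [f] equals its symmetral and
     the equalities are trivial. *)
  have [f0|f_neq0] := pselect (forall x, f x = 0).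
    have uA : A \in unitmx by rewrite unitmxE detA unitr1.
    by have <- := eq_schwarz_of_zero uA fA f0.
  have {}f_neq0 : exists x, f x != 0.
    by move/existsNP: f_neq0 => [x /eqP fx]; exists x.
  have vol K K' (b : R) : (lebesgue_rV n K = lebesgue_rV n K')%E ->
      vol_negpow K b = vol_negpow K' b by rewrite /vol_negpow => ->.
  have muE := lebesgue_fd_set_affine n_gt0 fW f_ge0 detA fA f_neq0.
  have cF := continuous_schwarz n_gt0 fW f_ge0.
  have wF := is_weak_grad_schwarz n_gt0 fW f_ge0 detA fA f_neq0.
  split.
    move=> s /andP[s0 _]; split; apply: vol.
    + by rewrite /Pi_frac_pos !Pi_fdE //; exact: muE.
    + by rewrite /Pi_frac_neg !Pi_fdE //; exact: muE.
    + by rewrite /Pi_frac !Pi_fdE //; exact: muE.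
  split; apply: vol.
  + by rewrite (Pi_grad_posE cf wf) (Pi_grad_posE cF wF); exact: muE.
  + by rewrite (Pi_grad_negE cf wf) (Pi_grad_negE cF wF); exact: muE.
  + by rewrite (Pi_gradE cf wf) (Pi_gradE cF wF); exact: muE.
Qed.
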